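(* Let $g\in L^2(\mathbb{R}^m)$ and let $\Lambda$ be a countable family of points of $\mathbb{R}^{2m}$ (repetitions allowed) such that the Gabor set $\mathcal{G}(g,\Lambda)$ is a frame for $L^2(\mathbb{R}^m)$. Then $\mathcal{G}(g,\Lambda)$ is non-expansive with respect to the quasi-metric index set $(\Lambda,\|\cdot\|_\infty)$.
   Context: For $\lambda=(t,\omega)\in\mathbb{R}^m\times\mathbb{R}^m$ and phase $\varphi_\lambda$, $g_\lambda(x)=e^{i\varphi_\lambda}e^{2\pi i\langle\omega,x\rangle}g(x-t)$, $\mathcal{G}(g,\Lambda)=\{g_\lambda\}_{\lambda\in\Lambda}$ (arbitrary fixed phases). $\Lambda$ is an index set with quasi-distance $d(\lambda,\lambda')=\|\lambda-\lambda'\|_\infty$ and balls $B_N(\lambda)=\{\lambda':d(\lambda',\lambda)\le N\}$. With $\{\delta_\lambda\}$ the canonical basis of $\ell^2(\Lambda)$, an operator $A$ is row non-expansive if for every $\varepsilon>0$ there is $N$ with $\sum_{\lambda'\notin B_N(\lambda)}|\langle A\delta_\lambda,\delta_{\lambda'}\rangle|^2<\varepsilon$ for all $\lambda$, and non-expansive if $A$ and $A^*$ are row non-expansive. A frame is non-expansive if its associated Gram projection (the orthogonal projection of $\ell^2(\Lambda)$ onto the range of the analysis operator $h\mapsto(\langle h,g_\lambda\rangle)_\lambda$) is non-expansive. *)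

(* Defs.v *)
(* MathComp-Analysis (measure/integration over R : realType)
   + real_closed's complex numbers R[i]. *)
From HB Require Import structures.
From mathcomp Require Import all_boot all_order all_algebra.
From mathcomp Require Import all_classical all_reals all_analysis.
From mathcomp Require Import complex.

Set Implicit Arguments.
Unset Strict Implicit.
Unset Printing Implicit Defensive.

Import Order.TTheory GRing.Theory Num.Theory.
Import numFieldNormedType.Exports.

Local Open Scope classical_set_scope.
Local Open Scope ring_scope.
Local Open Scope complex_scope.

Notation cRe := (@complex.Re _).
Notation cIm := (@complex.Im _).

Section Gabor.
Variable R : realType.

(** Points of R^m are m-tuples of reals; m.-tuple R carries the product
    (Borel) sigma-algebra generated by the coordinate projections. *)

(** Characterization of Lebesgue measure on R^m: the (unique) measure on the
    product Borel sigma-algebra giving to every closed box its volume. *)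
Definition is_lebesgue_Rm (m : nat) (mu : {measure set (m.-tuple R) -> \bar R}) : Prop :=
  forall a b : m.-tuple R, (forall i, tnth a i <= tnth b i) ->
    mu [set x | forall i, tnth a i <= tnth x i <= tnth b i] =
    (\prod_(i < m) (tnth b i - tnth a i))%:E.

(** Squared modulus of a complex number. *)
Definition csq (z : R[i]) : R := cRe z ^+ 2 + cIm z ^+ 2.

(** e^{i theta} *)
Definition expi (th : R) : R[i] := cos th +i* sin th.

(** f is in L^2(mu) (complex valued). *)
Definition L2 (m : nat) (mu : {measure set (m.-tuple R) -> \bar R})
    (f : m.-tuple R -> R[i]) : Prop :=
  [/\ measurable_fun [set: m.-tuple R] (fun x => cRe (f x)),
      measurable_fun [set: m.-tuple R] (fun x => cIm (f x)) &
      (\int[mu]_x (csq (f x))%:E < +oo)%E].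

(** L^2 inner product <f, g> = \int f conj(g). *)
Definition L2dot (m : nat) (mu : {measure set (m.-tuple R) -> \bar R})
    (f g : m.-tuple R -> R[i]) : R[i] :=
  Rintegral mu [set: m.-tuple R] (fun x => cRe (f x * (g x)^*)) +i*
  Rintegral mu [set: m.-tuple R] (fun x => cIm (f x * (g x)^*)).

(** Squared L^2 norm. *)
Definition L2normsq (m : nat) (mu : {measure set (m.-tuple R) -> \bar R})
    (f : m.-tuple R -> R[i]) : R :=
  Rintegral mu [set: m.-tuple R] (fun x => csq (f x)).

Definition dotR (m : nat) (u v : m.-tuple R) : R := \sum_(i < m) tnth u i * tnth v i.

Definition subT (m : nat) (u v : m.-tuple R) : m.-tuple R :=
  [tuple tnth u i - tnth v i | i < m].

(** Gabor atom g_lambda(x) = e^{i ph} e^{2 pi i <w,x>} g(x - t), lambda = (t,w). *)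
Definition gabor_atom (m : nat) (g : m.-tuple R -> R[i]) (ph : R)
    (lam : m.-tuple R * m.-tuple R) : m.-tuple R -> R[i] :=
  fun x => expi ph * expi (2 * pi * dotR lam.2 x) * g (subT x lam.1).

(** Frame for L^2(R^m). *)
Definition is_frame (m : nat) (mu : {measure set (m.-tuple R) -> \bar R})
    (I : countType) (e : I -> m.-tuple R -> R[i]) : Prop :=
  exists A B : R, [/\ 0 < A, 0 < B & forall h, L2 mu h ->
    ((A * L2normsq mu h)%:E <= \esum_(i in [set: I]) (csq (L2dot mu h (e i)))%:E)%E /\
    (\esum_(i in [set: I]) (csq (L2dot mu h (e i)))%:E <= (B * L2normsq mu h)%:E)%E].

(** ell^2(I) and absolutely summable sums over a countable index set. *)
Definition ell2 (I : countType) (c : I -> R[i]) : Prop :=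
  (\esum_(i in [set: I]) (csq (c i))%:E < +oo)%E.

Definition rsum (I : countType) (f : I -> R) : R :=
  fine (\esum_(i in [set: I]) (f^\+ i)%:E) - fine (\esum_(i in [set: I]) (f^\- i)%:E).

Definition csum (I : countType) (f : I -> R[i]) : R[i] :=
  rsum (fun i => cRe (f i)) +i* rsum (fun i => cIm (f i)).

(** Inner product on ell^2(I). *)
Definition ell2dot (I : countType) (c d : I -> R[i]) : R[i] :=
  csum (fun i => c i * (d i)^*).

(** Range of the analysis operator h |-> (<h, e_i>)_i. *)
Definition analysis_range (m : nat) (mu : {measure set (m.-tuple R) -> \bar R})
    (I : countType) (e : I -> m.-tuple R -> R[i]) : set (I -> R[i]) :=
  [set c | exists h, L2 mu h /\ c = fun i => L2dot mu h (e i)].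

(** P is the orthogonal projection of ell^2(I) onto V. *)
Definition is_orth_proj (I : countType) (V : set (I -> R[i]))
    (P : (I -> R[i]) -> (I -> R[i])) : Prop :=
  forall c, ell2 c -> V (P c) /\ forall v, V v -> ell2dot (fun i => c i - P c i) v = 0.

(** Gram projection of the system e. *)
Definition is_gram_projection (m : nat) (mu : {measure set (m.-tuple R) -> \bar R})
    (I : countType) (e : I -> m.-tuple R -> R[i]) (P : (I -> R[i]) -> (I -> R[i])) : Prop :=
  is_orth_proj (analysis_range mu e) P.

(** Canonical basis vector delta_l. *)
Definition delta (I : countType) (l : I) : I -> R[i] :=
  fun j => if j == l then 1 else 0.

(** sup-norm distance on R^{2m} between lambda = (t,w) and lambda' = (t',w'). *)
Definition dinf (m : nat) (p q : m.-tuple R * m.-tuple R) : R :=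
  Num.max (\big[Num.max/0]_(i < m) `|tnth p.1 i - tnth q.1 i|)
          (\big[Num.max/0]_(i < m) `|tnth p.2 i - tnth q.2 i|).

(** Matrix entries M l l' = <A delta_l, delta_l'> of the operator A. *)
Definition op_entries (I : countType) (A : (I -> R[i]) -> (I -> R[i])) : I -> I -> R[i] :=
  fun l l' => A (delta l) l'.

(** Entries of the adjoint: <A^* delta_l, delta_l'> = conj <A delta_l', delta_l>. *)
Definition adj_entries (I : countType) (M : I -> I -> R[i]) : I -> I -> R[i] :=
  fun l l' => (M l' l)^*.

(** Row non-expansive (w.r.t. the quasi-distance d on the index set). *)
Definition row_nonexpansive (I : countType) (d : I -> I -> R) (M : I -> I -> R[i]) : Prop :=
  forall eps : R, 0 < eps -> exists N : R, forall l : I,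
    (\esum_(l' in [set l' | ~ (d l' l <= N)%R]) (csq (M l l'))%:E < eps%:E)%E.

Definition nonexpansive (I : countType) (d : I -> I -> R) (A : (I -> R[i]) -> (I -> R[i])) : Prop :=
  row_nonexpansive d (op_entries A) /\ row_nonexpansive d (adj_entries (op_entries A)).

End Gabor.

(* Main.v *)
(* The entries of the Gram projection are <h_l, g_j>, where h_l = S^-1 g_l is the
   dual frame. The Richardson iteration f' = f + (g_l - S f) / B converges to h_l
   geometrically, uniformly in l. Each step keeps the coefficients localized
   around l, even with S truncated to a ball, because balls contain boundedly
   many indices and the tails of the rows of the Gram matrix (<g_l, g_j>)_j are
   uniformly small.

   By covariance the latter says that the sums of |<f, pi(mu) g>|^2 over the
   points mu of Lambda - lambda_l with |mu| > N tend to 0 uniformly in l, for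
   f = g. The f with this property form a closed subspace, so it suffices to
   treat C^{1,1} tensor bumps f. If the property failed for such an f, one could
   superpose many far-apart finite pieces of the sets Lambda - lambda_l into one
   sparse set M carrying arbitrarily large mass; but {pi(-mu) f : mu in M} is a
   Bessel family, by the Schur test, since |<f, pi(t,w) f>| decays quadratically
   in every coordinate. *)
Require Import Defs.
From HB Require Import structures.
From mathcomp Require Import all_boot all_order all_algebra finmap.
From mathcomp Require Import all_classical all_reals all_analysis.
From mathcomp Require Import complex measurable_realfun.
From mathcomp Require Import ring lra.

Set Implicit Arguments.
Unset Strict Implicit.
Unset Printing Implicit Defensive.

Import Order.TTheory GRing.Theory Num.Theory.
Import numFieldNormedType.Exports.

Local Open Scope classical_set_scope.
Local Open Scope complex_scope.
Local Open Scope ring_scope.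

(** * Complex modulus and the L^2 inner product *)

Section ComplexModulus.
Variable R : realType.
Implicit Types x y z : R[i].

(** The centred sets [Lambda - lambda_l] for different [l] need not lie in one translate of
    [Lambda], so the frame's own Bessel bound says nothing about a union of pieces of them. This is
    why reflection moves the shift from [g] to the bump: the Bessel bound for the atoms of a bump
    depends on the points only through a radius and a count, and widely separated pieces keep both.
    The count comes from the frame: some bump is not orthogonal to [g], and each point close to a
    given one contributes a fixed amount to a Bessel sum of that bump.

    Neither the frame operator [S] nor its inverse is built. The function [h_l] is any one whose
    coefficients are the projection of the basis vector at [l]; orthogonality gives [S h_l = g_l]
    weakly, and errors are estimated through the quadratic form of [I - S / B]. Only real parts of
    inner products on [ell2] are computed; multiplication by [i] recovers imaginary parts. The
    projection is Hermitian, so its columns have the same tails as its rows. *)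

Lemma complexE z : z = cRe z +i* cIm z.
Proof. by case: z. Qed.

Lemma conjE z : z^* = cRe z +i* - cIm z.
Proof. by case: z. Qed.

Lemma csq_ge0 z : 0 <= csq z.
Proof. by rewrite addr_ge0 ?sqr_ge0. Qed.

Lemma csqM x y : csq (x * y) = csq x * csq y.
Proof. by case: x y => [a b] [c d]; rewrite /csq /=; ring. Qed.

Lemma csq_conj z : csq z^* = csq z.
Proof. by rewrite conjE /csq /= sqrrN. Qed.

Lemma csqN z : csq (- z) = csq z.
Proof. by case: z => [a b]; rewrite /csq /= !sqrrN. Qed.

Lemma csq0 : csq (0 : R[i]) = 0.
Proof. by rewrite /csq /= expr0n addr0. Qed.

Lemma csq1 : csq (1 : R[i]) = 1.
Proof. by rewrite /csq /= expr0n expr1n addr0. Qed.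

Lemma csq_real (r : R) : csq r%:C = r ^+ 2.
Proof. by rewrite /csq /= expr0n addr0. Qed.

Lemma csq_expi (t : R) : csq (expi t) = 1.
Proof. by rewrite /csq /= cos2Dsin2. Qed.

Lemma csqD_le x y : csq (x + y) <= 2 * csq x + 2 * csq y.
Proof.
case: x y => [a b] [c d]; rewrite /csq /=.
have := sqr_ge0 (a - c); have := sqr_ge0 (b - d); nra.
Qed.

Lemma csqB_le x y : csq (x - y) <= 2 * csq x + 2 * csq y.
Proof. by rewrite -(csqN y); exact: csqD_le. Qed.

Lemma Re_sqr_le z : (cRe z) ^+ 2 <= csq z.
Proof. by rewrite lerDl sqr_ge0. Qed.

Lemma Im_sqr_le z : (cIm z) ^+ 2 <= csq z.
Proof. by rewrite lerDr sqr_ge0. Qed.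

Lemma norm_Re_le z : `|cRe z| <= Num.sqrt (csq z).
Proof. by rewrite -sqrtr_sqr ler_wsqrtr // Re_sqr_le. Qed.

Lemma sqrt_csq_le z : Num.sqrt (csq z) <= `|cRe z| + `|cIm z|.
Proof.
rewrite -(ger0_norm (addr_ge0 (normr_ge0 (cRe z)) (normr_ge0 (cIm z)))).
rewrite -sqrtr_sqr ler_wsqrtr // sqrrD !real_normK ?num_real // /csq.
have : 0 <= `|cRe z| * `|cIm z| by rewrite mulr_ge0.
lra.
Qed.

(** Cauchy-Schwarz against the constant 1, by induction. The weights [1 + n] and [1 + n^-1] in the
    Young inequality are those that turn the inductive bound [n * Q] into [(n + 1) * Q]. *)
Lemma csq_sum_le (T : Type) (s : seq T) (F : T -> R[i]) :
  csq (\sum_(t <- s) F t) <= (size s)%:R * \sum_(t <- s) csq (F t).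
Proof.
elim: s => [|t s IH]; first by rewrite !big_nil csq0 mulr0.
rewrite !big_cons /= -natr1.
set S := \sum_(i <- s) F i in IH *; set Q := \sum_(i <- s) csq (F i) in IH *.
have Q0 : 0 <= Q by apply: sumr_ge0 => *; exact: csq_ge0.
case: (posnP (size s)) => [/size0nil s0|s0].
  by rewrite /S /Q s0 /= !big_nil !addr0 add0r mul1r.
have n0 : (0 : R) < (size s)%:R by rewrite ltr0n.
set n : R := (size s)%:R in IH n0 *.
have : csq (F t + S) <= (1 + n) * csq (F t) + (1 + n^-1) * csq S.
  case: (F t) S {IH} => [a b] [c d]; rewrite /csq /=.
  have -> : (1 + n) * (a ^+ 2 + b ^+ 2) + (1 + n^-1) * (c ^+ 2 + d ^+ 2) =
    (a + c) ^+ 2 + (b + d) ^+ 2 + n^-1 * ((n * a - c) ^+ 2 + (n * b - d) ^+ 2).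
    by field; rewrite gt_eqF.
  by rewrite lerDl mulr_ge0 ?invr_ge0 ?addr_ge0 ?sqr_ge0 // ltW.
move=> /le_trans; apply.
have -> : (n + 1) * (csq (F t) + Q) = (1 + n) * csq (F t) + (1 + n^-1) * (n * Q).
  by field; rewrite gt_eqF.
by rewrite lerD2l; apply: ler_wpM2l => //; rewrite addr_ge0 // invr_ge0 ltW.
Qed.

(** Common source of the Cauchy-Schwarz inequalities below: in L^2, in [ell2], for the positive form
    [frame_defect], and in the Schur test. *)
Lemma discriminant_le (a b c : R) :
  (forall s, 0 <= a + 2 * s * b + s ^+ 2 * c) -> b ^+ 2 <= a * c.
Proof.
move=> H.
have c0 : 0 <= c.
  rewrite leNgt; apply/negP => c0.
  have := H 0; rewrite !(mulr0, mul0r, expr0n, addr0) /= => a0.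
  (* Adding [H t] and [H (- t)] removes [b]. Since [t >= 1] and [t * - c > a], the remaining
     [a + t ^+ 2 * c] is negative. *)
  pose t := (a + 1 + `|b|) / (- c) + 1.
  have nc : 0 < - c by lra.
  have t1 : 1 <= t by rewrite /t lerDr divr_ge0 ?(ltW nc) // addr_ge0 // addr_ge0.
  have tc : t * (- c) = a + 1 + `|b| - c by rewrite /t; field; lra.
  have h1 := H t; have h2 := H (- t).
  have : 0 <= a + t ^+ 2 * c by lra.
  have -> : t ^+ 2 * c = - (t * (t * - c)) by ring.
  rewrite tc; have := normr_ge0 b; nra.
case: (eqVneq c 0) => [c00|cn0].
  subst c; rewrite mulr0.
  have := H 0; rewrite !(mulr0, mul0r, expr0n, addr0) /= => a0.
  case: (eqVneq b 0) => [->|bn0]; first by rewrite expr0n.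
  have := H (- (a + 1) / (2 * b)).
  have -> : a + 2 * (- (a + 1) / (2 * b)) * b + (- (a + 1) / (2 * b)) ^+ 2 * 0 = -1.
    by field.
  by lra.
have c_gt0 : 0 < c by rewrite lt_neqAle c0 eq_sym cn0.
have := H (- b / c).
have -> : a + 2 * (- b / c) * b + (- b / c) ^+ 2 * c = (a * c - b ^+ 2) / c by field.
by rewrite pmulr_lge0 ?invr_gt0 // subr_ge0.
Qed.

End ComplexModulus.

Section L2Space.
Variables (R : realType) (m : nat) (mu : {measure set (m.-tuple R) -> \bar R}).
Local Notation X := (m.-tuple R).
Implicit Types (f g h : X -> R[i]) (z : R[i]).

Definition cmeas f := measurable_fun [set: X] (fun x => cRe (f x)) /\
  measurable_fun [set: X] (fun x => cIm (f x)).

Lemma cmeasD f g : cmeas f -> cmeas g -> cmeas (fun x => f x + g x).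
Proof.
case=> fr fi [gr gi]; split.
- rewrite (_ : (fun x => _) = (fun x => cRe (f x)) \+ (fun x => cRe (g x))).
    exact: measurable_funD.
  by apply/funext => x /=; case: (f x) (g x) => ? ? [].
- rewrite (_ : (fun x => _) = (fun x => cIm (f x)) \+ (fun x => cIm (g x))).
    exact: measurable_funD.
  by apply/funext => x /=; case: (f x) (g x) => ? ? [].
Qed.

Lemma cmeasM f g : cmeas f -> cmeas g -> cmeas (fun x => f x * g x).
Proof.
case=> fr fi [gr gi]; split.
- rewrite (_ : (fun x => _) =
    ((fun x => cRe (f x)) \* (fun x => cRe (g x))) \-
    ((fun x => cIm (f x)) \* (fun x => cIm (g x)))).
    by apply: measurable_funB; apply: measurable_funM.
  by apply/funext => x /=; case: (f x) (g x) => ? ? [].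
- rewrite (_ : (fun x => _) =
    ((fun x => cRe (f x)) \* (fun x => cIm (g x))) \+
    ((fun x => cIm (f x)) \* (fun x => cRe (g x)))).
    by apply: measurable_funD; apply: measurable_funM.
  by apply/funext => x /=; case: (f x) (g x) => ? ? [].
Qed.

Lemma cmeas_conj f : cmeas f -> cmeas (fun x => (f x)^*).
Proof.
case=> fr fi; split.
- rewrite (_ : (fun x => _) = (fun x => cRe (f x))) //.
  by apply/funext => x /=; rewrite conjE.
- rewrite (_ : (fun x => _) = \- (fun x => cIm (f x))); first exact: measurable_funN.
  by apply/funext => x /=; rewrite conjE.
Qed.

Lemma cmeas_cst z : cmeas (fun=> z).
Proof. by split; exact: measurable_cst. Qed.

Lemma cmeas_real (f : X -> R) : measurable_fun setT f -> cmeas (fun x => (f x)%:C).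
Proof. by move=> mf; split => //=; exact: measurable_cst. Qed.

Lemma cmeas_comp f (t : X -> X) : measurable_fun setT t -> cmeas f -> cmeas (f \o t).
Proof.
move=> mt [fr fi]; split.
- exact: (measurableT_comp fr mt).
- exact: (measurableT_comp fi mt).
Qed.

Lemma measurable_csq f : cmeas f -> measurable_fun setT (fun x => csq (f x)).
Proof. by case=> fr fi; apply: measurable_funD; apply: measurable_funX. Qed.

Lemma L2_cmeas f : L2 mu f -> cmeas f.
Proof. by case. Qed.

Lemma L2_integrable f : L2 mu f -> mu.-integrable setT (fun x => (csq (f x))%:E).
Proof.
move=> Lf; have mf := measurable_csq (L2_cmeas Lf); case: Lf => _ _ fi.
apply/integrableP; split; first exact/measurable_EFinP.
by under eq_integral do rewrite gee0_abs ?lee_fin ?csq_ge0 //.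
Qed.

Lemma integrable_L2 f : cmeas f ->
  mu.-integrable setT (fun x => (csq (f x))%:E) -> L2 mu f.
Proof.
move=> [fr fi] /integrableP[_ H]; split => //.
by under eq_integral do rewrite -[(csq _)%:E]gee0_abs ?lee_fin ?csq_ge0 //.
Qed.

Lemma L2_dominated f (F : X -> R) : cmeas f -> mu.-integrable setT (EFin \o F) ->
  (forall x, csq (f x) <= F x) -> L2 mu f.
Proof.
move=> mf iF le; apply: integrable_L2 => //.
apply: le_integrable iF => //; first by apply/measurable_EFinP; exact: measurable_csq.
move=> x _ /=; rewrite lee_fin ger0_norm ?csq_ge0 //.
by rewrite (le_trans (le x)) // ler_norm.
Qed.

Lemma L2D f g : L2 mu f -> L2 mu g -> L2 mu (fun x => f x + g x).
Proof.
move=> Lf Lg.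
apply: (@L2_dominated _ (fun x => 2 * csq (f x) + 2 * csq (g x))).
- by apply: cmeasD; exact: L2_cmeas.
- rewrite (_ : _ \o _ =
    (fun x => (2%:E * (csq (f x))%:E) + (2%:E * (csq (g x))%:E))%E) //.
  by apply: integrableD => //; apply: integrableZl => //; exact: L2_integrable.
- by move=> x; exact: csqD_le.
Qed.

Lemma L2Z z f : L2 mu f -> L2 mu (fun x => z * f x).
Proof.
move=> Lf.
apply: (@L2_dominated _ (fun x => csq z * csq (f x))).
- by apply: cmeasM; [exact: cmeas_cst|exact: L2_cmeas].
- rewrite (_ : _ \o _ = (fun x => ((csq z)%:E * (csq (f x))%:E))%E) //.
  by apply: integrableZl => //; exact: L2_integrable.
- by move=> x; rewrite csqM.
Qed.

Lemma L2N f : L2 mu f -> L2 mu (fun x => - f x).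
Proof.
move=> /(L2Z (-1)); congr L2; apply/funext => x; exact: mulN1r.
Qed.

Lemma L2B f g : L2 mu f -> L2 mu g -> L2 mu (fun x => f x - g x).
Proof. by move=> Lf /L2N; exact: L2D. Qed.

Lemma L2_0 : L2 mu (fun=> 0).
Proof.
split; [exact: measurable_cst|exact: measurable_cst|].
by rewrite integral0_eq ?ltry // => x _; rewrite csq0.
Qed.

Lemma L2_sum (T : Type) (s : seq T) (a : T -> R[i]) (F : T -> X -> R[i]) :
  (forall t, L2 mu (F t)) -> L2 mu (fun x => \sum_(t <- s) a t * F t x).
Proof.
move=> LF; elim: s => [|t s IH].
  by under eq_fun do rewrite big_nil; exact: L2_0.
under eq_fun do rewrite big_cons.
by apply: L2D => //; exact: L2Z.
Qed.

Lemma L2_mul_integrable f g : L2 mu f -> L2 mu g ->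
  mu.-integrable setT (EFin \o (fun x => cRe (f x * (g x)^*))) /\
  mu.-integrable setT (EFin \o (fun x => cIm (f x * (g x)^*))).
Proof.
move=> Lf Lg.
have [mr mi] : cmeas (fun x => f x * (g x)^*).
  by apply: cmeasM; [|apply: cmeas_conj]; exact: L2_cmeas.
have iF : mu.-integrable setT (EFin \o (fun x => csq (f x) + csq (g x))).
  rewrite (_ : _ \o _ = (fun x => ((csq (f x))%:E + (csq (g x))%:E)%E)) //.
  by apply: integrableD => //; exact: L2_integrable.
have le y : `|cRe (f y * (g y)^*)| <= csq (f y) + csq (g y) /\
            `|cIm (f y * (g y)^*)| <= csq (f y) + csq (g y).
  rewrite conjE; case: (f y) (g y) => [a b] [c d]; rewrite /csq /= !ler_norml.
  have := sqr_ge0 (a - c); have := sqr_ge0 (b - d).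
  have := sqr_ge0 (a + c); have := sqr_ge0 (b + d).
  have := sqr_ge0 (a - d); have := sqr_ge0 (b - c).
  have := sqr_ge0 (a + d); have := sqr_ge0 (b + c).
  by move=> *; split; apply/andP; split; nra.
split; apply: le_integrable iF => //.
- exact/measurable_EFinP.
- move=> y _ /=; rewrite lee_fin [leRHS]ger0_norm ?(addr_ge0 (csq_ge0 _) (csq_ge0 _)) //.
  by case: (le y).
- exact/measurable_EFinP.
- move=> y _ /=; rewrite lee_fin [leRHS]ger0_norm ?(addr_ge0 (csq_ge0 _) (csq_ge0 _)) //.
  by case: (le y).
Qed.

Lemma integrable_Rmull (F : X -> R) (k : R) : mu.-integrable setT (EFin \o F) ->
  mu.-integrable setT (EFin \o (fun x => k * F x)).
Proof. by move=> /(integrableZl measurableT k). Qed.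

Lemma L2dotDl f g h : L2 mu f -> L2 mu g -> L2 mu h ->
  L2dot mu (fun x => f x + g x) h = L2dot mu f h + L2dot mu g h.
Proof.
move=> Lf Lg Lh.
have [fr fi] := L2_mul_integrable Lf Lh; have [gr gi] := L2_mul_integrable Lg Lh.
rewrite /L2dot; simpc; congr (_ +i* _); rewrite -RintegralD //;
  apply: eq_Rintegral => x _; rewrite mulrDl //;
  by case: (f x * _) (g x * _) => ? ? [].
Qed.

Lemma L2dotZl z f h : L2 mu f -> L2 mu h ->
  L2dot mu (fun x => z * f x) h = z * L2dot mu f h.
Proof.
move=> Lf Lh; have [fr fi] := L2_mul_integrable Lf Lh.
rewrite {2}(complexE z) /L2dot [RHS]/GRing.mul /=; congr (_ +i* _).
- rewrite -!RintegralZl // -RintegralB //; try exact: integrable_Rmull.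
  by apply: eq_Rintegral => x _; rewrite -(mulrA z (f x)); case: z (f x * _) => ? ? [].
- rewrite -!RintegralZl // -RintegralD //; try exact: integrable_Rmull.
  by apply: eq_Rintegral => x _; rewrite -(mulrA z (f x)); case: z (f x * _) => ? ? [].
Qed.

Lemma L2dotC f g : L2 mu f -> L2 mu g -> L2dot mu g f = (L2dot mu f g)^*.
Proof.
move=> Lf Lg; have [fr fi] := L2_mul_integrable Lf Lg.
rewrite /L2dot /=; congr (_ +i* _).
- by apply: eq_Rintegral => x _; rewrite !conjE; case: (f x) (g x) => ? ? [] /= ? ?; ring.
- rewrite -[RHS]mulN1r -RintegralZl //.
  by apply: eq_Rintegral => x _; rewrite !conjE; case: (f x) (g x) => ? ? [] /= ? ?; ring.
Qed.

Lemma L2dotNl f h : L2 mu f -> L2 mu h ->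
  L2dot mu (fun x => - f x) h = - L2dot mu f h.
Proof.
move=> Lf Lh; rewrite -mulN1r -L2dotZl //; congr L2dot.
by apply/funext => x; rewrite mulN1r.
Qed.

Lemma L2dotBl f g h : L2 mu f -> L2 mu g -> L2 mu h ->
  L2dot mu (fun x => f x - g x) h = L2dot mu f h - L2dot mu g h.
Proof. by move=> Lf Lg Lh; rewrite L2dotDl ?L2dotNl //; exact: L2N. Qed.

Lemma L2dotDr f g h : L2 mu f -> L2 mu g -> L2 mu h ->
  L2dot mu h (fun x => f x + g x) = L2dot mu h f + L2dot mu h g.
Proof.
move=> Lf Lg Lh; rewrite (L2dotC (L2D Lf Lg) Lh) L2dotDl //.
by rewrite (L2dotC Lf Lh) (L2dotC Lg Lh) rmorphD.
Qed.

Lemma L2dotZr z f h : L2 mu f -> L2 mu h ->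
  L2dot mu h (fun x => z * f x) = z^* * L2dot mu h f.
Proof.
move=> Lf Lh; by rewrite (L2dotC (L2Z z Lf) Lh) L2dotZl // (L2dotC Lf Lh) rmorphM.
Qed.

Lemma L2dotBr f g h : L2 mu f -> L2 mu g -> L2 mu h ->
  L2dot mu h (fun x => f x - g x) = L2dot mu h f - L2dot mu h g.
Proof.
move=> Lf Lg Lh; rewrite (L2dotC (L2B Lf Lg) Lh) L2dotBl //.
by rewrite (L2dotC Lf Lh) (L2dotC Lg Lh) rmorphB.
Qed.

Lemma L2dot_suml (T : Type) (s : seq T) (a : T -> R[i]) (F : T -> X -> R[i]) h :
  (forall t, L2 mu (F t)) -> L2 mu h ->
  L2dot mu (fun x => \sum_(t <- s) a t * F t x) h =
  \sum_(t <- s) a t * L2dot mu (F t) h.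
Proof.
move=> LF Lh; elim: s => [|t s IH].
  rewrite big_nil -[RHS](mul0r (L2dot mu h h)) -L2dotZl //; congr L2dot.
  by apply/funext => x; rewrite big_nil mul0r.
rewrite big_cons -IH -L2dotZl // -L2dotDl //; [|exact: L2Z|exact: L2_sum].
by congr L2dot; apply/funext => x; rewrite big_cons.
Qed.

Lemma L2dot_sumr (T : Type) (s : seq T) (a : T -> R[i]) (F : T -> X -> R[i]) h :
  (forall t, L2 mu (F t)) -> L2 mu h ->
  L2dot mu h (fun x => \sum_(t <- s) a t * F t x) =
  \sum_(t <- s) (a t)^* * L2dot mu h (F t).
Proof.
move=> LF Lh; rewrite (L2dotC (L2_sum s a LF) Lh) L2dot_suml // rmorph_sum.
by apply: eq_bigr => t _; rewrite (L2dotC (LF t) Lh) rmorphM.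
Qed.

Lemma L2dotff f : L2 mu f -> L2dot mu f f = (L2normsq mu f)%:C.
Proof.
move=> Lf; rewrite /L2dot /L2normsq; congr (_ +i* _).
  by apply: eq_Rintegral => x _; rewrite conjE /csq; case: (f x) => a b /=; ring.
rewrite -(mul0r (Rintegral mu setT (fun=> 0))) -RintegralZl //; last first.
  exact: integrable0.
by apply: eq_Rintegral => x _; rewrite conjE; case: (f x) => a b /=; ring.
Qed.

Lemma L2normsq_ge0 f : 0 <= L2normsq mu f.
Proof. by apply: Rintegral_ge0 => x _; exact: csq_ge0. Qed.

Lemma L2normsqE f : L2 mu f -> L2normsq mu f = cRe (L2dot mu f f).
Proof. by move=> /L2dotff ->. Qed.

Lemma L2normsqZ z f : L2 mu f -> L2normsq mu (fun x => z * f x) = csq z * L2normsq mu f.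
Proof.
move=> Lf; rewrite /L2normsq -RintegralZl //; last exact: L2_integrable.
by apply: eq_Rintegral => x _; rewrite csqM.
Qed.

Lemma L2normsqD_le f g : L2 mu f -> L2 mu g ->
  L2normsq mu (fun x => f x + g x) <= 2 * L2normsq mu f + 2 * L2normsq mu g.
Proof.
move=> Lf Lg; have := L2_integrable Lf; have := L2_integrable Lg => ig jf.
rewrite /L2normsq -!RintegralZl // -RintegralD //; try exact: integrable_Rmull.
apply: le_Rintegral => //.
- exact: (L2_integrable (L2D Lf Lg)).
- rewrite (_ : _ \o _ =
    (fun x => (2%:E * (csq (f x))%:E) + (2%:E * (csq (g x))%:E))%E) //.
  by apply: integrableD => //; apply: integrableZl.
- by move=> x _; exact: csqD_le.
Qed.

Lemma L2normsqN f : L2normsq mu (fun x => - f x) = L2normsq mu f.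
Proof. by apply: eq_Rintegral => x _; rewrite csqN. Qed.

Lemma L2normsqDZ f g (s : R) : L2 mu f -> L2 mu g ->
  L2normsq mu (fun x => f x + s%:C * g x) =
  L2normsq mu f + 2 * s * cRe (L2dot mu f g) + s ^+ 2 * L2normsq mu g.
Proof.
move=> Lf Lg; have Lsg := L2Z s%:C Lg.
rewrite L2normsqE ?L2dotDl ?L2dotDr ?L2dotZl ?L2dotZr ?L2dotff //; try exact: L2D.
rewrite (L2dotC Lf Lg) !conjE; case: (L2dot mu f g) => a b /=; ring.
Qed.

Lemma Re_L2dot_sqr_le f g : L2 mu f -> L2 mu g ->
  (cRe (L2dot mu f g)) ^+ 2 <= L2normsq mu f * L2normsq mu g.
Proof.
move=> Lf Lg; apply: discriminant_le => s.
by rewrite -L2normsqDZ //; exact: L2normsq_ge0.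
Qed.

(** From the real part to the modulus: for [z] the inner product of [f] and [g], multiplying [f] by
    the conjugate of [z] makes the inner product the real number [csq z], and one factor [csq z]
    cancels. *)
Lemma L2_Cauchy_Schwarz f g : L2 mu f -> L2 mu g ->
  csq (L2dot mu f g) <= L2normsq mu f * L2normsq mu g.
Proof.
move=> Lf Lg; set z := L2dot mu f g.
have := Re_L2dot_sqr_le (L2Z z^* Lf) Lg.
rewrite L2dotZl // L2normsqZ // csq_conj -/z.
have -> : cRe (z^* * z) = csq z by rewrite conjE; case: z => a b; rewrite /csq /=; ring.
case: (eqVneq (csq z) 0) => [->|z0].
  by move=> _; rewrite mulr_ge0 // L2normsq_ge0.
by rewrite expr2 -mulrA ler_pM2l // lt_neqAle eq_sym z0 csq_ge0.
Qed.

Definition L2norm f : R := Num.sqrt (L2normsq mu f).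

Lemma L2norm_ge0 f : 0 <= L2norm f.
Proof. exact: sqrtr_ge0. Qed.

Lemma L2norm_sqr f : L2norm f ^+ 2 = L2normsq mu f.
Proof. by rewrite sqr_sqrtr // L2normsq_ge0. Qed.

End L2Space.

(** * Unordered sums and l^2(I) *)

Section SummableFamilies.
Variables (R : realType) (I : countType).
Implicit Types (f p q : I -> R) (c d v : I -> R[i]) (D : set I).

Definition abs_summable f := (\esum_(i in [set: I]) `|f i|%:E < +oo)%E.

Lemma esum_le_fin D f p : (forall i, D i -> 0 <= f i <= p i) ->
  (\esum_(i in D) (p i)%:E < +oo)%E -> (\esum_(i in D) (f i)%:E < +oo)%E.
Proof.
move=> fp; apply: le_lt_trans; apply: le_esum => i Di.
by rewrite lee_fin; case/andP: (fp i Di).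
Qed.

Lemma abs_summable_le f p : (forall i, `|f i| <= p i) ->
  (\esum_(i in [set: I]) (p i)%:E < +oo)%E -> abs_summable f.
Proof. by move=> fp; apply: esum_le_fin => i _; rewrite normr_ge0 fp. Qed.

Lemma esum_fineK p : (forall i, 0 <= p i) -> (\esum_(i in [set: I]) (p i)%:E < +oo)%E ->
  ((fine (\esum_(i in [set: I]) (p i)%:E))%:E = \esum_(i in [set: I]) (p i)%:E)%E.
Proof.
move=> p0 fin; rewrite fineK // ge0_fin_numE //.
by apply: esum_ge0 => i _; rewrite lee_fin.
Qed.

Lemma esumD_fine p q : (forall i, 0 <= p i) -> (forall i, 0 <= q i) ->
  (\esum_(i in [set: I]) (p i)%:E < +oo)%E -> (\esum_(i in [set: I]) (q i)%:E < +oo)%E ->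
  (\esum_(i in [set: I]) (p i + q i)%:E < +oo)%E /\
  fine (\esum_(i in [set: I]) (p i + q i)%:E) =
  fine (\esum_(i in [set: I]) (p i)%:E) + fine (\esum_(i in [set: I]) (q i)%:E).
Proof.
move=> p0 q0 fp fq.
have -> : (\esum_(i in [set: I]) (p i + q i)%:E =
  \esum_(i in [set: I]) (p i)%:E + \esum_(i in [set: I]) (q i)%:E)%E.
  under eq_esum do rewrite EFinD.
  by rewrite esumD // => i _; rewrite lee_fin.
by rewrite -(esum_fineK p0 fp) -(esum_fineK q0 fq) -EFinD /= ltry.
Qed.

Lemma funrpos_negB f i : f^\+ i - f^\- i = f i.
Proof.
rewrite /funrpos /funrneg; case: (lerP 0 (f i)) => [f0|/ltW f0].
  by rewrite max_r ?subr0 // oppr_le0.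
by rewrite max_l ?sub0r ?opprK // oppr_ge0.
Qed.

Lemma funrpos_le_norm f i : 0 <= f^\+ i <= `|f i|.
Proof. by rewrite /funrpos le_max lexx orbT ge_max ler_norm normr_ge0. Qed.

Lemma funrneg_le_norm f i : 0 <= f^\- i <= `|f i|.
Proof. by rewrite /funrneg le_max lexx orbT ge_max -normrN ler_norm normr_ge0. Qed.

Lemma rsum_posneg_fin f : abs_summable f ->
  (\esum_(i in [set: I]) (f^\+ i)%:E < +oo)%E /\
  (\esum_(i in [set: I]) (f^\- i)%:E < +oo)%E.
Proof.
by move=> sf; split; apply: esum_le_fin sf => i _;
  [exact: funrpos_le_norm|exact: funrneg_le_norm].
Qed.

(** The value of [rsum] does not depend on how a family is split into a difference of nonnegative
    summable ones, because the positive part plus [q] equals the negative part plus [p]. Linearity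
    of [rsum] rests on this. *)
Lemma rsum_sub p q : (forall i, 0 <= p i) -> (forall i, 0 <= q i) ->
  (\esum_(i in [set: I]) (p i)%:E < +oo)%E -> (\esum_(i in [set: I]) (q i)%:E < +oo)%E ->
  rsum (fun i => p i - q i) =
  fine (\esum_(i in [set: I]) (p i)%:E) - fine (\esum_(i in [set: I]) (q i)%:E).
Proof.
move=> p0 q0 fp fq; set f := fun i => p i - q i.
have [_ fpq] := esumD_fine p0 q0 fp fq; have [fpq' _] := esumD_fine p0 q0 fp fq.
have sf : abs_summable f.
  by apply: abs_summable_le fpq' => i; rewrite /f (le_trans (ler_normB _ _)) // !ger0_norm.
have [f1 f2] := rsum_posneg_fin sf.
have pos i : 0 <= f^\+ i by case/andP: (funrpos_le_norm f i).
have neg i : 0 <= f^\- i by case/andP: (funrneg_le_norm f i).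
have [_ e1] := esumD_fine pos q0 f1 fq; have [_ e2] := esumD_fine neg p0 f2 fp.
have : (fun i => (f^\+ i + q i)%:E) = (fun i => (f^\- i + p i)%:E).
  by apply/funext => i; congr EFin; have := funrpos_negB f i; rewrite {3}/f; lra.
rewrite /rsum => e3; move: e1; rewrite e3 e2; lra.
Qed.

Lemma rsumD f g : abs_summable f -> abs_summable g ->
  rsum (fun i => f i + g i) = rsum f + rsum g.
Proof.
move=> sf sg.
have [f1 f2] := rsum_posneg_fin sf; have [g1 g2] := rsum_posneg_fin sg.
have fpos i : 0 <= f^\+ i by case/andP: (funrpos_le_norm f i).
have fneg i : 0 <= f^\- i by case/andP: (funrneg_le_norm f i).
have gpos i : 0 <= g^\+ i by case/andP: (funrpos_le_norm g i).
have gneg i : 0 <= g^\- i by case/andP: (funrneg_le_norm g i).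
have [h1 e1] := esumD_fine fpos gpos f1 g1; have [h2 e2] := esumD_fine fneg gneg f2 g2.
have -> : (fun i => f i + g i) = (fun i => (f^\+ i + g^\+ i) - (f^\- i + g^\- i)).
  by apply/funext => i; have := funrpos_negB f i; have := funrpos_negB g i; lra.
rewrite rsum_sub ?e1 ?e2 //; first by rewrite /rsum; lra.
- by move=> i; exact: addr_ge0.
- by move=> i; exact: addr_ge0.
Qed.

Lemma rsum_ge0E p : (forall i, 0 <= p i) -> (\esum_(i in [set: I]) (p i)%:E < +oo)%E ->
  rsum p = fine (\esum_(i in [set: I]) (p i)%:E).
Proof.
move=> p0 fp.
have z : (\esum_(i in [set: I]) (0 : R)%:E = 0)%E by rewrite esum1.
have -> : rsum p = rsum (fun i => p i - 0).
  by congr rsum; apply/funext => i; rewrite subr0.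
by rewrite rsum_sub ?z ?subr0.
Qed.

Lemma rsumN f : rsum (fun i => - f i) = - rsum f.
Proof.
rewrite /rsum opprB; congr (fine _ - fine _); apply: eq_esum => i _;
  by rewrite /funrpos /funrneg ?opprK.
Qed.

Lemma esumZ_fine (k : R) p : 0 <= k -> (forall i, 0 <= p i) ->
  (\esum_(i in [set: I]) (p i)%:E < +oo)%E ->
  (\esum_(i in [set: I]) (k * p i)%:E = (k * fine (\esum_(i in [set: I]) (p i)%:E))%:E)%E.
Proof.
move=> k0 p0 fp; rewrite EFinM esum_fineK //.
apply/eqP; rewrite eq_le; apply/andP; split.
- apply: ub_ereal_sup => _ [F [finF _] <-].
  rewrite (eq_fsbigr (fun i => k%:E * (p i)%:E)%E); last by move=> i _; rewrite EFinM.
  rewrite -ge0_mule_fsumr; last by move=> i; rewrite lee_fin.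
  apply: lee_wpmul2l; first by rewrite lee_fin.
  by apply: ereal_sup_ubound; exists F.
- case: (eqVneq k 0) => [->|kn0].
    by rewrite mul0e esum_ge0 // => i _; rewrite mul0r.
  have kp : 0 < k by rewrite lt_neqAle eq_sym kn0.
  rewrite muleC -lee_pdivlMr //; apply: ub_ereal_sup => _ [F [finF _] <-].
  rewrite lee_pdivlMr // muleC ge0_mule_fsumr; last by move=> i; rewrite lee_fin.
  by apply: ereal_sup_ubound; exists F => //; apply: eq_fsbigr => i _; rewrite EFinM.
Qed.

Lemma rsumZ (k : R) f : abs_summable f -> rsum (fun i => k * f i) = k * rsum f.
Proof.
wlog k0 : k / 0 <= k.
  move=> H sf; case: (leP 0 k) => [k0|/ltW k0]; first exact: H.
  rewrite -[k in RHS]opprK mulNr -H ?oppr_ge0 // -rsumN; congr rsum.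
  by apply/funext => i; rewrite mulNr opprK.
move=> sf; have [f1 f2] := rsum_posneg_fin sf.
have fpos i : 0 <= f^\+ i by case/andP: (funrpos_le_norm f i).
have fneg i : 0 <= f^\- i by case/andP: (funrneg_le_norm f i).
have -> : (fun i => k * f i) = (fun i => k * f^\+ i - k * f^\- i).
  by apply/funext => i; rewrite -mulrBr funrpos_negB.
rewrite rsum_sub ?esumZ_fine ?ltry //=; first by rewrite mulrBr.
- by move=> i; exact: mulr_ge0.
- by move=> i; exact: mulr_ge0.
Qed.

Lemma esum_at (l : I) p : (forall i, 0 <= p i) -> (forall i, i != l -> p i = 0) ->
  (\esum_(i in [set: I]) (p i)%:E = (p l)%:E)%E.
Proof.
move=> p0 pl.
rewrite -(@esum_set1 R I l (fun i => (p i)%:E)) ?lee_fin //.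
rewrite esum_mkcond [RHS]esum_mkcond; apply: eq_esum => i _.
rewrite mem_set //; case: ifPn => // /negP nil.
by rewrite pl //; apply/eqP => il; apply: nil; rewrite inE.
Qed.

Lemma rsum_at (l : I) f : (forall i, i != l -> f i = 0) -> rsum f = f l.
Proof.
move=> f0.
rewrite /rsum !(esum_at (l := l)) //=; first exact: funrpos_negB.
- by move=> i /f0 e; rewrite /funrneg e oppr0 maxxx.
- by move=> i /f0 e; rewrite /funrpos e maxxx.
Qed.

Definition sqsum c : R := fine (\esum_(i in [set: I]) (csq (c i))%:E).

Lemma sqsumK c : ell2 c -> ((sqsum c)%:E = \esum_(i in [set: I]) (csq (c i))%:E)%E.
Proof. by move=> lc; rewrite esum_fineK // => i; exact: csq_ge0. Qed.

Lemma sqsum_ge0 c : 0 <= sqsum c.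
Proof.
by rewrite fine_ge0 // esum_ge0 // => i _; rewrite lee_fin csq_ge0.
Qed.

Lemma ell2_le c d : (forall i, csq (c i) <= csq (d i)) -> ell2 d -> ell2 c.
Proof. by move=> cd; apply: esum_le_fin => i _; rewrite csq_ge0 cd. Qed.

Lemma ell2D c d : ell2 c -> ell2 d -> ell2 (fun i => c i + d i).
Proof.
move=> lc ld.
have c2 i : 0 <= 2 * csq (c i) by rewrite mulr_ge0 // csq_ge0.
have d2 i : 0 <= 2 * csq (d i) by rewrite mulr_ge0 // csq_ge0.
have fc : (\esum_(i in [set: I]) (2 * csq (c i))%:E < +oo)%E.
  by rewrite esumZ_fine ?ltry // => i; exact: csq_ge0.
have fd : (\esum_(i in [set: I]) (2 * csq (d i))%:E < +oo)%E.
  by rewrite esumZ_fine ?ltry // => i; exact: csq_ge0.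
have [h _] := esumD_fine c2 d2 fc fd.
by apply: esum_le_fin h => i _; rewrite csq_ge0 csqD_le.
Qed.

Lemma ell2Z (z : R[i]) c : ell2 c -> ell2 (fun i => z * c i).
Proof.
move=> lc; rewrite /ell2; under eq_esum do rewrite csqM.
by rewrite esumZ_fine ?csq_ge0 ?ltry // => i; exact: csq_ge0.
Qed.

Lemma ell2_delta (l : I) : ell2 (delta R l).
Proof.
rewrite /ell2 (@esum_at l) ?ltry // => [i|i /negPf il]; first exact: csq_ge0.
by rewrite /delta il csq0.
Qed.

(** A real inner product: real linearity and symmetry are all that the discriminant argument and the
    orthogonality relations of the projection require. *)
Definition Re_ell2dot c d : R := rsum (fun i => cRe (c i * (d i)^*)).

Lemma ell2_mul_summable c d : ell2 c -> ell2 d ->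
  abs_summable (fun i => cRe (c i * (d i)^*)).
Proof.
move=> lc ld; have [h _] := esumD_fine (fun i => csq_ge0 _) (fun i => csq_ge0 _) lc ld.
apply: abs_summable_le h => i.
rewrite conjE; case: (c i) (d i) => [x y] [z w]; rewrite /csq /= ler_norml.
have := sqr_ge0 (x - z); have := sqr_ge0 (y - w).
have := sqr_ge0 (x + z); have := sqr_ge0 (y + w).
by move=> *; apply/andP; split; nra.
Qed.

Lemma Re_ell2dotDl c d v : ell2 c -> ell2 d -> ell2 v ->
  Re_ell2dot (fun i => c i + d i) v = Re_ell2dot c v + Re_ell2dot d v.
Proof.
move=> lc ld lv; rewrite -rsumD; try exact: ell2_mul_summable.
by congr rsum; apply/funext => i; rewrite mulrDl; case: (c i * _) (d i * _) => ? ? [].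
Qed.

Lemma Re_ell2dotZl (k : R) c v : ell2 c -> ell2 v ->
  Re_ell2dot (fun i => k%:C * c i) v = k * Re_ell2dot c v.
Proof.
move=> lc lv; rewrite -rsumZ; last exact: ell2_mul_summable.
by congr rsum; apply/funext => i; rewrite -mulrA; case: (c i * _) => ? ? /=; ring.
Qed.

Lemma Re_ell2dotC c d : Re_ell2dot c d = Re_ell2dot d c.
Proof.
congr rsum; apply/funext => i; rewrite !conjE.
by case: (c i) (d i) => ? ? [? ?] /=; ring.
Qed.

Lemma Re_ell2dotBl c d v : ell2 c -> ell2 d -> ell2 v ->
  Re_ell2dot (fun i => c i - d i) v = Re_ell2dot c v - Re_ell2dot d v.
Proof.
move=> lc ld lv; rewrite -[- Re_ell2dot d v]mulN1r -Re_ell2dotZl // -Re_ell2dotDl //.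
  congr (Re_ell2dot _ v); apply/funext => i.
  by case: (c i) (d i) => [x y] [z w]; simpc; congr (_ +i* _); ring.
exact: ell2Z.
Qed.

Lemma Re_ell2dotcc c : ell2 c -> Re_ell2dot c c = sqsum c.
Proof.
move=> lc; rewrite /sqsum -rsum_ge0E //; last by move=> i; exact: csq_ge0.
congr rsum; apply/funext => i; rewrite conjE /csq.
by case: (c i) => ? ? /=; ring.
Qed.

Lemma sqsumDZ c d (s : R) : ell2 c -> ell2 d ->
  sqsum (fun i => c i + s%:C * d i) =
  sqsum c + 2 * s * Re_ell2dot c d + s ^+ 2 * sqsum d.
Proof.
move=> lc ld; have lsd := ell2Z s%:C ld; have lcd := ell2D lc lsd.
rewrite -Re_ell2dotcc // Re_ell2dotDl // Re_ell2dotZl //.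
rewrite !(Re_ell2dotC _ (fun i => c i + _)) !Re_ell2dotDl // !Re_ell2dotZl //.
rewrite !Re_ell2dotcc // (Re_ell2dotC d c); ring.
Qed.

Lemma Re_ell2dot_sqr_le c d : ell2 c -> ell2 d ->
  Re_ell2dot c d ^+ 2 <= sqsum c * sqsum d.
Proof.
by move=> lc ld; apply: discriminant_le => s; rewrite -sqsumDZ // sqsum_ge0.
Qed.

Lemma Re_ell2dot_delta (l : I) v : Re_ell2dot (delta R l) v = cRe (v l).
Proof.
rewrite /Re_ell2dot (@rsum_at l).
  by rewrite /delta eqxx mul1r conjE.
by move=> i /negPf il; rewrite /delta il mul0r.
Qed.

End SummableFamilies.

(** * Translation invariance of Lebesgue measure *)

Section LebesgueBoxes.
Variables (R : realType) (m : nat).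
Local Notation X := (m.-tuple R).
Implicit Types (a b t x : X).

Definition cbox a b : set X := [set x | forall i, tnth a i <= tnth x i <= tnth b i].

Lemma measurable_cbox a b : measurable (cbox a b).
Proof.
rewrite (_ : cbox a b = \bigcap_(i in [set: 'I_m])
    ((fun x : X => tnth x i) @^-1` `[tnth a i, tnth b i]%classic)).
  apply: fin_bigcap_measurable; first exact: finite_finset.
  move=> i _; rewrite -[X in measurable X]setTI.
  by apply: measurable_tnth => //; exact: measurable_itv.
apply/seteqP; split => x /=.
  by move=> H i _; rewrite /= in_itv /=; exact: H.
by move=> H i; have := H i I; rewrite /= in_itv.
Qed.

(** No order between [a] and [b] is imposed: empty boxes belong to the family, which makes it closed
    under intersection. *)
Definition cboxes : set (set X) := [set A | exists a b, A = cbox a b].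

Lemma cboxI a b a' b' : cbox a b `&` cbox a' b' =
  cbox [tuple Num.max (tnth a i) (tnth a' i) | i < m]
       [tuple Num.min (tnth b i) (tnth b' i) | i < m].
Proof.
apply/seteqP; split => x /=.
  move=> [H H'] i; rewrite !tnth_mktuple ge_max le_min.
  by case/andP: (H i) => -> ->; case/andP: (H' i) => -> ->.
move=> H; split=> i; have := H i;
  by rewrite !tnth_mktuple ge_max le_min => /andP[/andP[h1 h2] /andP[h3 h4]]; apply/andP.
Qed.

Lemma cboxes_setI : setI_closed cboxes.
Proof.
move=> _ _ [a [b ->]] [a' [b' ->]]; rewrite cboxI.
by eexists; eexists.
Qed.

Definition cst_tuple (r : R) : X := [tuple r | i < m].

Definition cube (n : nat) : set X := cbox (cst_tuple (- n%:R)) (cst_tuple n%:R).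

Lemma cubeP n x : cube n x <-> forall i, `|tnth x i| <= n%:R.
Proof.
split=> H i; have := H i; rewrite /cst_tuple /= ?tnth_mktuple ler_norml //.
Qed.

Lemma ex_cube x : exists n, cube n x.
Proof.
pose s := \sum_(i < m) `|tnth x i|.
have s0 : 0 <= s by apply: sumr_ge0.
exists (Num.truncn s).+1; apply/cubeP => i.
apply: le_trans (ltW (truncnS_gt s)).
by rewrite /s (bigD1 i) //= lerDl sumr_ge0.
Qed.

Lemma cube_le n k x : (n <= k)%N -> cube n x -> cube k x.
Proof.
move=> nk /cubeP H; apply/cubeP => i; apply: le_trans (H i) _.
by rewrite ler_nat.
Qed.

Lemma bigcup_cube : \bigcup_n cube n = [set: X].
Proof.
apply/seteqP; split => // x _; have [n xn] := ex_cube x; by exists n.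
Qed.

Lemma measurable_cboxes : @measurable _ X = <<s cboxes >>.
Proof.
apply/seteqP; split; last first.
  apply: smallest_sub; first exact: sigma_algebra_measurable.
  by move=> _ [a [b ->]]; exact: measurable_cbox.
apply: smallest_sub; first exact: smallest_sigma_algebra.
rewrite -bigcup_seq => A [i _ [B mB <-]]; rewrite setTI.
pose S := [set B : set R | <<s cboxes >> ((fun x : X => tnth x i) @^-1` B)].
suff : @measurable _ R `<=` S by apply.
have -> : @measurable _ R = <<s @RGenCInfty.G R >>.
  exact: (RGenCInfty.measurableE R).
apply: smallest_sub.
  split.
  - rewrite /S /= preimage_set0; exact: sigma_algebra0.
  - move=> C SC; rewrite /S /= setTD preimage_setC -setTD.
    exact: sigma_algebraCD.
  - move=> F SF; rewrite /S /= preimage_bigcup.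
    exact: sigma_algebra_bigcup.
move=> _ [r ->]; rewrite /S /=.
(* The half-space where coordinate [i] is at least [r] is exhausted by boxes with side [[r, n]] in
   direction [i] and [[-n, n]] in the others. *)
rewrite (_ : _ @^-1` _ = \bigcup_n
  cbox [tuple if j == i then r else - n%:R | j < m] (cst_tuple n%:R)).
  by apply: sigma_algebra_bigcup => n; apply: sub_gen_smallest; eexists; eexists.
apply/seteqP; split => x /=.
  rewrite in_itv /= andbT => rx.
  have [n /cubeP xn] := ex_cube x; exists n => // j.
  rewrite !tnth_mktuple; have := xn j; rewrite ler_norml => /andP[h1 h2].
  by rewrite h2 andbT; case: (eqVneq j i) => [->|_].
by move=> [n _ /(_ i)]; rewrite !tnth_mktuple eqxx in_itv /= andbT => /andP[].
Qed.

Section Measure.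
Variable mu : {measure set X -> \bar R}.
Hypothesis mu_leb : is_lebesgue_Rm mu.

Lemma mu_cbox a b : (forall i, tnth a i <= tnth b i) ->
  mu (cbox a b) = (\prod_(i < m) (tnth b i - tnth a i))%:E.
Proof. exact: mu_leb. Qed.

Lemma cbox_empty a b i : tnth b i < tnth a i -> cbox a b = set0.
Proof.
move=> ba; apply/seteqP; split => // x /(_ i) /andP[ax xb].
by move: ba; rewrite ltNge (le_trans ax xb).
Qed.

Lemma mu_cbox_lty a b : (mu (cbox a b) < +oo)%E.
Proof.
have [H|/existsNP[i /negP]] := pselect (forall i, tnth a i <= tnth b i).
  by rewrite mu_cbox // ltry.
by rewrite -ltNge => /cbox_empty ->; rewrite measure0 ltry.
Qed.

Lemma measurable_subT t : measurable_fun setT (fun x : X => subT x t).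
Proof.
apply/measurable_fun_tnthP => i.
rewrite (_ : _ \o _ = fun x : X => tnth x i - tnth t i).
  by apply: measurable_funB; [exact: measurable_tnth|exact: measurable_cst].
by apply/funext => x; rewrite /= tnth_mktuple.
Qed.

Lemma preimage_subT_cbox t a b : (fun x : X => subT x t) @^-1` cbox a b =
  cbox (subT a (subT (cst_tuple 0) t)) (subT b (subT (cst_tuple 0) t)).
Proof.
apply/seteqP; split => x /= H i; have := H i; rewrite !tnth_mktuple sub0r opprK;
  by rewrite lerBrDr lerBlDr.
Qed.

(** Both measures agree on the pi-system of closed boxes, and the cubes exhaust the space with
    finite measure, so uniqueness of measures applies. *)
Lemma mu_shift t A : measurable A -> pushforward mu (fun x : X => subT x t) A = mu A.
Proof.
move=> mA.
pose phi : X -> X := fun x => subT x t.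
pose phi_m := isMeasurableFun.Build _ _ _ _ phi (measurable_subT t).
pose Phi : {mfun X >-> X} := HB.pack phi phi_m.
apply: (measure_unique cboxes cube measurable_cboxes cboxes_setI _ bigcup_cube
   (pushforward mu Phi) mu) => //.
- by move=> i; eexists; eexists.
- move=> _ [a [b ->]] /=; rewrite /pushforward /= preimage_subT_cbox.
  have [H|/existsNP[i /negP]] := pselect (forall i, tnth a i <= tnth b i).
    rewrite !mu_cbox //; last by move=> i; rewrite !tnth_mktuple lerD2r.
    by congr EFin; apply: eq_bigr => i _; rewrite !tnth_mktuple; ring.
  rewrite -ltNge => ba.
  by rewrite !(@cbox_empty _ _ i) // !tnth_mktuple ltrD2r.
- move=> k; change (mu (phi @^-1` cube k) < +oo)%E.
  by rewrite preimage_subT_cbox; exact: mu_cbox_lty.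
Qed.

Lemma ge0_integral_shift t (F : X -> \bar R) : measurable_fun setT F ->
  (forall x, 0 <= F x)%E -> (\int[mu]_x F (subT x t) = \int[mu]_x F x)%E.
Proof.
move=> mF F0.
pose phi : X -> X := fun x => subT x t.
pose phi_m := isMeasurableFun.Build _ _ _ _ phi (measurable_subT t).
pose Phi : {mfun X >-> X} := HB.pack phi phi_m.
have := @ge0_integral_pushforward _ _ X X R phi (measurable_subT t) mu setT F measurableT mF (fun y _ => F0 y).
rewrite preimage_setT => <-.
apply: (@eq_measure_integral _ _ _ setT mu (pushforward mu Phi)) => A mA _.
exact: mu_shift.
Qed.

Lemma integral_shift t (F : X -> \bar R) : measurable_fun setT F ->
  (\int[mu]_x F (subT x t) = \int[mu]_x F x)%E.
Proof.
move=> mF; rewrite integralE [RHS]integralE; congr (_ - _)%E.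
- have h := ge0_integral_shift t (measurable_funepos mF) (fun x => funepos_ge0 F x).
  rewrite -h; apply: eq_integral => x _; by rewrite !funeposE.
- have h := ge0_integral_shift t (measurable_funeneg mF) (fun x => funeneg_ge0 F x).
  rewrite -h; apply: eq_integral => x _; by rewrite !funenegE.
Qed.

Lemma Rintegral_shift t (F : X -> R) : measurable_fun setT F ->
  Rintegral mu setT (fun x => F (subT x t)) = Rintegral mu setT F.
Proof.
move=> mF; congr fine; apply: (integral_shift t (F := EFin \o F)).
exact/measurable_EFinP.
Qed.

Lemma integrable_shift t (F : X -> R) : mu.-integrable setT (EFin \o F) ->
  mu.-integrable setT (EFin \o (fun x => F (subT x t))).
Proof.
move=> /integrableP[mF iF]; apply/integrableP; split.
  by apply: (measurableT_comp mF); exact: measurable_subT.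
rewrite (ge0_integral_shift t (F := fun x => `|(EFin \o F) x|%E)) //.
exact: measurableT_comp.
Qed.

End Measure.

End LebesgueBoxes.

(** * Density of smooth bumps in L^2 *)

Section Ramp.
Variable R : realType.
Implicit Types u v a : R.

(* A quadratic spline: its second differences are O(a^2), which is what the
   quadratic decay of the Gram entries of bumps needs. *)
Definition ramp u : R :=
  let y := Num.max 0 (Num.min 1 u) in
  2 * y ^+ 2 - 4 * (Num.max 0 (y - 2^-1)) ^+ 2.

Lemma ramp_le0 u : u <= 0 -> ramp u = 0.
Proof.
move=> u0; rewrite /ramp min_r; last by lra.
rewrite (max_l u0) max_l; last by lra.
by ring.
Qed.

Lemma ramp_ge1 u : 1 <= u -> ramp u = 1.
Proof.
by move=> u0; rewrite /ramp min_l // max_r // max_r; [field | lra].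
Qed.

Lemma ramp_clamp u : 0 <= Num.max 0 (Num.min 1 u) <= 1.
Proof. by rewrite le_max lexx /= ge_max ler01 ge_min lexx. Qed.

Lemma ramp_ge0 u : 0 <= ramp u.
Proof.
rewrite /ramp; case/andP: (ramp_clamp u); move: (Num.max 0 _) => y y0 y1.
by case: (lerP 0 (y - 2^-1)) => h; nra.
Qed.

Lemma ramp_le1 u : ramp u <= 1.
Proof.
rewrite /ramp; case/andP: (ramp_clamp u); move: (Num.max 0 _) => y y0 y1.
by case: (lerP 0 (y - 2^-1)) => h; nra.
Qed.

Lemma max0_lip u v : `|Num.max 0 u - Num.max 0 v| <= `|u - v|.
Proof.
wlog uv : u v / u <= v.
  by move=> H; case: (leP u v) => [/H//|/ltW/H]; rewrite distrC (distrC v).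
rewrite distrC (distrC u) !ger0_norm ?subr_ge0 //.
  by case: (lerP 0 u); case: (lerP 0 v) => *; lra.
by rewrite ge_max le_max lexx /= le_max uv orbT.
Qed.

Lemma min1_lip u v : `|Num.min 1 u - Num.min 1 v| <= `|u - v|.
Proof.
wlog uv : u v / u <= v.
  by move=> H; case: (leP u v) => [/H//|/ltW/H]; rewrite distrC (distrC v).
rewrite distrC (distrC u) !ger0_norm ?subr_ge0 //.
  by case: (lerP 1 u); case: (lerP 1 v) => *; lra.
by rewrite le_min ge_min lexx /= ge_min uv orbT.
Qed.

Lemma ramp_lip u v : `|ramp u - ramp v| <= 8 * `|u - v|.
Proof.
rewrite /ramp; set y := Num.max 0 (Num.min 1 u); set y' := Num.max 0 (Num.min 1 v).
have yy : `|y - y'| <= `|u - v|.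
  by apply: le_trans (max0_lip _ _) _; exact: min1_lip.
have zz := le_trans (max0_lip (y - 2^-1) (y' - 2^-1)) (lexx _).
move: zz; rewrite (_ : y - 2^-1 - (y' - 2^-1) = y - y'); last by ring.
set z := Num.max 0 (y - 2^-1); set z' := Num.max 0 (y' - 2^-1) => zz.
case/andP: (ramp_clamp u) => y0 y1; case/andP: (ramp_clamp v) => y0' y1'.
have z01 (w : R) : 0 <= w -> w <= 1 -> 0 <= Num.max 0 (w - 2^-1) <= 2^-1.
  by move=> w0 w1; case: (lerP 0 (w - 2^-1)) => h; apply/andP; split; lra.
case/andP: (z01 _ y0 y1); rewrite -/z => z0 z1.
case/andP: (z01 _ y0' y1'); rewrite -/z' => z0' z1'.
have -> : 2 * y ^+ 2 - 4 * z ^+ 2 - (2 * y' ^+ 2 - 4 * z' ^+ 2) =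
  2 * ((y + y') * (y - y')) - 4 * ((z + z') * (z - z')) by ring.
apply: le_trans (ler_normB _ _) _.
have -> : `|2 * ((y + y') * (y - y'))| = 2 * ((y + y') * `|y - y'|).
  by rewrite !normrM (ger0_norm (addr_ge0 y0 y0')) (ger0_norm (ler0n _ _)).
have -> : `|4 * ((z + z') * (z - z'))| = 4 * ((z + z') * `|z - z'|).
  by rewrite !normrM (ger0_norm (addr_ge0 z0 z0')) (ger0_norm (ler0n _ _)).
move: y0 y1 y0' y1'; rewrite -/y -/y' => y0 y1 y0' y1'.
have := normr_ge0 (y - y'); have := normr_ge0 (z - z').
nra.
Qed.

Lemma max0_diff2 u a : 0 <= Num.max 0 (u + a) ^+ 2 + Num.max 0 (u - a) ^+ 2 -
  2 * Num.max 0 u ^+ 2 <= 2 * a ^+ 2.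
Proof.
by apply/andP; split;
  case: (lerP 0 (u + a)); case: (lerP 0 (u - a)); case: (lerP 0 u) => *; nra.
Qed.

(** The spline in terms of truncated squares with knots 0, 1/2 and 1. Each truncated square has
    second differences between 0 and [2 * a ^+ 2], which yields [ramp_diff2]. *)
Lemma rampE u : ramp u = 2 * Num.max 0 u ^+ 2 -
  4 * Num.max 0 (u - 2^-1) ^+ 2 + 2 * Num.max 0 (u - 1) ^+ 2.
Proof.
case: (lerP u 0) => u0.
  by rewrite ramp_le0 // !max_l; [ring| lra | lra].
case: (lerP 1 u) => u1.
  by rewrite ramp_ge1 // !max_r; [field | lra | lra].
rewrite /ramp min_r ?(ltW u1) // (max_r (ltW u0)) [Num.max 0 (u - 1)]max_l; last by lra.
by ring.
Qed.

Lemma ramp_diff2 u a : `|ramp (u + a) + ramp (u - a) - 2 * ramp u| <= 16 * a ^+ 2.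
Proof.
rewrite !rampE.
have h1 := max0_diff2 u a; have h2 := max0_diff2 (u - 2^-1) a.
have h3 := max0_diff2 (u - 1) a.
rewrite (addrAC u a) (addrAC u (- a)) (addrAC u a) (addrAC u (- a)).
move: h1 h2 h3 => /andP[h1 h1'] /andP[h2 h2'] /andP[h3 h3'].
by rewrite ler_norml; apply/andP; split; lra.
Qed.

Lemma measurable_ramp : measurable_fun setT ramp.
Proof.
have my : measurable_fun setT (fun u : R => Num.max 0 (Num.min 1 u)).
  apply: measurable_maxr; first exact: measurable_cst.
  by apply: measurable_minr; [exact: measurable_cst|exact: measurable_id].
apply: measurable_funB; apply: measurable_funM; try exact: measurable_cst.
- exact: measurable_funX.
- apply: measurable_funX; apply: measurable_maxr; first exact: measurable_cst.
  by apply: measurable_funB => //; exact: measurable_cst.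
Qed.

(** For [k > 0] and [a <= b] it is 1 on [[a, b]] and vanishes outside [[a - 1/k, b + 1/k]]; as [k]
    grows it approaches the indicator of the interval. *)
Definition plateau (k a b : R) : R -> R :=
  fun y => ramp (1 + k * (y - a)) * ramp (1 + k * (b - y)).

Lemma plateau_ge0 k a b y : 0 <= plateau k a b y.
Proof. by rewrite mulr_ge0 // ramp_ge0. Qed.

Lemma plateau_le1 k a b y : plateau k a b y <= 1.
Proof. by rewrite mulr_ile1 // ?ramp_ge0 // ramp_le1. Qed.

Lemma plateau_eq1 k a b y : 0 <= k -> a <= y <= b -> plateau k a b y = 1.
Proof.
move=> k0 /andP[ay yb]; rewrite /plateau !ramp_ge1 ?mulr1 //;
  by rewrite lerDl mulr_ge0 // subr_ge0.
Qed.

Lemma plateau_eq0l k a b y : k * (y - a) <= -1 -> plateau k a b y = 0.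
Proof. by move=> h; rewrite /plateau ramp_le0 ?mul0r //; lra. Qed.

Lemma plateau_eq0r k a b y : k * (b - y) <= -1 -> plateau k a b y = 0.
Proof. by move=> h; rewrite /plateau [ramp (1 + k * (b - y))]ramp_le0 ?mulr0 //; lra. Qed.

Lemma measurable_plateau k a b : measurable_fun setT (plateau k a b).
Proof.
apply: measurable_funM; (apply: (measurableT_comp measurable_ramp);
  apply: measurable_funD; first exact: measurable_cst);
  apply: measurable_funM; try exact: measurable_cst;
  apply: measurable_funB; try exact: measurable_cst; exact: measurable_id.
Qed.

End Ramp.

Section Density.
Variables (R : realType) (m : nat) (mu : {measure set (m.-tuple R) -> \bar R}).
Local Notation X := (m.-tuple R).
Implicit Types (a b x : X) (f g h : X -> R[i]).
Hypothesis mu_leb : is_lebesgue_Rm mu.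

Lemma L2_dominated_limit f (u : nat -> X -> R[i]) (F : X -> R) (eps : R) :
  cmeas f -> (forall n, cmeas (u n)) -> mu.-integrable setT (EFin \o F) ->
  (forall n x, csq (f x - u n x) <= F x) ->
  (forall x, csq (f x - u n x) @[n --> \oo] --> (0 : R)) ->
  0 < eps -> exists n, L2normsq mu (fun x => f x - u n x) < eps.
Proof.
move=> mf mu_ iF le lim eps0.
have mfu n : measurable_fun setT (fun x => csq (f x - u n x)).
  apply: measurable_csq; apply: cmeasD => //.
  have := cmeasM (cmeas_cst m (-1)) (mu_ n).
  by congr cmeas; apply/funext => x; rewrite mulN1r.
have [||||_ _ H] := @dominated_convergence _ _ _ mu setT measurableT
  (fun n x => (csq (f x - u n x))%:E) (cst 0%E) (EFin \o F) _ _ _ iF.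
- by move=> n; apply/measurable_EFinP; exact: mfu.
- exact: measurable_cst.
- apply: aeW => x _; apply: cvg_EFin; first exact: nearW.
  exact: lim.
- by apply: aeW => x n _; rewrite gee0_abs ?lee_fin ?csq_ge0.
move: H; rewrite integral0 => /fine_cvg /cvgr0_norm_lt /(_ _ eps0)[N _ /(_ N (leqnn N))].
by rewrite /= ger0_norm ?L2normsq_ge0 // => h; exists N.
Qed.

Definition bump (k : R) a b : X -> R :=
  fun x => \prod_(i < m) plateau k (tnth a i) (tnth b i) (tnth x i).

Lemma measurable_bump k a b : measurable_fun setT (bump k a b).
Proof.
apply: measurable_prod => i _.
by apply: (measurableT_comp (measurable_plateau _ _ _)); exact: measurable_tnth.
Qed.

Lemma bump_ge0 k a b x : 0 <= bump k a b x.
Proof. by apply: prodr_ge0 => i _; exact: plateau_ge0. Qed.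

Lemma bump_le1 k a b x : bump k a b x <= 1.
Proof. by apply: prodr_ile1 => i _; rewrite plateau_ge0 plateau_le1. Qed.

Lemma bump_eq1 k a b x : 0 <= k -> cbox a b x -> bump k a b x = 1.
Proof. by move=> k0 xab; rewrite /bump big1 // => i _; rewrite plateau_eq1. Qed.

Lemma bump_eq0 k a b x i : plateau k (tnth a i) (tnth b i) (tnth x i) = 0 ->
  bump k a b x = 0.
Proof. by move=> h; rewrite /bump (bigD1 i) //= h mul0r. Qed.

(** A unit margin holds the ramps of every slope [k >= 1], so one integrable function dominates all
    the bumps over a box. *)
Definition enlarge a b : set X :=
  cbox (subT a (cst_tuple m 1)) (subT b (cst_tuple m (-1))).

Lemma bump_support k a b x : 1 <= k -> ~ enlarge a b x -> bump k a b x = 0.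
Proof.
move=> k1 /existsNP[i /negP]; rewrite !tnth_mktuple opprK negb_and -!ltNge.
move=> /orP[h|h]; apply: (@bump_eq0 _ _ _ _ i).
- by apply: plateau_eq0l; nra.
- by apply: plateau_eq0r; nra.
Qed.

Lemma bump_le_indic k a b x : 1 <= k -> bump k a b x <= \1_(enlarge a b) x.
Proof.
move=> k1; rewrite indicE; case: (boolP (x \in enlarge a b)) => xe.
  exact: bump_le1.
by rewrite bump_support //; move/negP: xe; rewrite inE.
Qed.

Lemma bump_cvg a b x : \forall n \near \oo, bump n.+1%:R a b x = \1_(cbox a b) x.
Proof.
rewrite indicE; case: (boolP (x \in cbox a b)) => xe.
  by apply: nearW => n; rewrite bump_eq1 //; move: xe; rewrite inE.
move/negP: xe; rewrite inE => /existsNP[i /negP]; rewrite negb_and -!ltNge.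
move=> /orP[h|h].
(* [d] is the distance to the violated face: as soon as the slope exceeds [d^-1] the plateau in this
   coordinate vanishes at [x]. The bumps are thus eventually constant at each point. *)
- pose d := tnth a i - tnth x i; have d0 : 0 < d by rewrite subr_gt0.
  exists (Num.truncn d^-1).+1 => // n /= nd.
  apply: (@bump_eq0 _ _ _ _ i); apply: plateau_eq0l.
  have : d^-1 < n.+1%:R.
    by apply: lt_le_trans (truncnS_gt _) _; rewrite ler_nat ltnW.
  rewrite -(ltr_pM2r d0) mulVf ?gt_eqF // /d; lra.
- pose d := tnth x i - tnth b i; have d0 : 0 < d by rewrite subr_gt0.
  exists (Num.truncn d^-1).+1 => // n /= nd.
  apply: (@bump_eq0 _ _ _ _ i); apply: plateau_eq0r.
  have : d^-1 < n.+1%:R.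
    by apply: lt_le_trans (truncnS_gt _) _; rewrite ler_nat ltnW.
  rewrite -(ltr_pM2r d0) mulVf ?gt_eqF // /d; lra.
Qed.

Lemma integrable_indic_box a b : mu.-integrable setT (EFin \o \1_(cbox a b)).
Proof.
have mE : measurable_fun setT (\1_(cbox a b) : X -> R).
  by apply: measurable_indic; exact: measurable_cbox.
apply/integrableP; split; first exact/measurable_EFinP.
under eq_integral do rewrite gee0_abs ?lee_fin //.
have mB := measurable_cbox a b.
by rewrite integral_indic // setIT; exact: mu_cbox_lty.
Qed.

Lemma L2_real (f : X -> R) (F : X -> R) : measurable_fun setT f ->
  mu.-integrable setT (EFin \o F) -> (forall x, f x ^+ 2 <= F x) ->
  L2 mu (fun x => (f x)%:C).
Proof.
move=> mf iF le; apply: (L2_dominated _ iF); first exact: cmeas_real.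
by move=> x; rewrite csq_real.
Qed.

Lemma L2_bump k a b : 1 <= k -> L2 mu (fun x => (bump k a b x)%:C).
Proof.
move=> k1; apply: (L2_real (measurable_bump k a b) (integrable_indic_box _ _)) => x.
apply: le_trans (bump_le_indic a b x k1).
by have := bump_ge0 k a b x; have := bump_le1 k a b x; nra.
Qed.

(** * Closed subspaces of L^2 containing all bumps *)

Section ClosedSubspace.
Import HBNNSimple.
Variable T : set (X -> R[i]).
Hypothesis T_L2 : forall f, T f -> L2 mu f.
Hypothesis T_bump : forall (n : nat) a b, T (fun x => (bump n.+1%:R a b x)%:C).
Hypothesis TD : forall f g, T f -> T g -> T (fun x => f x + g x).
Hypothesis TZ : forall z f, T f -> T (fun x => z * f x).
Hypothesis T_lim : forall f, L2 mu f ->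
  (forall eps, 0 < eps -> exists h, T h /\ L2normsq mu (fun x => f x - h x) < eps) -> T f.

Lemma T_dominated_limit f (u : nat -> X -> R[i]) (F : X -> R) :
  L2 mu f -> (forall n, T (u n)) -> mu.-integrable setT (EFin \o F) ->
  (forall n x, csq (f x - u n x) <= F x) ->
  (forall x, csq (f x - u n x) @[n --> \oo] --> (0 : R)) -> T f.
Proof.
move=> Lf Tu iF le lim; apply: T_lim => // eps eps0.
have [|n hn] := @L2_dominated_limit f u F eps (L2_cmeas Lf) _ iF le lim eps0.
  by move=> n; exact: L2_cmeas (T_L2 (Tu n)).
by exists (u n).
Qed.

Lemma L2_indic_sub A a b : measurable A -> A `<=` cbox a b ->
  L2 mu (fun x => (\1_A x)%:C).
Proof.
move=> mA sA; have mE : measurable_fun setT (\1_A : X -> R) by exact: measurable_indic.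
apply: (L2_real mE (integrable_indic_box a b)) => x.
rewrite !indicE -natrX ler_nat.
case: (boolP (x \in A)) => // /set_mem /sA xb.
by rewrite mem_set.
Qed.

Lemma T_cbox a b : T (fun x => (\1_(cbox a b) x)%:C).
Proof.
apply: (@T_dominated_limit _ (fun n x => (bump n.+1%:R a b x)%:C)
  (fun x => \1_(enlarge a b) x)).
- exact: (L2_indic_sub (measurable_cbox a b) (@subset_refl _ _)).
- by move=> n.
- exact: integrable_indic_box.
- move=> n x; rewrite -rmorphB csq_real.
  have k1 : 1 <= n.+1%:R :> R by rewrite ler1n.
  have := bump_le_indic a b x k1; have := bump_ge0 n.+1%:R a b x.
  have := bump_le1 n.+1%:R a b x; rewrite !indicE.
  case: (boolP (x \in cbox a b)) => [/set_mem xe|xe].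
    rewrite bump_eq1 // subrr expr0n /= => *; lra.
  by move=> *; rewrite sub0r sqrrN; nra.
- move=> x; apply: cvg_near_cst; near=> n.
  rewrite (near (bump_cvg a b x) n) // subrr csq0 //.
Unshelve. all: by end_near. Qed.

Lemma T_0 : T (fun=> 0).
Proof.
have := TZ 0 (T_cbox (cst_tuple m 0) (cst_tuple m 0)); congr T.
by apply/funext => x; rewrite mul0r.
Qed.

Lemma T_sum (J : eqType) (s : seq J) (F : J -> X -> R[i]) :
  (forall j, j \in s -> T (F j)) -> T (fun x => \sum_(j <- s) F j x).
Proof.
elim: s => [|j s IH] H; first by under eq_fun do rewrite big_nil; exact: T_0.
under eq_fun do rewrite big_cons.
apply: TD; first by apply: H; rewrite mem_head.
by apply: IH => i js; apply: H; rewrite inE js orbT.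
Qed.

(** Dynkin induction from the boxes. Cutting with a cube keeps all indicators square integrable,
    makes complements differences of two members of [T], and supplies the dominating function for
    disjoint unions. *)
Lemma T_indic N A : measurable A -> T (fun x => (\1_(A `&` cube N) x)%:C).
Proof.
move=> mA; have := mA; rewrite measurable_cboxes.
pose P (A : set X) := T (fun x => (\1_(A `&` cube N) x)%:C).
move: A {mA}; apply: (@dynkin_induction _ X (@cboxes R m) P) => //.
- exact: measurable_cboxes.
- exact: cboxes_setI.
- by rewrite /P setTI; exact: T_cbox.
- by move=> _ [a [b ->]]; rewrite /P /cube cboxI; exact: T_cbox.
- move=> S mS PS; rewrite /P.
  have := TD (T_cbox (cst_tuple m (- N%:R)) (cst_tuple m N%:R)) (TZ (-1) PS).
  congr T; apply/funext => x; rewrite mulN1r -rmorphB; congr (_ %:C).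
  rewrite !indicE !in_setI in_setC -/(cube N).
  by case: (x \in S); case: (x \in cube N); rewrite /= ?subr0 ?subrr.
- move=> F mF tF PF; rewrite /P.
  have partial_sum n x : \sum_(k <- iota 0 n) (\1_(F k `&` cube N) x)%:C =
      (\1_((\bigcup_(k in [set k | (k < n)%N]) F k) `&` cube N) x)%:C :> R[i].
    rewrite -rmorph_sum /=; congr (_ %:C).
    have [[k /= kn Fk]|nF] := pselect ((\bigcup_(k in [set k | (k < n)%N]) F k) x).
      rewrite (bigD1_seq k) ?iota_uniq ?mem_iota //= big1 ?addr0.
        have Uk : (\bigcup_(k in [set k | (k < n)%N]) F k) x by exists k.
        by rewrite !indicE !in_setI (mem_set Fk) (mem_set Uk).
      move=> j /eqP jk; rewrite indicE memNset // => -[Fj _]; apply: jk.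
      by move/trivIsetP : tF => /(_ j k I I); case: eqVneq => // _ /(_ isT) => e; have : (F j `&` F k) x by []; rewrite e.
    rewrite big1_seq; last first.
      move=> j /andP[_]; rewrite mem_iota /= add0n => jn.
      by rewrite indicE memNset // => -[Fj _]; apply: nF; exists j.
    by rewrite indicE memNset // => -[].
  apply: (@T_dominated_limit _ (fun n x => \sum_(k <- iota 0 n) (\1_(F k `&` cube N) x)%:C)
    (fun x => \1_(cube N) x)).
  + by apply: (@L2_indic_sub _ (cst_tuple m (- N%:R)) (cst_tuple m N%:R));
      [apply: measurableI; [exact: bigcup_measurable|exact: measurable_cbox]|exact: subIsetr].
  + by move=> n; apply: T_sum => k _; exact: PF.
  + exact: integrable_indic_box.
  + move=> n x; rewrite partial_sum -rmorphB csq_real !indicE !in_setI.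
    case: (x \in cube N); rewrite /= ?andbF ?andbT ?subrr ?expr0n //.
    by case: (_ \in _); case: (_ \in _); rewrite /= ?subr0 ?subrr ?sub0r ?sqrrN ?expr1n ?expr0n.
  + move=> x; apply: cvg_near_cst.
    have [[k _ Fk]|nF] := pselect ((\bigcup_k F k) x).
      exists k.+1 => // n /= kn; rewrite partial_sum !indicE !in_setI.
      have U1 : (\bigcup_k F k) x by exists k.
      have Un : (\bigcup_(k in [set k | (k < n)%N]) F k) x by exists k.
      by rewrite (mem_set U1) (mem_set Un) subrr csq0.
    apply: nearW => n; rewrite partial_sum !indicE !in_setI.
    have nFn : ~ (\bigcup_(k in [set k | (k < n)%N]) F k) x.
      by move=> [k _ Fk]; apply: nF; exists k.
    by rewrite (memNset nF) (memNset nFn) subrr csq0.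
Qed.

Lemma T_nonneg (f : X -> R) : measurable_fun setT f -> (forall x, 0 <= f x) ->
  mu.-integrable setT (EFin \o (fun x => f x ^+ 2)) -> T (fun x => (f x)%:C).
Proof.
move=> mf f0 if2.
have mEf : measurable_fun setT (EFin \o f) by exact/measurable_EFinP.
pose g := nnsfun_approx measurableT mEf.
have gcvg x : g ^~ x @ \oo --> f x.
  have f0' y : setT y -> (0 <= (EFin \o f) y)%E by rewrite lee_fin.
  exact: (fine_cvg (cvg_nnsfun_approx measurableT mEf f0' (x := x) I)).
have gle n x : g n x <= f x.
  have -> : f x = limn (g ^~ x) by apply/esym/cvg_lim => //; exact: gcvg.
  apply: nondecreasing_cvgn_le; last by apply/cvg_ex; exists (f x); exact: gcvg.
  by move=> i j ij; have /lefP := nd_nnsfun_approx measurableT mEf ij; exact.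
have g0 n x : 0 <= g n x by [].
have i01 n x : 0 <= (\1_(cube n) x : R) <= 1.
  by rewrite indicE; case: (_ \in _); rewrite /= ?lexx ?ler01.
(* The simple approximations are cut off to growing cubes so that [T_indic] covers their level sets;
   both [f] and the approximation lie between 0 and [f], hence the bound [f x ^+ 2]. *)
apply: (@T_dominated_limit _ (fun n x => (g n x * \1_(cube n) x)%:C) (fun x => f x ^+ 2)).
- by apply: (L2_real mf if2).
- move=> n.
  have -> : (fun x => (g n x * \1_(cube n) x)%:C) = (fun x =>
      \sum_(y <- fset_set (range (g n))) y%:C * (\1_(g n @^-1` [set y] `&` cube n) x)%:C).
    apply/funext => x; rewrite fimfunE fsbig_finite //= mulr_suml rmorph_sum /=.
    apply: eq_bigr => y _; rewrite -rmorphM; congr (_ %:C).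
    by rewrite -mulrA indicI.
  apply: T_sum => y _; apply: TZ; apply: T_indic.
  by rewrite -[X in measurable X]setTI; exact: measurable_funP.
- exact: if2.
- move=> n x; rewrite -rmorphB csq_real.
  have := gle n x; have := g0 n x; have := f0 x; case/andP: (i01 n x).
  move: (g n x) (f x) (\1_(cube n) x) => G ff c c0 c1 ff0 G0 le.
  have t0 : 0 <= G * c by rewrite mulr_ge0.
  have t1 : G * c <= ff by nra.
  by move: (G * c) t0 t1 => t t0 t1; nra.
- move=> x; have [N xN] := ex_cube x.
  have : (f x - g n x) ^+ 2 @[n --> \oo] --> (f x - f x) ^+ 2.
    by rewrite expr2; under eq_fun do rewrite expr2; apply: cvgM; apply: cvgB => //; exact: cvg_cst.
  rewrite subrr expr0n /=; apply: cvg_trans; apply: near_eq_cvg.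
  exists N => // n /= Nn; rewrite -rmorphB csq_real indicE mem_set ?mulr1 //.
  exact: cube_le xN.
Qed.

(** Density in the form of an induction principle. It serves for the functions orthogonal to [g] and
    for those with uniform tails. *)
Theorem L2_sub_closed f : L2 mu f -> T f.
Proof.
move=> Lf; have [mr mi] := L2_cmeas Lf.
have part (p : X -> R) : measurable_fun setT p -> (forall x, p x ^+ 2 <= csq (f x)) ->
    T (fun x => (p x)%:C).
  move=> mp le.
  have iq (q : X -> R) : measurable_fun setT q -> (forall x, q x ^+ 2 <= p x ^+ 2) ->
      mu.-integrable setT (EFin \o (fun x => q x ^+ 2)).
    move=> mq qp; apply: le_integrable (L2_integrable Lf) => //.
      by apply/measurable_EFinP; exact: measurable_funX.
    move=> x _ /=; rewrite lee_fin !ger0_norm ?sqr_ge0 ?csq_ge0 //.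
    exact: le_trans (le x).
  have pos : T (fun x => (p^\+ x)%:C).
    apply: T_nonneg; first exact: measurable_funrpos.
      by move=> x; rewrite /funrpos le_max lexx orbT.
    apply: iq; first exact: measurable_funrpos.
    by move=> x; rewrite /funrpos; case: (lerP (p x) 0) => h; rewrite ?expr0n /= ?sqr_ge0.
  have neg : T (fun x => (p^\- x)%:C).
    apply: T_nonneg; first exact: measurable_funrneg.
      by move=> x; rewrite /funrneg le_max lexx orbT.
    apply: iq; first exact: measurable_funrneg.
    move=> x; rewrite /funrneg; case: (lerP (- p x) 0) => h; rewrite ?expr0n /= ?sqr_ge0 //.
    by rewrite sqrrN.
  have := TD pos (TZ (-1) neg); congr T; apply/funext => x.
  rewrite mulN1r -rmorphB; congr (_ %:C); rewrite /funrpos /funrneg.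
  by case: (lerP (p x) 0) => h; case: (lerP (- p x) 0) => h'; lra.
have := TD (part _ mr (fun x => Re_sqr_le _)) (TZ 'i (part _ mi (fun x => Im_sqr_le _))).
congr T; apply/funext => x; case: (f x) => u v /=.
by simpc.
Qed.

End ClosedSubspace.
End Density.

(** * Counting points and Bessel bounds for Gabor atoms *)

Section TimeFrequencyPoints.
Variables (R : realType) (m : nat).
Local Notation X := (m.-tuple R).
Implicit Types (p q z : X * X).

Definition subP p q : X * X := (subT p.1 q.1, subT p.2 q.2).

Definition origin : X * X := (cst_tuple m 0, cst_tuple m 0).

Lemma tnth_subT (u v : X) i : tnth (subT u v) i = tnth u i - tnth v i.
Proof. by rewrite tnth_mktuple. Qed.

Lemma subT0 (u : X) : subT u (cst_tuple m 0) = u.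
Proof. by apply: eq_from_tnth => i; rewrite !tnth_mktuple subr0. Qed.

Lemma dinf_le p q (r : R) : 0 <= r ->
  dinf p q <= r <-> forall i, `|tnth p.1 i - tnth q.1 i| <= r /\
                              `|tnth p.2 i - tnth q.2 i| <= r.
Proof.
move=> r0; rewrite /dinf ge_max; split.
  move=> /andP[/bigmax_leP[_ h1] /bigmax_leP[_ h2]] i.
  by split; [exact: h1|exact: h2].
by move=> H; apply/andP; split; apply/bigmax_leP; split => // i _; case: (H i).
Qed.

Lemma dinf_ge0 p q : 0 <= dinf p q.
Proof. by rewrite /dinf le_max bigmax_ge_id. Qed.

Lemma dinf_coord p q i : `|tnth p.1 i - tnth q.1 i| <= dinf p q /\
                         `|tnth p.2 i - tnth q.2 i| <= dinf p q.
Proof. by move: i; apply/(dinf_le p q (dinf_ge0 p q)). Qed.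

Lemma dinfC p q : dinf p q = dinf q p.
Proof.
rewrite /dinf; congr Num.max; apply: eq_bigr => i _; exact: distrC.
Qed.

Lemma dinf_triangle p q z : dinf p z <= dinf p q + dinf q z.
Proof.
apply/dinf_le; first by rewrite addr_ge0 // dinf_ge0.
move=> i; have [h1 h2] := dinf_coord p q i; have [h3 h4] := dinf_coord q z i.
split.
- by apply: le_trans (lerD h1 h3); exact: ler_distD.
- by apply: le_trans (lerD h2 h4); exact: ler_distD.
Qed.

Lemma dinf_subP p q z : dinf (subP p z) (subP q z) = dinf p q.
Proof.
rewrite /dinf; congr Num.max; apply: eq_bigr => i _;
  by rewrite !tnth_subT opprB addrA subrK.
Qed.

Lemma dinf_subP_origin p z : dinf (subP p z) origin = dinf p z.
Proof.
rewrite /dinf; congr Num.max; apply: eq_bigr => i _;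
  by rewrite tnth_subT tnth_mktuple subr0.
Qed.

Lemma dinf_reflect p q : dinf (subP origin p) (subP origin q) = dinf p q.
Proof.
rewrite /dinf; congr Num.max; apply: eq_bigr => i _;
  by rewrite !tnth_subT !tnth_mktuple !sub0r opprK addrC distrC.
Qed.

Definition decay (u : R) : R := (1 + u ^+ 2)^-1.

Lemma decay_gt0 u : 0 < decay u.
Proof. by rewrite invr_gt0 ltr_pwDl // sqr_ge0. Qed.

Definition weight p : R :=
  (\prod_(i < m) decay (tnth p.1 i)) * (\prod_(i < m) decay (tnth p.2 i)).

Lemma weight_reflect p q : weight (subP p q) = weight (subP q p).
Proof.
rewrite /weight; congr (_ * _); apply: eq_bigr => i _;
  by rewrite /decay !tnth_subT -sqrrN opprB.
Qed.

Section Counting.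
Variable r : R.
Hypothesis r_gt0 : 0 < r.

(* Numbers with the same code lie in a common cell of length r; the parity
   records the sign. *)
Definition code (u : R) : nat :=
  if 0 <= u then (Num.truncn (u / r)).*2 else (Num.truncn (- u / r)).*2.+1.

Lemma truncn_cell (u v : R) : 0 <= u -> 0 <= v ->
  Num.truncn (u / r) = Num.truncn (v / r) -> `|u - v| <= r.
Proof.
move=> u0 v0 e.
have /truncn_itv /andP[h1 h2] : 0 <= u / r by rewrite divr_ge0 // ltW.
have /truncn_itv /andP[h3 h4] : 0 <= v / r by rewrite divr_ge0 // ltW.
rewrite e in h1 h2; move: h1 h2 h3 h4; rewrite -natr1; move: (_%:R) => n.
rewrite !ler_pdivlMr // !ltr_pdivrMr // => *.
by rewrite ler_norml; apply/andP; split; nra.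
Qed.

Lemma code_inj (u v : R) : code u = code v -> `|u - v| <= r.
Proof.
rewrite /code; case: (lerP 0 u) => u0; case: (lerP 0 v) => v0 e.
- by apply: truncn_cell => //; exact: double_inj.
- by have := congr1 odd e; rewrite /= !odd_double.
- by have := congr1 odd e; rewrite /= !odd_double.
- rewrite -normrN opprD; apply: truncn_cell; rewrite ?oppr_ge0 ?ltW //.
  by case: e => /double_inj.
Qed.

(** With [t = 2 / r * |u|], the code of [u] is at most [t + 1], and
    [(t + 2) * (t + 3) <= 2 * t ^+ 2 + 18], which is at most this constant times [1 + u ^+ 2]. *)
Definition cell_const : R := 2 * (2 / r) ^+ 2 + 18.

(** A substitute for inverse squares that telescopes, with all partial sums at most 1. *)
Definition cell_decay (k : nat) : R := (k.+1%:R * k.+2%:R)^-1.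

Lemma code_le u : (code u)%:R <= 2 / r * `|u| + 1.
Proof.
have H v : 0 <= v -> (Num.truncn (v / r)).*2%:R <= 2 / r * v.
  move=> v0; have /truncn_itv /andP[h _] : 0 <= v / r by rewrite divr_ge0 // ltW.
  by rewrite -muln2 natrM mulrC -mulrA [r^-1 * _]mulrC ler_pM2l.
rewrite /code; case: (lerP 0 u) => u0.
  by rewrite ger0_norm // (le_trans (H _ u0)) // lerDl.
by rewrite ltr0_norm // -natr1 lerD2r H // oppr_ge0 ltW.
Qed.

Lemma decay_code u : decay u <= cell_const * cell_decay (code u).
Proof.
rewrite /decay /cell_decay -div1r ler_pdivrMr; last by rewrite ltr_pwDl // sqr_ge0.
rewrite mulrAC ler_pdivlMr ?mulr_gt0 ?ltr0n // mul1r.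
have e1 : (code u).+1%:R = (code u)%:R + 1 :> R by rewrite natr1.
have e2 : (code u).+2%:R = (code u)%:R + 2 :> R by rewrite -natrD addn2.
rewrite e1 e2 -(real_normK (num_real u)) /cell_const.
have c0 : 0 <= (code u)%:R :> R by rewrite ler0n.
move: (code_le u) (normr_ge0 u) c0.
have A0 : 0 <= 2 / r by rewrite divr_ge0 // ltW.
move: (code u)%:R (2 / r) `|u| A0 => c A w A0 cw w0 c0.
have Aw : 0 <= A * w by rewrite mulr_ge0.
have : (c + 1) * (c + 2) <= (A * w + 2) * (A * w + 3) by apply: ler_pM; lra.
have := sqr_ge0 (A * w - 3); have := sqr_ge0 A; have := sqr_ge0 w.
have -> : (2 * A ^+ 2 + 18) * (1 + w ^+ 2) =
    2 * A ^+ 2 + 18 + 18 * w ^+ 2 + 2 * (A * w) ^+ 2 by ring.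
move: (A * w) (A ^+ 2) (w ^+ 2) => t a b; nra.
Qed.

Lemma sum_cell_decay n : \sum_(j < n) cell_decay j <= 1.
Proof.
have : \sum_(j < n) cell_decay j = 1 - n.+1%:R^-1.
  elim: n => [|n IH]; first by rewrite big_ord0 invr1 subrr.
  rewrite big_ord_recr /= IH /cell_decay; field.
  by rewrite -![_ + _]natrD -natr1 ?gt_eqF //; apply/andP; split; rewrite gt_eqF // -?natrD ltr0n.
by move=> ->; rewrite gerBl invr_ge0.
Qed.

(** Multiplicities count, as repetitions in [Lambda] require. The centre [z] ranges over the whole
    phase space, so the property survives translations and reflections. *)
Definition sparse (K : nat) (M : seq (X * X)) : Prop :=
  forall z, (count (fun p : X * X => (dinf p z <= r)%R) M <= K)%N.

(** Points are sorted by the codes of their [2 * m] coordinates relative to [z]. Points with equal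
    codes are within [r] of each other, so each class has at most [K] of them, and the sum of the
    bounds over all codes factors into one-dimensional telescoping sums. *)
Lemma sum_weight_le K M z : sparse K M ->
  \sum_(p <- M) weight (subP p z) <= K%:R * (cell_const ^+ m) ^+ 2.
Proof.
move=> sepM.
pose c1 p i := code (tnth (subP p z).1 i); pose c2 p i := code (tnth (subP p z).2 i).
(* A crude bound on all codes that occur; it only serves to make the set of codes a finite type, and
   drops out of the estimate. *)
pose n := (\sum_(p <- M) \sum_(i < m) (c1 p i + c2 p i))%N.
have le_n p i : p \in M -> (c1 p i < n.+1)%N /\ (c2 p i < n.+1)%N.
  move=> pM; rewrite !ltnS.
  have : (c1 p i + c2 p i <= n)%N.
    rewrite /n (big_rem p pM) /= (bigD1 i) //= -addnA; exact: leq_addr.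
  by move=> h; split; apply: leq_trans h; rewrite ?leq_addr ?leq_addl.
pose T := ({ffun 'I_m -> 'I_n.+1} * {ffun 'I_m -> 'I_n.+1})%type.
pose kappa p : T := ([ffun i => inord (c1 p i)], [ffun i => inord (c2 p i)]).
pose F (k : T) : R := (\prod_(i < m) (cell_const * cell_decay (k.1 i))) *
                      (\prod_(i < m) (cell_const * cell_decay (k.2 i))).
have C0 : 0 <= cell_const by rewrite addr_ge0 // mulr_ge0 // sqr_ge0.
have d0 k : 0 <= cell_decay k by rewrite invr_ge0 mulr_ge0.
have F0 k : 0 <= F k by rewrite mulr_ge0 // prodr_ge0 // => i _; rewrite mulr_ge0.
apply: (@le_trans _ _ (\sum_(p <- M) F (kappa p))).
  rewrite !big_seq; apply: ler_sum => p pM; apply: ler_pM.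
  - by apply: prodr_ge0 => i _; rewrite ltW // decay_gt0.
  - by apply: prodr_ge0 => i _; rewrite ltW // decay_gt0.
  - apply: ler_prod => i _; rewrite ltW ?decay_gt0 //= ffunE inordK ?decay_code //.
    by case: (le_n p i pM).
  - apply: ler_prod => i _; rewrite ltW ?decay_gt0 //= ffunE inordK ?decay_code //.
    by case: (le_n p i pM).
rewrite (partition_big kappa xpredT) //=.
apply: (@le_trans _ _ (\sum_k K%:R * F k)).
  apply: ler_sum => k _.
  under eq_bigr => p /eqP -> do [].
  rewrite big_const_seq iter_addr_0 -[leLHS]mulr_natl ler_wpM2r // ler_nat.
  case: (boolP (has (fun p => kappa p == k) M)) => [/hasP[q qM /eqP kq]|]; last first.
    by rewrite has_count -leqNgt => /leq_trans; apply.
  apply: leq_trans (sepM q).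
  rewrite (@eq_in_count _ _ (predI (fun p => kappa p == k) (mem M))); last first.
    by move=> p pM; rewrite /= pM andbT.
  apply: sub_count => p /= /andP[/eqP kp pM].
  apply/dinf_le; first exact: ltW.
  move=> i; have := congr1 (fun k : T => (nat_of_ord (k.1 i), nat_of_ord (k.2 i))) (etrans kp (esym kq)).
  have [a1 a2] := le_n p i pM; have [b1 b2] := le_n q i qM.
  rewrite /= !ffunE !inordK // => -[/code_inj h1 /code_inj h2].
  by move: h1 h2; rewrite !tnth_subT !opprB !addrA !subrK.
rewrite -mulr_sumr ler_wpM2l //.
rewrite -(pair_bigA _ (fun k1 k2 : {ffun 'I_m -> 'I_n.+1} =>
  (\prod_(i < m) (cell_const * cell_decay (k1 i))) *
  (\prod_(i < m) (cell_const * cell_decay (k2 i))))) /=.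
under eq_bigr do rewrite -mulr_sumr.
rewrite -mulr_suml -(bigA_distr_bigA (fun (i : 'I_m) (j : 'I_n.+1) => cell_const * cell_decay j)).
have S0 : 0 <= \prod_(i < m) \sum_(j < n.+1) cell_const * cell_decay j <= cell_const ^+ m.
  apply/andP; split.
    by apply: prodr_ge0 => i _; apply: sumr_ge0 => j _; rewrite mulr_ge0.
  rewrite -[X in _ ^+ X]card_ord -prodr_const; apply: ler_prod => i _.
  rewrite -mulr_sumr mulr_ge0 ?sumr_ge0 //=.
  by rewrite -[leRHS]mulr1 ler_wpM2l // sum_cell_decay.
by rewrite -expr2 lerXn2r ?nnegrE ?exprn_ge0 //; case/andP: S0.
Qed.

End Counting.

End TimeFrequencyPoints.

(** * Covariance of time-frequency shifts and the Schur test *)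

Section GaborAtoms.
Variables (R : realType) (m : nat) (mu : {measure set (m.-tuple R) -> \bar R}).
Local Notation X := (m.-tuple R).
Hypothesis mu_leb : is_lebesgue_Rm mu.
Implicit Types (f g h : X -> R[i]) (l k : X * X).

Lemma expiD (s t : R) : expi s * expi t = expi (s + t).
Proof. by rewrite /expi cosD sinD; simpc; congr (_ +i* _); rewrite addrC. Qed.

Lemma conj_expi (t : R) : (expi t)^* = expi (- t).
Proof. by rewrite conjE /expi /= cosN sinN. Qed.

Lemma expi0 : expi 0 = 1 :> R[i].
Proof. by rewrite /expi cos0 sin0. Qed.

Lemma measurable_dotR (w : X) : measurable_fun setT (dotR w).
Proof.
apply: measurable_sum => i; apply: measurable_funM; first exact: measurable_cst.
exact: measurable_tnth.
Qed.

Lemma measurable_cosT : measurable_fun setT (@cos R).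
Proof. by apply: continuous_measurable_fun; exact: continuous_cos. Qed.

Lemma measurable_sinT : measurable_fun setT (@sin R).
Proof. by apply: continuous_measurable_fun; exact: continuous_sin. Qed.

Lemma cmeas_expi (F : X -> R) : measurable_fun setT F -> cmeas (fun x => expi (F x)).
Proof.
move=> mF; split; first exact: (measurableT_comp measurable_cosT mF).
exact: (measurableT_comp measurable_sinT mF).
Qed.

Lemma cmeas_gabor g ph l : cmeas g -> cmeas (gabor_atom g ph l).
Proof.
move=> mg; apply: cmeasM; last by apply: (cmeas_comp _ mg); exact: measurable_subT.
apply: cmeasM; first exact: cmeas_cst.
apply: cmeas_expi; apply: measurable_funM; first exact: measurable_cst.
exact: measurable_dotR.
Qed.

Lemma csq_gabor g ph l x : csq (gabor_atom g ph l x) = csq (g (subT x l.1)).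
Proof. by rewrite /gabor_atom !csqM !csq_expi !mul1r. Qed.

Lemma L2_gabor g ph l : L2 mu g -> L2 mu (gabor_atom g ph l).
Proof.
move=> Lg; apply: (@L2_dominated _ _ _ _ (fun x => csq (g (subT x l.1)))).
- exact: cmeas_gabor (L2_cmeas Lg).
- exact: (integrable_shift mu_leb l.1 (L2_integrable Lg)).
- by move=> x; rewrite csq_gabor.
Qed.

Lemma L2normsq_gabor g ph l : L2 mu g -> L2normsq mu (gabor_atom g ph l) = L2normsq mu g.
Proof.
move=> Lg; rewrite /L2normsq; under eq_Rintegral do rewrite csq_gabor.
by rewrite (Rintegral_shift mu_leb l.1 (F := fun x => csq (g x))) //; exact: measurable_csq (L2_cmeas Lg).
Qed.

Lemma gabor_origin g : gabor_atom g 0 (origin R m) = g.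
Proof.
apply/funext => x; rewrite /gabor_atom expi0 mul1r subT0.
rewrite (_ : dotR _ _ = 0) ?mulr0 ?expi0 ?mul1r //.
by rewrite /dotR big1 // => i _; rewrite tnth_mktuple mul0r.
Qed.

Lemma L2dot_shift t f g : L2 mu f -> L2 mu g ->
  L2dot mu (fun x => f (subT x t)) (fun x => g (subT x t)) = L2dot mu f g.
Proof.
move=> Lf Lg; have [mr mi] := cmeasM (L2_cmeas Lf) (cmeas_conj (L2_cmeas Lg)).
by rewrite /L2dot -(Rintegral_shift mu_leb t mr) -(Rintegral_shift mu_leb t mi).
Qed.

Lemma dotRBl (u v x : X) : dotR (subT u v) x = dotR u x - dotR v x.
Proof.
by rewrite /dotR -sumrB; apply: eq_bigr => i _; rewrite tnth_subT mulrBl.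
Qed.

Lemma dotRBr (u v x : X) : dotR x (subT u v) = dotR x u - dotR x v.
Proof.
by rewrite /dotR -sumrB; apply: eq_bigr => i _; rewrite tnth_subT mulrBr.
Qed.

(** Time-frequency shifts compose up to unimodular factors, and [csq] forgets these. The factor [c]
    collects the two phases and the values of the modulations at the translation [l.1]. *)
Lemma csq_L2dot_gabor f g p q l k : L2 mu f -> L2 mu g ->
  csq (L2dot mu (gabor_atom f p l) (gabor_atom g q k)) =
  csq (L2dot mu f (gabor_atom g 0 (subP k l))).
Proof.
move=> Lf Lg.
pose c := expi (p - q + 2 * pi * (dotR l.2 l.1 - dotR k.2 l.1)) : R[i].
rewrite (_ : L2dot mu (gabor_atom f p l) (gabor_atom g q k) =
  c * L2dot mu f (gabor_atom g 0 (subP k l))) ?csqM ?csq_expi ?mul1r //.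
rewrite -L2dotZl //; last exact: L2_gabor.
rewrite -[RHS](L2dot_shift l.1 (L2Z c Lf) (L2_gabor 0 (subP k l) Lg)).
have E x : gabor_atom f p l x * (gabor_atom g q k x)^* =
    c * f (subT x l.1) * (gabor_atom g 0 (subP k l) (subT x l.1))^*.
  have e3 : subT (subT x l.1) (subT k.1 l.1) = subT x k.1.
    by apply: eq_from_tnth => i; rewrite !tnth_subT; ring.
  rewrite /gabor_atom /= e3 !rmorphM /= !conj_expi.
  set F := f _; set G := (g _)^*.
  transitivity (expi p * expi (2 * pi * dotR l.2 x) * (expi (- q) * expi (- (2 * pi * dotR k.2 x))) * (F * G)); first by ring.
  transitivity (c * (expi (- 0) * expi (- (2 * pi * dotR (subT k.2 l.2) (subT x l.1)))) * (F * G)); last by ring.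
  rewrite /c !expiD; congr (expi _ * _).
  by rewrite dotRBl !dotRBr; ring.
by rewrite /L2dot; congr (_ +i* _); apply: eq_Rintegral => x _; rewrite E.
Qed.

Lemma csq_L2dotC f g : L2 mu f -> L2 mu g -> csq (L2dot mu f g) = csq (L2dot mu g f).
Proof. by move=> Lf Lg; rewrite (L2dotC Lg Lf) csq_conj. Qed.

(** The adjoint of a shift is the opposite shift up to a phase. This exchanges the roles of [g] and
    a bump, for which continuity and decay are available. *)
Lemma csq_L2dot_reflect f g l : L2 mu f -> L2 mu g ->
  csq (L2dot mu f (gabor_atom g 0 l)) = csq (L2dot mu g (gabor_atom f 0 (subP (origin R m) l))).
Proof.
move=> Lf Lg; rewrite csq_L2dotC //; last exact: L2_gabor.
by rewrite -{1}(gabor_origin f) csq_L2dot_gabor.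
Qed.

(** Duality: for [u] the sum of the [a p * phi p], the real part of the inner product of [f] and [u]
    is the sum [S] to be bounded, while [u] has squared norm at most [C * S]. Cauchy-Schwarz gives
    [S ^+ 2 <= L2normsq mu f * (C * S)]. *)
Lemma schur_bessel (M : seq (X * X)) (phi : X * X -> X -> R[i]) (G : X * X -> X * X -> R) (C : R) f :
  (forall p, L2 mu (phi p)) -> L2 mu f ->
  (forall p q, Num.sqrt (csq (L2dot mu (phi p) (phi q))) <= G p q) ->
  (forall p q, G p q = G q p) ->
  (forall p, \sum_(q <- M) G p q <= C) ->
  \sum_(p <- M) csq (L2dot mu f (phi p)) <= C * L2normsq mu f.
Proof.
move=> Lphi Lf GG Gsym Grow.
have [M0|M1] := eqVneq M [::].
  rewrite M0 big_nil mulr_ge0 ?L2normsq_ge0 //.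
  by have := Grow (origin R m); rewrite M0 big_nil.
pose a p := L2dot mu f (phi p); pose S := \sum_(p <- M) csq (a p).
pose u x := \sum_(p <- M) a p * phi p x.
have G0 p q : 0 <= G p q by apply: le_trans (sqrtr_ge0 _) (GG p q).
have Lu : L2 mu u by exact: L2_sum.
have fu : cRe (L2dot mu f u) = S.
  rewrite L2dot_sumr // /S raddf_sum; apply: eq_bigr => p _.
  transitivity (cRe ((a p)^* * a p)) => //.
  by rewrite conjE; case: (a p) => x y; rewrite /csq /=; ring.
have uu : L2normsq mu u <= C * S.
  rewrite L2normsqE // L2dot_suml //.
  under eq_bigr => p _ do rewrite L2dot_sumr // mulr_sumr.
  rewrite raddf_sum; under eq_bigr => p _ do rewrite raddf_sum.
  (* The product of moduli is at most half the sum of squares; by symmetry of [G] both halves then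
     give the same row sums. *)
  apply: (@le_trans _ _ (\sum_(p <- M) \sum_(q <- M) (2^-1 * (csq (a p) + csq (a q)) * G p q))).
    apply: ler_sum => p _; apply: ler_sum => q _.
    apply: le_trans (ler_norm _) _; apply: le_trans (norm_Re_le _) _.
    rewrite !csqM csq_conj !sqrtrM ?csq_ge0 // mulrA.
    apply: ler_pM; rewrite ?mulr_ge0 ?sqrtr_ge0 //.
    have := sqr_ge0 (Num.sqrt (csq (a p)) - Num.sqrt (csq (a q))).
    rewrite sqrrB !sqr_sqrtr ?csq_ge0 //; lra.
  have -> : \sum_(p <- M) \sum_(q <- M) (2^-1 * (csq (a p) + csq (a q)) * G p q) =
      \sum_(p <- M) csq (a p) * \sum_(q <- M) G p q.
    transitivity (\sum_(p <- M) \sum_(q <- M) (2^-1 * csq (a p) * G p q) +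
                  \sum_(p <- M) \sum_(q <- M) (2^-1 * csq (a q) * G p q)).
      rewrite -big_split; apply: eq_bigr => p _; rewrite -big_split.
      by apply: eq_bigr => q _ /=; ring.
    rewrite [X in _ + X]exchange_big /=.
    rewrite -big_split; apply: eq_bigr => p _; rewrite mulr_sumr -big_split.
    by apply: eq_bigr => q _ /=; rewrite (Gsym q p); field.
  rewrite mulrC /S mulr_suml; apply: ler_sum => p _.
  by rewrite ler_wpM2l ?csq_ge0.
have C0 : 0 <= C.
  by apply: le_trans (Grow (origin R m)); apply: sumr_ge0.
have S0 : 0 <= S by apply: sumr_ge0 => p _; exact: csq_ge0.
have := discriminant_le (a := L2normsq mu f) (b := S) (c := C * S).
have H s : 0 <= L2normsq mu f + 2 * s * S + s ^+ 2 * (C * S).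
  apply: le_trans (L2normsq_ge0 mu (fun x => f x + s%:C * u x)) _.
  by rewrite L2normsqDZ // fu lerD2l ler_wpM2l // sqr_ge0.
move=> /(_ H); rewrite -/S => SS.
have [->|Sn0] := eqVneq S 0; first by rewrite mulr_ge0 ?L2normsq_ge0.
have Sp : 0 < S by rewrite lt_neqAle eq_sym Sn0.
by move: SS; rewrite expr2 mulrA ler_pM2r // mulrC.
Qed.

(** The constant sees [M] only through [r] and [K], never through its length: piling up far-apart
    pieces leaves it unchanged. *)
Lemma bessel_of_decay (D r : R) (K : nat) (M : seq (X * X)) phi f : 0 < r ->
  L2 mu phi -> L2 mu f -> sparse r K M ->
  (forall l, Num.sqrt (csq (L2dot mu phi (gabor_atom phi 0 l))) <= D * weight l) ->
  \sum_(p <- M) csq (L2dot mu f (gabor_atom phi 0 p)) <=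
  D * (K%:R * (cell_const r ^+ m) ^+ 2) * L2normsq mu f.
Proof.
move=> r0 Lphi Lf sep dec.
have W0 l : 0 < weight l by rewrite mulr_gt0 //; apply: prodr_gt0 => i _; exact: decay_gt0.
have D0 : 0 <= D.
  have := dec (origin R m); move=> /(le_trans (sqrtr_ge0 _)).
  by rewrite pmulr_lge0.
apply: (@schur_bessel M (fun p => gabor_atom phi 0 p) (fun p q => D * weight (subP q p))) => //.
- by move=> p; exact: L2_gabor.
- by move=> p q; rewrite csq_L2dot_gabor.
- by move=> p q; rewrite weight_reflect.
- by move=> p; rewrite -mulr_sumr ler_wpM2l // sum_weight_le.
Qed.

End GaborAtoms.

(** * Off-diagonal decay of the Gram matrix of a bump *)

Section SmoothFunctions.
Variable R : realType.
Implicit Types (C D : R) (f g : R -> R).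

(** A quantitative C^{1,1} bound in terms of finite differences, with one constant for all orders;
    no derivative has to exist. *)
Definition smooth_bound C f : Prop := [/\ measurable_fun setT f,
  forall y, `|f y| <= C,
  forall y a, `|f (y + a) - f y| <= C * `|a| &
  forall y a, `|f (y + a) + f (y - a) - 2 * f y| <= C * a ^+ 2].

Lemma smooth_bound_ge0 C f : smooth_bound C f -> 0 <= C.
Proof. by case=> _ h _ _; apply: le_trans (h 0). Qed.

(** The 4 counts the terms of the product rule for second differences. *)
Lemma smooth_boundM C D f g : smooth_bound C f -> smooth_bound D g ->
  smooth_bound (4 * (C * D)) (fun y => f y * g y).
Proof.
move=> sf sg; have C0 := smooth_bound_ge0 sf; have D0 := smooth_bound_ge0 sg.
case: sf => mf f0 f1 f2; case: sg => mg g0 g1 g2.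
have CD0 : 0 <= C * D by rewrite mulr_ge0.
split.
- exact: measurable_funM.
- move=> y; rewrite normrM; apply: (@le_trans _ _ (C * D)); first exact: ler_pM.
  lra.
- move=> y a.
  have -> : f (y + a) * g (y + a) - f y * g y =
    (f (y + a) - f y) * g (y + a) + f y * (g (y + a) - g y) by ring.
  apply: le_trans (ler_normD _ _) _; rewrite !normrM.
  have h1 : `|f (y + a) - f y| * `|g (y + a)| <= C * `|a| * D by exact: ler_pM.
  have h2 : `|f y| * `|g (y + a) - g y| <= C * (D * `|a|) by exact: ler_pM.
  have : 0 <= C * D * `|a| by rewrite mulr_ge0.
  lra.
- move=> y a.
  have -> : f (y + a) * g (y + a) + f (y - a) * g (y - a) - 2 * (f y * g y) =
    f y * (g (y + a) + g (y - a) - 2 * g y) + g y * (f (y + a) + f (y - a) - 2 * f y)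
    + (f (y + a) - f y) * (g (y + a) - g y) + (f (y - a) - f y) * (g (y - a) - g y) by ring.
  apply: le_trans (ler_normD _ _) _; apply: le_trans (lerD (ler_normD _ _) (lexx _)) _.
  apply: le_trans (lerD (lerD (ler_normD _ _) (lexx _)) (lexx _)) _.
  rewrite !normrM.
  have h1 : `|f y| * `|g (y + a) + g (y - a) - 2 * g y| <= C * (D * a ^+ 2) by exact: ler_pM.
  have h2 : `|g y| * `|f (y + a) + f (y - a) - 2 * f y| <= D * (C * a ^+ 2) by exact: ler_pM.
  have h3 : `|f (y + a) - f y| * `|g (y + a) - g y| <= (C * `|a|) * (D * `|a|) by exact: ler_pM.
  have h4 : `|f (y - a) - f y| * `|g (y - a) - g y| <= (C * `|a|) * (D * `|a|).
    by have := f1 y (- a); have := g1 y (- a); rewrite normrN => *; exact: ler_pM.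
  have e : (C * `|a|) * (D * `|a|) = C * D * a ^+ 2.
    by rewrite -(real_normK (num_real a)); ring.
  rewrite e in h3 h4; lra.
Qed.

Lemma smooth_bound_shift C f (t : R) : smooth_bound C f ->
  smooth_bound C (fun y => f (y - t)).
Proof.
case=> mf f0 f1 f2; split.
- by apply: (measurableT_comp mf); apply: measurable_funB => //; exact: measurable_cst.
- by [].
- by move=> y a; rewrite (addrAC y a).
- by move=> y a; rewrite (addrAC y a) (addrAC y (- a)).
Qed.

Lemma smooth_bound_ramp (k c : R) : 1 <= `|k| ->
  smooth_bound (16 * k ^+ 2) (fun y => ramp (c + k * y)).
Proof.
move=> k1; have kk : `|k| <= k ^+ 2.
  by rewrite -(real_normK (num_real k)) expr2 ler_peMr.
split.
- apply: (measurableT_comp (@measurable_ramp R)); apply: measurable_funD; first exact: measurable_cst.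
  by apply: measurable_funM; [exact: measurable_cst|exact: measurable_id].
- by move=> y; rewrite ger0_norm ?ramp_ge0 // (le_trans (ramp_le1 _)) //; lra.
- move=> y a; apply: le_trans (ramp_lip _ _) _.
  have -> : c + k * (y + a) - (c + k * y) = k * a by ring.
  by rewrite normrM; have := normr_ge0 a; have := normr_ge0 k; nra.
- move=> y a; have := ramp_diff2 (c + k * y) (k * a).
  have -> : c + k * y + k * a = c + k * (y + a) by ring.
  have -> : c + k * y - k * a = c + k * (y - a) by ring.
  by rewrite exprMn mulrA.
Qed.

Lemma smooth_bound_plateau (k a b : R) : 1 <= k ->
  smooth_bound (4 * ((16 * k ^+ 2) * (16 * k ^+ 2))) (plateau k a b).
Proof.
move=> k1.
have k1' : 1 <= `|k| by rewrite ger0_norm //; lra.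
have h1 := smooth_bound_ramp (1 - k * a) k1'.
have k2' : 1 <= `|- k| by rewrite normrN.
have h2 := smooth_bound_ramp (1 + k * b) k2'.
rewrite sqrrN in h2.
have := smooth_boundM h1 h2; congr smooth_bound.
by apply/funext => y; rewrite /plateau; congr (ramp _ * ramp _); ring.
Qed.

(* If E (x + s) = - E x then f and half_diff2 s f have the same integral against
   E; this replaces integration by parts. *)
Definition half_diff2 (s : R) f : R -> R :=
  fun y => (2 * f y - f (y - s) - f (y + s)) / 4.

Lemma half_diff2_bound C f s y : smooth_bound C f ->
  `|half_diff2 s f y| <= C * s ^+ 2.
Proof.
move=> sf; have C0 := smooth_bound_ge0 sf; case: sf => _ _ _ /(_ y s) h.
have : 0 <= C * s ^+ 2 by rewrite mulr_ge0 // sqr_ge0.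
move: h; rewrite /half_diff2 !ler_norml => /andP[h1 h2] h3.
by apply/andP; split; lra.
Qed.

Lemma measurable_half_diff2 f s : measurable_fun setT f ->
  measurable_fun setT (half_diff2 s f).
Proof.
move=> mf; apply: measurable_funM; last exact: measurable_cst.
apply: measurable_funB; last first.
  apply: (measurableT_comp mf); apply: measurable_funD => //; exact: measurable_cst.
apply: measurable_funB; first by apply: measurable_funM => //; exact: measurable_cst.
by apply: (measurableT_comp mf); apply: measurable_funB => //; exact: measurable_cst.
Qed.

End SmoothFunctions.

(** * Oscillatory integrals of tensor products *)

Section TensorProducts.
Variables (R : realType) (m : nat) (mu : {measure set (m.-tuple R) -> \bar R}).
Local Notation X := (m.-tuple R).
Hypothesis mu_leb : is_lebesgue_Rm mu.
Implicit Types (h : 'I_m -> R -> R) (E : X -> R) (x : X).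

Definition tensor h x : R := \prod_(i < m) h i (tnth x i).

Lemma measurable_tensor h : (forall i, measurable_fun setT (h i)) ->
  measurable_fun setT (tensor h).
Proof.
move=> mh; apply: measurable_prod => i _.
by apply: (measurableT_comp (mh i)); exact: measurable_tnth.
Qed.

Lemma tensor_bound h (B : 'I_m -> R) (rho : R) x :
  (forall i y, `|h i y| <= B i) -> (forall i y, rho < `|y| -> h i y = 0) ->
  `|tensor h x| <= (\prod_(i < m) B i) * \1_(cbox (cst_tuple m (- rho)) (cst_tuple m rho)) x.
Proof.
move=> hB h0; rewrite indicE; case: (boolP (x \in _)) => [_|].
  by rewrite mulr1 normr_prod; apply: ler_prod => i _; rewrite normr_ge0 hB.
move/negP; rewrite inE => /existsNP[i /negP]; rewrite !tnth_mktuple -ler_norml -ltNge => xi.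
by rewrite mulr0 /tensor (bigD1 i) //= h0 // mul0r normr0.
Qed.

Lemma integrable_tensor h E (B : 'I_m -> R) (rho : R) :
  (forall i, measurable_fun setT (h i)) -> measurable_fun setT E ->
  (forall x, `|E x| <= 1) ->
  (forall i y, `|h i y| <= B i) -> (forall i y, rho < `|y| -> h i y = 0) ->
  mu.-integrable setT (EFin \o (fun x => tensor h x * E x)).
Proof.
move=> mh mE E1 hB h0.
have iB := integrable_indic_box mu_leb (cst_tuple m (- rho)) (cst_tuple m rho).
apply: le_integrable (integrable_Rmull (\prod_(i < m) B i) iB) => //.
  by apply/measurable_EFinP; apply: measurable_funM => //; exact: measurable_tensor.
move=> x _ /=; rewrite lee_fin normrM.
apply: le_trans (ler_norm _).
apply: le_trans (tensor_bound x hB h0).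
by rewrite -[leRHS]mulr1 ler_wpM2l.
Qed.

Lemma Rintegral_tensor_le h E (B : 'I_m -> R) (rho : R) : 0 <= rho ->
  (forall i, measurable_fun setT (h i)) -> measurable_fun setT E ->
  (forall x, `|E x| <= 1) ->
  (forall i y, `|h i y| <= B i) -> (forall i y, rho < `|y| -> h i y = 0) ->
  `|Rintegral mu setT (fun x => tensor h x * E x)| <= (\prod_(i < m) B i) * (2 * rho) ^+ m.
Proof.
move=> rho0 mh mE E1 hB h0.
have iH := integrable_tensor mh mE E1 hB h0.
pose box := cbox (cst_tuple m (- rho)) (cst_tuple m rho).
have iB : mu.-integrable setT (EFin \o \1_box) := integrable_indic_box mu_leb _ _.
apply: le_trans (le_normr_Rintegral _ iH) _ => //.
apply: (@le_trans _ _ (Rintegral mu setT (fun x => (\prod_(i < m) B i) * \1_box x))).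
  apply: le_Rintegral => //.
  - by apply: (integrable_norm iH).
  - exact: integrable_Rmull.
  - move=> x _; rewrite normrM; apply: le_trans (tensor_bound x hB h0).
    by rewrite -[leRHS]mulr1 ler_wpM2l.
rewrite RintegralZl // ler_wpM2l //.
  by apply: prodr_ge0 => i _; apply: le_trans (hB i 0).
have mB : measurable box := measurable_cbox _ _.
rewrite /Rintegral integral_indic // setIT mu_cbox //=; last first.
  by move=> i; rewrite !tnth_mktuple; lra.
rewrite (eq_bigr (fun=> 2 * rho)); first by rewrite prodr_const card_ord.
by move=> i _; rewrite !tnth_mktuple; ring.
Qed.

Lemma tensorD1 h i x :
  tensor h x = h i (tnth x i) * \prod_(j < m | j != i) h j (tnth x j).
Proof. by rewrite /tensor (bigD1 i). Qed.

Definition unit_shift (i : 'I_m) (s : R) : X := [tuple if j == i then s else 0 | j < m].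

(** By translation invariance the integrand may be replaced by its average with weights 1/2, 1/4,
    1/4 over the shifts by 0, [s], [- s] in direction [i]. The sign change of [E] turns this average
    into the second difference of [h i]. *)
Lemma half_diff2_integral h E (B : 'I_m -> R) (rho : R) (i : 'I_m) (s : R) :
  (forall i, measurable_fun setT (h i)) -> measurable_fun setT E ->
  (forall x, `|E x| <= 1) ->
  (forall i y, `|h i y| <= B i) -> (forall i y, rho < `|y| -> h i y = 0) ->
  (forall x, E (subT x (unit_shift i s)) = - E x) ->
  Rintegral mu setT (fun x => tensor h x * E x) =
  Rintegral mu setT (fun x =>
    tensor (fun j => if j == i then half_diff2 s (h j) else h j) x * E x).
Proof.
move=> mh mE E1 hB h0 anti.
pose F x := tensor h x * E x.
have iF : mu.-integrable setT (EFin \o F) := integrable_tensor mh mE E1 hB h0.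
have mF : measurable_fun setT F by apply: measurable_funM => //; exact: measurable_tensor.
have iFs t : mu.-integrable setT (EFin \o (fun x => F (subT x t))) := integrable_shift mu_leb t iF.
have anti' x : E (subT x (unit_shift i (- s))) = - E x.
  rewrite -[x in RHS](_ : subT (subT x (unit_shift i (- s))) (unit_shift i s) = x).
    by rewrite anti opprK.
  apply: eq_from_tnth => j; rewrite !tnth_subT !tnth_mktuple.
  by case: eqP => _; ring.
have tensorE x : tensor (fun j => if j == i then half_diff2 s (h j) else h j) x * E x =
    4^-1 * (2 * F x + (F (subT x (unit_shift i s)) + F (subT x (unit_shift i (- s))))).
  rewrite /F anti anti' !(tensorD1 _ i) eqxx !tnth_subT !tnth_mktuple eqxx.
  set P := \prod_(_ < m | _) _; set P1 := \prod_(_ < m | _) _.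
  set P2 := \prod_(_ < m | _) _; set P3 := \prod_(_ < m | _) _.
  have -> : P1 = P by apply: eq_bigr => j /negPf ji; rewrite ji.
  have -> : P2 = P.
    by apply: eq_bigr => j /negPf ji; rewrite tnth_subT tnth_mktuple ji subr0.
  have -> : P3 = P.
    by apply: eq_bigr => j /negPf ji; rewrite tnth_subT tnth_mktuple ji subr0.
  by rewrite /half_diff2 opprK; field.
under [RHS]eq_Rintegral do rewrite tensorE.
rewrite RintegralZl //; last first.
  have := integrableD measurableT (integrable_Rmull 2 iF)
     (integrableD measurableT (iFs (unit_shift i s)) (iFs (unit_shift i (- s)))).
  by apply: eq_integrable => //.
rewrite RintegralD //; last 2 first.
  exact: integrable_Rmull.
  by have := integrableD measurableT (iFs (unit_shift i s)) (iFs (unit_shift i (- s))).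
rewrite RintegralD // RintegralZl // !(Rintegral_shift mu_leb _ mF).
by rewrite /F; lra.
Qed.

Section Oscillation.
Variables (C rho : R) (h : 'I_m -> R -> R) (E : X -> R) (w : X).
Hypothesis rho_ge0 : 0 <= rho.
Hypothesis sh : forall i, smooth_bound C (h i).
Hypothesis h_support : forall i y, rho < `|y| -> h i y = 0.
Hypothesis mE : measurable_fun setT E.
Hypothesis E1 : forall x, `|E x| <= 1.
Hypothesis E_anti : forall i, 1 <= `|tnth w i| ->
  forall x, E (subT x (unit_shift i (2 * tnth w i)^-1)) = - E x.

(** The first [n] coordinates have been treated. The shift [(2 * tnth w i)^-1] is half a period of
    the oscillation; when the frequency is below 1 the coordinate is left alone, as its decay factor
    is at least 1/2 anyway. *)
Let damped (n : nat) (i : 'I_m) : R -> R :=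
  if (i < n)%N && (1 <= `|tnth w i|) then half_diff2 (2 * tnth w i)^-1 (h i) else h i.

Let damped_bound n i y : `|damped n i y| <= C.
Proof.
rewrite /damped; case: ifP => [/andP[_ w1]|_]; last by case: (sh i).
apply: le_trans (half_diff2_bound _ _ (sh i)) _.
have C0 := smooth_bound_ge0 (sh i).
rewrite -[leRHS]mulr1 ler_wpM2l // exprVn invf_le1.
  by rewrite exprMn -(real_normK (num_real (tnth w i))); nra.
by rewrite exprMn -(real_normK (num_real (tnth w i))); nra.
Qed.

Let damped_support n i y : rho + 1 < `|y| -> damped n i y = 0.
Proof.
move=> yr; rewrite /damped; case: ifP => [/andP[_ w1]|_]; last first.
  by rewrite h_support //; lra.
have s1 : `|(2 * tnth w i)^-1| <= 1.
  by rewrite normfV normrM ger0_norm // invf_le1; nra.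
have := ler_distD 0 y (2 * tnth w i)^-1.
rewrite /half_diff2 !h_support //; first by move=> _; field.
- apply: lt_le_trans (lerB_normD _ _); lra.
- apply: lt_le_trans (lerB_dist _ _); lra.
- lra.
Qed.

Let measurable_damped n i : measurable_fun setT (damped n i).
Proof.
rewrite /damped; case: ifP => _; last by case: (sh i).
by apply: measurable_half_diff2; case: (sh i).
Qed.

Let damped_step n : (n < m)%N ->
  Rintegral mu setT (fun x => tensor (damped n) x * E x) =
  Rintegral mu setT (fun x => tensor (damped n.+1) x * E x).
Proof.
move=> nm; pose i := Ordinal nm.
case: (lerP 1 `|tnth w i|) => w1; last first.
  congr Rintegral; apply/funext => x; congr (_ * _); apply: eq_bigr => j _.
  rewrite /damped ltnS [in RHS]leq_eqVlt; case: eqP => // ji.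
  have -> : j = i by exact: val_inj.
  by rewrite /= ltnn /= leNgt w1.
rewrite (half_diff2_integral (B := fun=> C) (rho := rho + 1) (i := i) (s := (2 * tnth w i)^-1)) //.
- congr Rintegral; apply/funext => x; congr (_ * _); apply: eq_bigr => j _.
  case: (eqVneq j i) => [->|ji]; first by rewrite /damped /= ltnn ltnSn /= w1.
  rewrite /damped ltnS [in RHS]leq_eqVlt.
  by rewrite -val_eqE /= in ji; rewrite (negPf ji).
- by move=> *; exact: damped_support.
- exact: E_anti.
Qed.

(** A damped factor is at most [C / (4 * w_i ^+ 2)] and an untouched one at most [C]; both are
    within [2 * C * decay w_i] in their range of frequencies. The shifts have length at most 1,
    whence the support radius [rho + 1]. *)
Lemma oscillation_bound :
  `|Rintegral mu setT (fun x => tensor h x * E x)| <=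
  (\prod_(i < m) (2 * C * decay (tnth w i))) * (2 * (rho + 1)) ^+ m.
Proof.
have eq0 n : (n <= m)%N -> Rintegral mu setT (fun x => tensor h x * E x) =
    Rintegral mu setT (fun x => tensor (damped n) x * E x).
  elim: n => [|n IH] nm; last by rewrite IH 1?ltnW // damped_step.
  by congr Rintegral; apply/funext => x; congr (_ * _); apply: eq_bigr.
rewrite (eq0 m (leqnn m)); apply: Rintegral_tensor_le => //.
- by rewrite addr_ge0.
- move=> i y; have C0 := smooth_bound_ge0 (sh i).
  have d0 := decay_gt0 (tnth w i).
  have dE : decay (tnth w i) * (1 + tnth w i ^+ 2) = 1.
    by rewrite mulVf // gt_eqF // ltr_pwDl // sqr_ge0.
  rewrite /damped ltn_ord /=; case: ifP => w1; last first.
    have w2 : tnth w i ^+ 2 <= 1.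
      by move/negbT: w1; rewrite -ltNge -(real_normK (num_real (tnth w i))) => ?; have := normr_ge0 (tnth w i); nra.
    apply: (@le_trans _ _ C); first by case: (sh i).
    have : 1 <= 2 * decay (tnth w i) by nra.
    nra.
  apply: le_trans (half_diff2_bound _ _ (sh i)) _.
  suff : ((2 * tnth w i)^-1) ^+ 2 <= 2 * decay (tnth w i).
    by move: (_^-1 ^+ 2) => u; nra.
  have w2 : 1 <= tnth w i ^+ 2.
    by rewrite -(real_normK (num_real (tnth w i))); nra.
  have wp : 0 < 4 * tnth w i ^+ 2 by lra.
  rewrite exprVn exprMn -(@ler_pM2r _ (4 * tnth w i ^+ 2)) //.
  have -> : (2 ^+ 2 * tnth w i ^+ 2)^-1 * (4 * tnth w i ^+ 2) = 1.
    by rewrite (_ : 2 ^+ 2 = 4) ?mulVf ?gt_eqF //; ring.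
  nra.
- by move=> *; exact: damped_support.
Qed.

End Oscillation.

End TensorProducts.

Section BumpGram.
Variables (R : realType) (m : nat) (mu : {measure set (m.-tuple R) -> \bar R}).
Local Notation X := (m.-tuple R).
Hypothesis mu_leb : is_lebesgue_Rm mu.

Lemma dotR_unit_shift (w x : X) i s :
  dotR w (subT x (unit_shift i s)) = dotR w x - tnth w i * s.
Proof.
rewrite dotRBr; congr (_ - _); rewrite /dotR (bigD1 i) //= tnth_mktuple eqxx.
by rewrite big1 ?addr0 // => j /negPf ji; rewrite tnth_mktuple ji mulr0.
Qed.

Lemma bump_gram_decay (k : R) (a b : X) : 1 <= k -> exists D : R,
  forall l, Num.sqrt (csq (L2dot mu (fun x => (bump k a b x)%:C)
    (gabor_atom (fun x => (bump k a b x)%:C) 0 l))) <= D * weight l.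
Proof.
move=> k1.
pose C := 4 * ((16 * k ^+ 2) * (16 * k ^+ 2)).
(* All one-dimensional factors vanish outside [[- rho, rho]]; the 1 covers the ramps, of width at
   most [1 / k]. *)
pose rho := \sum_(i < m) (`|tnth a i| + `|tnth b i|) + 1.
have rho0 : 0 <= rho.
  by rewrite addr_ge0 // sumr_ge0 // => i _; rewrite addr_ge0.
pose f i := plateau k (tnth a i) (tnth b i).
have sf i : smooth_bound C (f i) by exact: smooth_bound_plateau.
have f0 i y : rho < `|y| -> f i y = 0.
  move=> hy; have : `|tnth a i| + `|tnth b i| + 1 < `|y|.
    apply: le_lt_trans hy; rewrite lerD2r (bigD1 i) //= lerDl.
    by apply: sumr_ge0 => j _; rewrite addr_ge0.
  have := ler_norm (- tnth a i); have := ler_norm (tnth b i); rewrite normrN => h1 h2.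
  have := normr_ge0 (tnth a i); have := normr_ge0 (tnth b i) => h3 h4.
  case: (lerP 0 y) => y0.
    by rewrite (ger0_norm y0) => h; apply: plateau_eq0r; nra.
  by rewrite (ltr0_norm y0) => h; apply: plateau_eq0l; nra.
pose C' := 4 * (C * C).
(* Decay in time comes from supports: the entry is 0 once some [|t_i|] exceeds [2 * rho], and
   otherwise [T * decay t_i >= 1] pays for the missing factor. *)
pose T := 1 + (2 * rho) ^+ 2.
have T1 : 1 <= T by rewrite lerDl sqr_ge0.
(* The leading 2 adds up the real and the imaginary part, a cosine and a sine integral. *)
exists (2 * (2 * C' * T * (2 * (rho + 1))) ^+ m) => l.
pose h i y := f i y * f i (y - tnth l.1 i).
have C'0 : 0 <= C' by rewrite mulr_ge0 // -expr2 sqr_ge0.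
have hE x : tensor h x = bump k a b x * bump k a b (subT x l.1).
  rewrite /tensor /bump -big_split; apply: eq_bigr => i _.
  by rewrite tnth_subT.
have dotE (e : X -> R) (e' : X -> R) : e = (fun x => cos (2 * pi * dotR l.2 x)) ->
    e' = (fun x => - sin (2 * pi * dotR l.2 x)) ->
    L2dot mu (fun x => (bump k a b x)%:C) (gabor_atom (fun x => (bump k a b x)%:C) 0 l) =
    Rintegral mu setT (fun x => tensor h x * e x) +i*
    Rintegral mu setT (fun x => tensor h x * e' x).
  move=> -> ->; rewrite /L2dot; congr (_ +i* _); apply: eq_Rintegral => x _;
    by rewrite hE /gabor_atom expi0 mul1r conjE /expi /=; ring.
have W0 : 0 <= weight l.
  by rewrite mulr_ge0 //; apply: prodr_ge0 => i _; rewrite ltW // decay_gt0.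
have rho1 : 0 <= 2 * (rho + 1) by rewrite mulr_ge0 // addr_ge0.
have A0 : 0 <= 2 * C' * T * (2 * (rho + 1)).
  have T0 : 0 <= T by lra.
  by rewrite mulr_ge0 // mulr_ge0 // mulr_ge0.
rewrite (dotE _ _ erefl erefl).
have [[i far]|close] := pselect (exists i, 2 * rho < `|tnth l.1 i|).
  have tz x : tensor h x = 0.
    rewrite /tensor (bigD1 i) //= /h; case: (lerP `|tnth x i| rho) => xr; last first.
      by rewrite f0 // !mul0r.
    rewrite (f0 i (tnth x i - tnth l.1 i)) ?mulr0 ?mul0r //.
    have := ler_distD (tnth x i) 0 (tnth l.1 i).
    by rewrite !sub0r !normrN; lra.
  have z (e : X -> R) : Rintegral mu setT (fun x => tensor h x * e x) = 0.
    rewrite -[RHS](mul0r (fine (mu setT))) -Rintegral_cst //.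
    by apply: eq_Rintegral => x _; rewrite tz mul0r.
  by rewrite !z csq0 sqrtr0 mulr_ge0 // mulr_ge0 // exprn_ge0.
have sh i : smooth_bound C' (h i).
  by apply: smooth_boundM => //; exact: smooth_bound_shift.
have h0 i y : rho < `|y| -> h i y = 0 by move=> hy; rewrite /h f0 // mul0r.
have bnd : (\prod_(i < m) (2 * C' * decay (tnth l.2 i))) * (2 * (rho + 1)) ^+ m <=
    (2 * C' * T * (2 * (rho + 1))) ^+ m * weight l.
  have pc (c : R) : c ^+ m = \prod_(i < m) c by rewrite prodr_const card_ord.
  rewrite /weight !pc -!big_split; apply: ler_prod => i _ /=.
  have d1 := decay_gt0 (tnth l.1 i); have d2 := decay_gt0 (tnth l.2 i).
  have Td : 1 <= T * decay (tnth l.1 i).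
    rewrite /decay ler_pdivlMr ?mul1r; last by rewrite ltr_pwDl // sqr_ge0.
    have : `|tnth l.1 i| <= 2 * rho by rewrite leNgt; apply/negP => ?; apply: close; exists i.
    rewrite /T -(real_normK (num_real (tnth l.1 i))); have := normr_ge0 (tnth l.1 i); nra.
  have B0 : 0 <= 2 * C' * decay (tnth l.2 i) * (2 * (rho + 1)).
    by rewrite mulr_ge0 // mulr_ge0 ?(ltW d2) // mulr_ge0.
  rewrite B0 /=.
  have -> : 2 * C' * T * (2 * (rho + 1)) * (decay (tnth l.1 i) * decay (tnth l.2 i)) =
    (2 * C' * decay (tnth l.2 i) * (2 * (rho + 1))) * (T * decay (tnth l.1 i)) by ring.
  by rewrite ler_peMr.
have osc (E : X -> R) : measurable_fun setT E -> (forall x, `|E x| <= 1) ->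
   (forall i, 1 <= `|tnth l.2 i| ->
     forall x, E (subT x (unit_shift i (2 * tnth l.2 i)^-1)) = - E x) ->
   `|Rintegral mu setT (fun x => tensor h x * E x)| <=
    (2 * C' * T * (2 * (rho + 1))) ^+ m * weight l.
  move=> mE E1 anti; apply: le_trans bnd.
  exact: (oscillation_bound mu_leb rho0 sh h0 mE E1 anti).
have shift i x : 1 <= `|tnth l.2 i| ->
    2 * pi * dotR l.2 (subT x (unit_shift i (2 * tnth l.2 i)^-1)) =
    2 * pi * dotR l.2 x - pi.
  move=> w1; have w0 : tnth l.2 i != 0 by rewrite -normr_gt0; lra.
  by rewrite dotR_unit_shift; field.
have mphase : measurable_fun setT (fun x => 2 * pi * dotR l.2 x).
  by apply: measurable_funM; [exact: measurable_cst|exact: measurable_dotR].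
apply: le_trans (sqrt_csq_le _) _; rewrite /=.
move: osc; set Q := (X in X ^+ m * weight l) => osc.
have -> : 2 * Q ^+ m * weight l = Q ^+ m * weight l + Q ^+ m * weight l by ring.
apply: lerD; apply: osc.
- exact: (measurableT_comp (@measurable_cosT R)).
- by move=> x; rewrite ler_norml cos_geN1 cos_le1.
- by move=> i w1 x; rewrite shift // cosB cospi sinpi; ring.
- by apply: measurable_funN; exact: (measurableT_comp (@measurable_sinT R)).
- by move=> x; rewrite normrN ler_norml sin_geN1 sin_le1.
- by move=> i w1 x; rewrite shift // sinB cospi sinpi; ring.
Qed.

End BumpGram.

(** * Uniform tails and local finiteness *)

Section FiniteSubsums.
Variables (R : realType) (I : countType).
Implicit Types (D : set I) (f : I -> R).

Lemma sum_le_esum D f (s : seq I) : (forall i, 0 <= f i) -> uniq s ->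
  (forall i, i \in s -> D i) ->
  ((\sum_(i <- s) f i)%:E <= \esum_(i in D) (f i)%:E)%E.
Proof.
move=> f0 us sD; apply: esum_ge; exists [set` s].
  by split; [exact: finite_seq|move=> i /=; exact: sD].
by rewrite -fsbig_seq // sumEFin.
Qed.

Lemma esum_le_sum D f (c : R) :
  (forall s : seq I, uniq s -> (forall i, i \in s -> D i) -> \sum_(i <- s) f i <= c) ->
  (\esum_(i in D) (f i)%:E <= c%:E)%E.
Proof.
move=> H; apply: ub_ereal_sup => _ [A [finA AD] <-].
rewrite fsbig_finite //= sumEFin lee_fin; apply: H; first exact: fset_uniq.
by move=> i; rewrite in_fset_set // => /set_mem; exact: AD.
Qed.

Lemma rsum_seq (q : I -> R) (s : seq I) : uniq s -> (forall i, i \notin s -> q i = 0) ->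
  rsum q = \sum_(i <- s) q i.
Proof.
move=> us q0.
have E (p : I -> R) : (forall i, 0 <= p i) -> (forall i, i \notin s -> p i = 0) ->
    (\esum_(i in [set: I]) (p i)%:E = (\sum_(i <- s) p i)%:E)%E.
  move=> p0 ps; apply/eqP; rewrite eq_le sum_le_esum // andbT.
  apply: esum_le_sum => s' us' _.
  rewrite (bigID (mem s)) /= [X in _ + X]big1 ?addr0; last by move=> i /ps.
  rewrite -big_filter [leRHS](bigID (mem s')) /=.
  rewrite -[X in _ <= X + _]big_filter (perm_big [seq i <- s | i \in s']).
    by rewrite lerDl sumr_ge0.
  apply: uniq_perm; rewrite ?filter_uniq // => i.
  by rewrite !mem_filter andbC.
rewrite /rsum !E //=.
- by rewrite -sumrB; apply: eq_bigr => i _; exact: funrpos_negB.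
- by move=> i /q0 h; rewrite /funrneg h oppr0 maxxx.
- by move=> i /q0 h; rewrite /funrpos h maxxx.
Qed.

End FiniteSubsums.

Section GaborTails.
Variables (R : realType) (m : nat) (mu : {measure set (m.-tuple R) -> \bar R}).
Local Notation X := (m.-tuple R).
Hypothesis mu_leb : is_lebesgue_Rm mu.
Variables (I : countType) (lam : I -> X * X) (g : X -> R[i]) (B : R).
Hypothesis B_gt0 : 0 < B.
Hypothesis L2g : L2 mu g.
Hypothesis bessel : forall h (s : seq I), L2 mu h -> uniq s ->
  \sum_(j <- s) csq (L2dot mu h (gabor_atom g 0 (lam j))) <= B * L2normsq mu h.
Hypothesis g_neq0 : 0 < L2normsq mu g.

Lemma bessel_shift h (s : seq I) z : L2 mu h -> uniq s ->
  \sum_(j <- s) csq (L2dot mu h (gabor_atom g 0 (subP (lam j) z))) <= B * L2normsq mu h.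
Proof.
move=> Lh us; rewrite -(L2normsq_gabor mu_leb 0 z Lh).
apply: le_trans (bessel (L2_gabor mu_leb 0 z Lh) us).
by apply: ler_sum => j _; rewrite csq_L2dot_gabor.
Qed.

(** The functions orthogonal to [g] form a closed subspace; if it contained all bumps it would
    contain [g] itself. *)
Lemma ex_bump : exists a b (n : nat),
  L2dot mu (fun x => (bump n.+1%:R a b x)%:C) g != 0.
Proof.
apply: contrapT => no.
suff /(_ g L2g)[_ z] : forall f, L2 mu f -> L2 mu f /\ L2dot mu f g = 0.
  by move: g_neq0; rewrite L2normsqE // z ltxx.
apply: (L2_sub_closed mu_leb (T := [set f | L2 mu f /\ L2dot mu f g = 0])).
- by move=> f [].
- move=> n a b; split; first by apply: L2_bump => //; rewrite ler1n.
  by apply/eqP/negP => /negP h; apply: no; exists a, b, n.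
- move=> f h [Lf f0] [Lh h0]; split; first exact: L2D.
  by rewrite L2dotDl // f0 h0 addr0.
- by move=> c f [Lf f0]; split; [exact: L2Z|rewrite L2dotZl // f0 mulr0].
- move=> f Lf lim; split => //.
  have [->//|fg] := eqVneq (L2dot mu f g) 0.
  have q0 : 0 < csq (L2dot mu f g).
    rewrite lt_neqAle csq_ge0 andbT; apply: contra_neq fg => /esym/eqP.
    rewrite paddr_eq0 ?sqr_ge0 // !sqrf_eq0 => /andP[/eqP e1 /eqP e2].
    by rewrite (complexE (L2dot mu f g)) e1 e2.
  have [h [[Lh h0] small]] := lim (csq (L2dot mu f g) / L2normsq mu g) (divr_gt0 q0 g_neq0).
  have := L2_Cauchy_Schwarz (L2B Lf Lh) L2g.
  rewrite L2dotBl // h0 subr0; move: small.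
  by rewrite ltr_pdivlMr // => h1 /le_lt_trans /(_ h1); rewrite ltxx.
Qed.

Lemma plateau_continuous (k a b : R) (u : R) (v : nat -> R) : 1 <= k ->
  v @ \oo --> (0 : R) -> plateau k a b (u - v n) @[n --> \oo] --> plateau k a b u.
Proof.
move=> k1 v0; have sp := smooth_bound_plateau a b k1.
have C0 := smooth_bound_ge0 sp; case: sp => _ _ lip _.
set C := (X in 0 <= X) in C0; rewrite -/C in lip.
apply/cvgrPdist_le => e e0.
have d0 : 0 < e / (C + 1) by rewrite divr_gt0 // ltr_wpDl.
move/cvgr0_norm_le : v0 => /(_ _ d0); apply: filterS => n vn.
have := lip u (- v n); rewrite normrN distrC => /le_trans; apply.
apply: (@le_trans _ _ (C * (e / (C + 1)))); first by rewrite ler_wpM2l.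
by rewrite mulrA ler_pdivrMr ?ltr_wpDl //; nra.
Qed.

Lemma bump_continuous (k : R) (a b x : X) (t : nat -> X) : 1 <= k ->
  (forall i, tnth (t n) i @[n --> \oo] --> (0 : R)) ->
  bump k a b (subT x (t n)) @[n --> \oo] --> bump k a b x.
Proof.
move=> k1 t0; rewrite /bump.
elim: (index_enum 'I_m) => [|i s IH].
  by under eq_fun do rewrite big_nil; rewrite big_nil; exact: cvg_cst.
under eq_fun do rewrite big_cons; rewrite big_cons.
apply: cvgM => //; under eq_fun do rewrite tnth_subT.
exact: plateau_continuous.
Qed.

(** Strong continuity of time-frequency shifts at the origin. A failure would produce a sequence of
    shifts tending to the origin, which dominated convergence excludes. *)
Lemma gabor_bump_continuous (k : R) (a b : X) (eps : R) : 1 <= k -> 0 < eps ->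
  exists2 r, 0 < r <= 1 & forall p, dinf p (origin R m) <= r ->
    L2normsq mu (fun x => (bump k a b x)%:C - gabor_atom (fun x => (bump k a b x)%:C) 0 p x) < eps.
Proof.
move=> k1 eps0; apply: contrapT => no.
pose psi x : R[i] := (bump k a b x)%:C.
have Lpsi : L2 mu psi := L2_bump mu_leb a b k1.
have /choice[p Hp] : forall n : nat, exists p, dinf p (origin R m) <= n.+1%:R^-1 /\
    eps <= L2normsq mu (fun x => psi x - gabor_atom psi 0 p x).
  move=> n; apply: contrapT => no'; apply: no; exists n.+1%:R^-1.
    by rewrite invr_gt0 ltr0n /= invf_le1 ?ler1n.
  move=> p hp; rewrite ltNge; apply/negP => h; apply: no'; by exists p.
have inv0 : (n.+1%:R^-1 : R) @[n --> \oo] --> (0 : R) by exact: cvg_harmonic.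
have to0 (u : nat -> R) (c : R) : 0 <= c -> (forall n, `|u n| <= c * n.+1%:R^-1) -> u @ \oo --> (0 : R).
  move=> c0 hu; apply/norm_cvg0P; apply: (@squeeze_cvgr _ _ _ _ (cst 0) (fun n => c * n.+1%:R^-1)).
  - by apply: nearW => n; rewrite normr_ge0 hu.
  - exact: cvg_cst.
  - by rewrite -[X in _ --> X](mulr0 c); apply: cvgM => //; exact: cvg_cst.
have coord n i : `|tnth (p n).1 i| <= n.+1%:R^-1 /\ `|tnth (p n).2 i| <= n.+1%:R^-1.
  have [h1 h2] := dinf_coord (p n) (origin R m) i; have [h3 _] := Hp n.
  move: h1 h2; rewrite /origin /= tnth_mktuple !subr0 => h1 h2.
  by split; [apply: le_trans h1 _|apply: le_trans h2 _].
(* The box grows by 1 for the support of the bump and by 1 more for the translation; 4 is [2 + 2]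
   from [csqB_le]. *)
pose F : X -> R := fun x => 4 * \1_(cbox (subT (subT a (cst_tuple m 1)) (cst_tuple m 1)) (subT (subT b (cst_tuple m (-1))) (cst_tuple m (-1)))) x.
have [||||||n hn] := @L2_dominated_limit _ _ mu psi (fun n => gabor_atom psi 0 (p n)) F eps.
- exact: (L2_cmeas Lpsi).
- by move=> n; apply: cmeas_gabor; exact: (L2_cmeas Lpsi).
- by apply: integrable_Rmull; exact: integrable_indic_box.
- move=> n x.
  apply: le_trans (csqB_le _ _) _; rewrite csq_gabor /psi !csq_real.
  have b01 y : bump k a b y ^+ 2 <= 1.
    by have := bump_ge0 k a b y; have := bump_le1 k a b y; nra.
  rewrite /F indicE; case: (boolP (x \in _)) => xin.
    by rewrite mulr1; have := b01 x; have := b01 (subT x (p n).1); lra.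
  move/negP: xin; rewrite inE => xout.
  have n1 : n.+1%:R^-1 <= 1 :> R by rewrite invf_le1 ?ler1n.
  rewrite !bump_support // ?expr0n /= ?mulr0 ?addr0 //.
    move=> h; apply: xout => i; have := h i; have [+ _] := coord n i.
    rewrite !tnth_subT !tnth_mktuple => /le_trans /(_ n1).
    by rewrite ler_norml => /andP[? ?] /andP[? ?]; apply/andP; split; lra.
  move=> h; apply: xout => i; have := h i.
  by rewrite !tnth_subT !tnth_mktuple => /andP[? ?]; apply/andP; split; lra.
- move=> x; pose th n := 2 * pi * dotR (p n).2 x.
  have th0 : th @ \oo --> (0 : R).
    apply: (to0 _ (2 * pi * \sum_(i < m) `|tnth x i|)).
      by rewrite mulr_ge0 ?sumr_ge0 // mulr_ge0 // pi_ge0.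
    move=> n; rewrite /th normrM ger0_norm ?mulr_ge0 ?pi_ge0 // -mulrA.
    apply: ler_wpM2l; first by rewrite mulr_ge0 // pi_ge0.
    rewrite /dotR mulr_suml; apply: le_trans (ler_norm_sum _ _ _) _.
    apply: ler_sum => i _; rewrite normrM mulrC ler_wpM2l //.
    by case: (coord n i).
  have cth : cos (th n) @[n --> \oo] --> (1 : R).
    by rewrite -[X in _ --> X](@cos0 R); apply: cvg_comp th0 _; exact: continuous_cos.
  have sth : sin (th n) @[n --> \oo] --> (0 : R).
    by rewrite -[X in _ --> X](@sin0 R); apply: cvg_comp th0 _; exact: continuous_sin.
  pose b_ n := bump k a b (subT x (p n).1); pose b0 := bump k a b x.
  have bb : b_ n @[n --> \oo] --> b0.
    apply: bump_continuous => // i; apply: (to0 _ 1) => // n.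
    by rewrite mul1r; case: (coord n i).
  have E n : csq (psi x - gabor_atom psi 0 (p n) x) =
      (b0 - cos (th n) * b_ n) * (b0 - cos (th n) * b_ n) +
      (sin (th n) * b_ n) * (sin (th n) * b_ n).
    by rewrite /gabor_atom expi0 mul1r /csq /expi /psi -/(b_ n) -/b0 -/(th n) /=; ring.
  under eq_fun do rewrite E.
  have -> : (0 : R) = (b0 - 1 * b0) * (b0 - 1 * b0) + (0 * b0) * (0 * b0) by ring.
  have L1 : b0 - cos (th n) * b_ n @[n --> \oo] --> b0 - 1 * b0.
    by apply: cvgB; [exact: cvg_cst|exact: cvgM].
  have L2' : sin (th n) * b_ n @[n --> \oo] --> 0 * b0 by exact: cvgM.
  by apply: cvgD; exact: cvgM.
- exact: eps0.
- have [_] := Hp n; by rewrite leNgt hn.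
Qed.

(** After moving [z] to the origin, every point within [r] of it contributes at least [c / 4] to the
    Bessel sum of a bump not orthogonal to [g], and this sum is bounded independently of [z]. *)
Lemma local_count : exists2 r, 0 < r & exists K : nat, forall z (s : seq I), uniq s ->
  (forall j, j \in s -> dinf (lam j) z <= r) -> (size s <= K)%N.
Proof.
have [a [b [n bg]]] := ex_bump.
pose psi x : R[i] := (bump n.+1%:R a b x)%:C.
have n1 : 1 <= n.+1%:R :> R by rewrite ler1n.
have Lpsi : L2 mu psi := L2_bump mu_leb a b n1.
pose c := csq (L2dot mu psi g).
have c0 : 0 < c.
  rewrite lt_neqAle csq_ge0 andbT; apply: contra_neq bg => /esym/eqP.
  rewrite paddr_eq0 ?sqr_ge0 // !sqrf_eq0 => /andP[/eqP e1 /eqP e2].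
  by rewrite (complexE (L2dot mu _ g)) e1 e2.
(* By Cauchy-Schwarz with [g], this keeps the change of the coefficient at [c / 4] in square; then
   [c <= 2 * (c / 4) + 2 * x] leaves [x >= c / 4]. *)
have eps0 : 0 < c / (4 * L2normsq mu g) by rewrite divr_gt0 // mulr_gt0.
have [r /andP[r0 r1] hr] := gabor_bump_continuous a b n1 eps0.
exists r => //.
exists (Num.truncn (B * L2normsq mu psi / (c / 4))).+1 => z s us sz.
have low p : dinf p (origin R m) <= r -> c / 4 <= csq (L2dot mu psi (gabor_atom g 0 p)).
  move=> pr; rewrite csq_L2dot_reflect //; set q := subP _ p.
  have qr : dinf q (origin R m) <= r.
    by rewrite /q dinf_subP_origin dinfC.
  have Lq : L2 mu (gabor_atom psi 0 q) by exact: L2_gabor.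
  have := L2_Cauchy_Schwarz L2g (L2B Lpsi Lq).
  rewrite L2dotBr // => CS.
  have := hr q qr; rewrite ltr_pdivlMr ?mulr_gt0 // => h.
  have h1 : csq (L2dot mu g psi - L2dot mu g (gabor_atom psi 0 q)) <= c / 4.
    by apply: le_trans CS _; rewrite -/psi in h; lra.
  have := csqD_le (L2dot mu g psi - L2dot mu g (gabor_atom psi 0 q)) (L2dot mu g (gabor_atom psi 0 q)).
  rewrite subrK (csq_L2dotC L2g Lpsi) -/c; lra.
have H := bessel_shift z Lpsi us.
have : (size s)%:R * (c / 4) <= B * L2normsq mu psi.
  apply: le_trans H; rewrite -sum1_size natr_sum mulr_suml !big_seq.
  apply: ler_sum => j js; rewrite mul1r; apply: low.
  by rewrite dinf_subP_origin; exact: sz.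
rewrite -ler_pdivlMr ?divr_gt0 // => /le_lt_trans /(_ (truncnS_gt _)).
by rewrite ltr_nat => /ltnW.
Qed.

Definition uniform_tail (psi : X -> R[i]) : Prop := L2 mu psi /\
  forall eps, 0 < eps -> exists N : R, forall l (s : seq I), uniq s ->
    (forall j, j \in s -> N < dinf (lam j) (lam l)) ->
    \sum_(j <- s) csq (L2dot mu psi (gabor_atom g 0 (subP (lam j) (lam l)))) <= eps.

(* Otherwise one could pile up arbitrarily many far-apart finite pieces, each
   carrying mass eps, into a single sparse set of points: this contradicts the
   Bessel bound for the atoms of the bump. *)
Lemma uniform_tail_bump (n : nat) a b :
  uniform_tail (fun x => (bump n.+1%:R a b x)%:C).
Proof.
have n1 : 1 <= n.+1%:R :> R by rewrite ler1n.
pose psi x : R[i] := (bump n.+1%:R a b x)%:C.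
have Lpsi : L2 mu psi := L2_bump mu_leb a b n1.
split => // eps eps0; apply: contrapT => no.
have [r r0 [K hK]] := local_count.
have [D hD] := bump_gram_decay mu_leb a b n1.
have piece N : exists M : seq (X * X), [/\ sparse r K M,
    (forall p, p \in M -> N < dinf p (origin R m)) &
    eps <= \sum_(p <- M) csq (L2dot mu psi (gabor_atom g 0 p))].
  apply: contrapT => no'; apply: no; exists N => l s us far.
  rewrite leNgt; apply/negP => big; apply: no'.
  exists [seq subP (lam j) (lam l) | j <- s]; split.
  - move=> z; rewrite count_map -size_filter.
    apply: (hK (subP z (subP (origin R m) (lam l)))); first exact: filter_uniq.
    move=> j; rewrite mem_filter /= => /andP[+ _].
    rewrite -(dinf_subP (lam j) _ (lam l)); congr (dinf _ _ <= _).
    rewrite [LHS]surjective_pairing /subP /=.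
    by congr (_, _); apply: eq_from_tnth => i; rewrite !tnth_mktuple; ring.
  - by move=> _ /mapP[j js ->]; rewrite dinf_subP_origin; exact: far.
  - by rewrite big_map ltW.
have pile (L : nat) : exists M : seq (X * X), sparse r K M /\
    L%:R * eps <= \sum_(p <- M) csq (L2dot mu psi (gabor_atom g 0 p)).
  elim: L => [|L [M [sM hM]]].
    by exists [::]; split => //; rewrite mul0r big_nil.
  (* The new piece lies more than [2 * r] away from every point of [M], so no ball of radius [r]
     meets both, and [K] need not grow. *)
  pose N := \sum_(p <- M) dinf p (origin R m) + 2 * r.
  have [M' [sM' far hM']] := piece N.
  exists (M ++ M'); split; last first.
    by rewrite big_cat /= -natr1 mulrDl mul1r lerD.
  move=> z; rewrite count_cat.
  have [/hasP[p pM pz]|] := boolP (has (fun p : X * X => dinf p z <= r) M); last first.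
    by rewrite has_count -leqNgt leqn0 => /eqP ->; exact: sM'.
  have -> : count (fun p : X * X => dinf p z <= r) M' = 0%N; last first.
    by rewrite addn0; exact: sM.
  apply/eqP; rewrite -leqn0 leqNgt -has_count; apply/negP => /hasP[q qM' qz].
  have := far q qM'; apply/negP; rewrite -leNgt.
  have h1 := dinf_triangle q z (origin R m); have h2 := dinf_triangle z p (origin R m).
  have h3 : dinf p (origin R m) <= \sum_(p <- M) dinf p (origin R m).
    by rewrite (big_rem p pM) /= lerDl sumr_ge0 // => *; exact: dinf_ge0.
  rewrite dinfC in pz; rewrite /N; lra.
pose C := D * (K%:R * (cell_const r ^+ m) ^+ 2) * L2normsq mu g.
have ub (L : nat) : L%:R * eps <= C.
  have [M [sM hM]] := pile L; apply: le_trans hM _.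
  (* Reflection turns the coefficients of [psi] against shifts of [g] into those of [g] against
     opposite shifts of [psi], hence the reflected set. *)
  have sM' : sparse r K [seq subP (origin R m) p | p <- M].
    move=> z; rewrite count_map; apply: leq_trans (sM (subP (origin R m) z)).
    apply: sub_count => p /=; rewrite -(dinf_reflect (subP _ p)); congr (dinf _ _ <= _).
    by rewrite [RHS]surjective_pairing; congr (_, _); apply: eq_from_tnth => i; rewrite !tnth_mktuple; ring.
  apply: le_trans (bessel_of_decay mu_leb r0 Lpsi L2g sM' hD).
  by rewrite big_map; apply: ler_sum => p _; rewrite csq_L2dot_reflect.
have := ub (Num.truncn (C / eps)).+1.
by rewrite -ler_pdivlMr // leNgt truncnS_gt.
Qed.

Lemma uniform_tailD f h : uniform_tail f -> uniform_tail h ->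
  uniform_tail (fun x => f x + h x).
Proof.
move=> [Lf tf] [Lh th]; split; first exact: L2D.
move=> eps eps0; have e4 : 0 < eps / 4 by rewrite divr_gt0.
have [N hN] := tf _ e4; have [N' hN'] := th _ e4.
exists (Num.max N N') => l s us far.
apply: (@le_trans _ _ (\sum_(j <- s)
   (2 * csq (L2dot mu f (gabor_atom g 0 (subP (lam j) (lam l)))) +
    2 * csq (L2dot mu h (gabor_atom g 0 (subP (lam j) (lam l))))))).
  apply: ler_sum => j _; rewrite L2dotDl //; first exact: csqD_le.
  exact: L2_gabor.
rewrite big_split -!mulr_sumr /=.
have h1 : forall j, j \in s -> N < dinf (lam j) (lam l).
  by move=> j /far; rewrite gt_max => /andP[].
have h2 : forall j, j \in s -> N' < dinf (lam j) (lam l).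
  by move=> j /far; rewrite gt_max => /andP[].
have := hN l s us h1; have := hN' l s us h2; lra.
Qed.

Lemma uniform_tailZ z f : uniform_tail f -> uniform_tail (fun x => z * f x).
Proof.
move=> [Lf tf]; split; first exact: L2Z.
move=> eps eps0.
have z0 : 0 < csq z + 1 by rewrite ltr_wpDl // csq_ge0.
have [N hN] := tf _ (divr_gt0 eps0 z0); exists N => l s us far.
rewrite (eq_bigr (fun j => csq z * csq (L2dot mu f (gabor_atom g 0 (subP (lam j) (lam l)))))); last first.
  by move=> j _; rewrite L2dotZl ?csqM //; exact: L2_gabor.
rewrite -mulr_sumr; have := hN l s us far; set S := (X in X <= _ -> _).
have S0 : 0 <= S by apply: sumr_ge0 => j _; exact: csq_ge0.
rewrite -/S ler_pdivlMr // => h; have := csq_ge0 z; nra.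
Qed.

(** All the centred systems share the Bessel bound [B], so the approximation error is uniform in
    [l]. *)
Lemma uniform_tail_lim f : L2 mu f ->
  (forall eps, 0 < eps -> exists h, uniform_tail h /\
     L2normsq mu (fun x => f x - h x) < eps) -> uniform_tail f.
Proof.
move=> Lf lim; split => // eps eps0.
have e4 : 0 < eps / 4 by rewrite divr_gt0.
have [h [[Lh th] small]] := lim _ (divr_gt0 e4 B_gt0).
have [N hN] := th _ e4; exists N => l s us far.
apply: (@le_trans _ _ (\sum_(j <- s)
   (2 * csq (L2dot mu (fun x => f x - h x) (gabor_atom g 0 (subP (lam j) (lam l)))) +
    2 * csq (L2dot mu h (gabor_atom g 0 (subP (lam j) (lam l))))))).
  apply: ler_sum => j _; have La : L2 mu (gabor_atom g 0 (subP (lam j) (lam l))) by exact: L2_gabor.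
  by rewrite L2dotBl //; apply: le_trans (csqD_le _ _); rewrite subrK.
rewrite big_split -!mulr_sumr /=.
have := hN l s us far; have := bessel_shift (lam l) (L2B Lf Lh) us.
by move: small; rewrite ltr_pdivlMr //; lra.
Qed.

Lemma uniform_tail_L2 f : L2 mu f -> uniform_tail f.
Proof.
apply: (L2_sub_closed mu_leb (T := uniform_tail)).
- by move=> ? [].
- by move=> n a b; exact: uniform_tail_bump.
- exact: uniform_tailD.
- exact: uniform_tailZ.
- exact: uniform_tail_lim.
Qed.

(** From radius [r] to radius [N] without a covering argument: each point of the ball has weight at
    least [w], while the total weight around the centre is bounded. *)
Lemma ball_count (N : R) : exists K : nat, forall l (s : seq I), uniq s ->
  (forall j, j \in s -> dinf (lam j) (lam l) <= N) -> (size s <= K)%N.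
Proof.
have [r r0 [K hK]] := local_count.
pose w := ((decay N) ^+ m) ^+ 2; pose C := K%:R * (cell_const r ^+ m) ^+ 2.
have w0 : 0 < w by rewrite !exprn_gt0 // decay_gt0.
exists (Num.truncn (C / w)).+1 => l s us sN.
have sp : sparse r K [seq lam j | j <- s].
  move=> z; rewrite count_map -size_filter; apply: (hK z); first exact: filter_uniq.
  by move=> j; rewrite mem_filter => /andP[].
have := sum_weight_le r0 (lam l) sp; rewrite big_map -/C => ub.
have : (size s)%:R * w <= C.
  apply: le_trans ub; rewrite -sum1_size natr_sum mulr_suml !big_seq.
  apply: ler_sum => j js; rewrite mul1r /w expr2.
  have d0 : 0 <= decay N by rewrite ltW // decay_gt0.
  have pc (c : R) : c ^+ m = \prod_(i < m) c by rewrite prodr_const card_ord.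
  have dle (u : R) : `|u| <= N -> 0 <= decay N <= decay u.
    move=> uN; rewrite d0 /= /decay lef_pV2 ?posrE ?ltr_pwDl ?sqr_ge0 // lerD2l.
    by rewrite -(real_normK (num_real u)) lerXn2r ?nnegrE // (le_trans _ uN).
  have H := (dinf_le (lam j) (lam l) (le_trans (dinf_ge0 _ _) (sN j js))).1 (sN j js).
  rewrite !pc; apply: ler_pM; try by apply: prodr_ge0.
    by apply: ler_prod => i _; rewrite dle // tnth_subT; case: (H i).
  by apply: ler_prod => i _; rewrite dle // tnth_subT; case: (H i).
rewrite -ler_pdivlMr // => /le_lt_trans /(_ (truncnS_gt _)).
by rewrite ltr_nat => /ltnW.
Qed.

End GaborTails.

(** * Localization of the dual frame *)

Section FrameLocalization.
Variables (R : realType) (m : nat) (mu : {measure set (m.-tuple R) -> \bar R}).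
Local Notation X := (m.-tuple R).
Variables (I : countType) (e : I -> X -> R[i]) (d : I -> I -> R) (A B G : R).
Implicit Types (phi f : X -> R[i]) (s : seq I).

Definition analysis phi : I -> R[i] := fun i => L2dot mu phi (e i).

Hypothesis L2e : forall j, L2 mu (e j).
Hypothesis A_gt0 : 0 < A.
Hypothesis AB : A <= B.
Hypothesis ell2_analysis : forall phi, L2 mu phi -> ell2 (analysis phi).
Hypothesis frame_lower : forall phi, L2 mu phi ->
  A * L2normsq mu phi <= sqsum (analysis phi).
Hypothesis frame_upper : forall phi, L2 mu phi ->
  sqsum (analysis phi) <= B * L2normsq mu phi.
Hypothesis d_triangle : forall i j k, d i k <= d i j + d j k.
Hypothesis e_bounded : forall j, L2normsq mu (e j) <= G.
Hypothesis balls : forall N : R, exists K : nat, forall l s, uniq s ->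
  (forall j, j \in s -> d j l <= N) -> (size s <= K)%N.

Lemma upper_bound_gt0 : 0 < B.
Proof. exact: lt_le_trans AB. Qed.
Lemma contraction_ge0 : 0 <= 1 - A / B.
Proof. by rewrite subr_ge0 ler_pdivrMr ?mul1r ?upper_bound_gt0. Qed.

Definition localized (f : I -> X -> R[i]) : Prop :=
  [/\ forall l, L2 mu (f l), exists C, forall l, L2normsq mu (f l) <= C &
   forall eps, 0 < eps -> exists N : R, forall l s, uniq s ->
    (forall j, j \in s -> N < d j l) ->
    \sum_(j <- s) csq (analysis (f l) j) <= eps].

Hypothesis localized_e : localized e.

Lemma bessel_seq phi s : L2 mu phi -> uniq s ->
  \sum_(j <- s) csq (analysis phi j) <= B * L2normsq mu phi.
Proof.
move=> Lphi us; apply: le_trans (frame_upper Lphi).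
rewrite -lee_fin sqsumK; last exact: ell2_analysis.
by apply: sum_le_esum => // i; exact: csq_ge0.
Qed.

Lemma localizedDZ (f f' : I -> X -> R[i]) (c : R[i]) : localized f -> localized f' ->
  localized (fun l x => f l x + c * f' l x).
Proof.
move=> [Lf [C hC] tf] [Lf' [C' hC'] tf']; split.
- by move=> l; apply: L2D => //; exact: L2Z.
- exists (2 * C + 2 * (csq c * C')) => l.
  apply: le_trans (L2normsqD_le (Lf l) (L2Z c (Lf' l))) _.
  by rewrite L2normsqZ // lerD // ler_wpM2l // ler_wpM2l // csq_ge0.
- move=> eps eps0; have e4 : 0 < eps / 4 by rewrite divr_gt0.
  have c1 : 0 < csq c + 1 by rewrite ltr_wpDl // csq_ge0.
  have [N hN] := tf _ e4; have [N' hN'] := tf' _ (divr_gt0 e4 c1).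
  exists (Num.max N N') => l s us far.
  apply: (@le_trans _ _ (\sum_(j <- s)
     (2 * csq (analysis (f l) j) + 2 * (csq c * csq (analysis (f' l) j))))).
    apply: ler_sum => j _; rewrite /analysis L2dotDl ?L2dotZl //; last exact: L2Z.
    by rewrite -csqM csqD_le.
  rewrite big_split -!mulr_sumr /=.
  have maxE j : j \in s -> N < d j l /\ N' < d j l.
    by move=> /far; rewrite gt_max => /andP[].
  have h1 := hN l s us (fun j js => proj1 (maxE j js)).
  have h2 := hN' l s us (fun j js => proj2 (maxE j js)).
  have S0 : 0 <= \sum_(j <- s) csq (analysis (f' l) j) by apply: sumr_ge0 => *; exact: csq_ge0.
  move: h2; rewrite ler_pdivlMr // => h2; have := csq_ge0 c; nra.
Qed.

Lemma localized0 : localized (fun _ _ => 0).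
Proof.
have := localizedDZ (-1) localized_e localized_e; congr localized.
by apply/funext => l; apply/funext => x; rewrite mulN1r subrr.
Qed.

(** A duplicate-free list inside the ball of maximal length, which exists since lengths are bounded,
    must exhaust the ball. *)
Lemma ball_enum (N : R) : exists K : nat, exists b : I -> seq I, forall l,
  [/\ uniq (b l), (size (b l) <= K)%N & forall j, (j \in b l) = (d j l <= N)].
Proof.
have [K hK] := balls N; exists K.
suff /choice[b hb] : forall l, exists s, [/\ uniq s, (size s <= K)%N & forall j, (j \in s) = (d j l <= N)].
  by exists b.
move=> l.
pose Pn n := `[< exists s, [/\ uniq s, forall j, j \in s -> d j l <= N & size s = n] >].
have P0 : exists n, Pn n by exists 0%N; apply/asboolP; exists [::].
have PK n : Pn n -> (n <= K)%N by move=> /asboolP[s [us sN <-]]; exact: hK sN.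
case: (ex_maxnP P0 PK) => n /asboolP[s [us sN sn]] nmax.
exists s; split => //; first exact: (hK l).
move=> j; apply/idP/idP; first exact: sN.
move=> jN; apply/negPn/negP => js.
have : Pn n.+1.
  apply/asboolP; exists (j :: s); split; rewrite /= ?js ?sn //.
  by move=> k; rewrite inE => /orP[/eqP ->|/sN].
by move=> /nmax; rewrite ltnn.
Qed.

(** Any constant depending on [size s] alone will do, since balls have bounded size. *)
Lemma L2normsq_sum_le (T : Type) (s : seq T) (a : T -> R[i]) (F : T -> X -> R[i]) :
  (forall t, L2 mu (F t)) ->
  L2normsq mu (fun x => \sum_(t <- s) a t * F t x) <=
  2 ^+ size s * \sum_(t <- s) csq (a t) * L2normsq mu (F t).
Proof.
move=> LF; elim: s => [|t s IH].
  rewrite big_nil mulr0; under eq_fun do rewrite big_nil.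
  by have := L2normsqZ 0 (L2_0 mu); rewrite csq0 !mul0r => ->.
under eq_fun do rewrite big_cons; rewrite big_cons /=.
apply: le_trans (L2normsqD_le (L2Z (a t) (LF t)) (L2_sum s a LF)) _.
rewrite L2normsqZ // exprS; move: IH; set S := \sum_(_ <- _) _ => IH.
have : 1 <= 2 ^+ size s :> R by rewrite exprn_ege1 // ler1n.
have : 0 <= csq (a t) * L2normsq mu (F t) by rewrite mulr_ge0 ?csq_ge0 ?L2normsq_ge0.
move: (csq (a t) * _) (2 ^+ size s) IH => u v IH; nra.
Qed.

(** An index farther than [N + N'] from [l] is farther than [N'] from each [j] in the ball, so the
    tail of every [e j] is small there. Combining at most [K] of them costs a factor [K], and the
    squared coefficients sum to at most [B * C]. *)
Lemma localized_synthesis (f : I -> X -> R[i]) (N : R) (b : I -> seq I) (K : nat) :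
  localized f ->
  (forall l, [/\ uniq (b l), (size (b l) <= K)%N & forall j, (j \in b l) = (d j l <= N)]) ->
  localized (fun l x => \sum_(j <- b l) analysis (f l) j * e j x).
Proof.
have B_gt0 := upper_bound_gt0.
move=> [Lf [C hC] tf] hb.
have C0 (l : I) : 0 <= C := le_trans (L2normsq_ge0 _ _) (hC l).
have G0 (l : I) : 0 <= G := le_trans (L2normsq_ge0 _ _) (e_bounded l).
have sumC l : \sum_(j <- b l) csq (analysis (f l) j) <= B * C.
  have [us _ _] := hb l; apply: le_trans (bessel_seq (Lf l) us) _.
  by rewrite ler_wpM2l // ltW.
split.
- by move=> l; exact: L2_sum.
- exists (2 ^+ K * (B * C * G)) => l.
  apply: le_trans (L2normsq_sum_le _ _ L2e) _.
  have [_ sz _] := hb l.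
  apply: ler_pM.
  + by rewrite exprn_ge0.
  + by apply: sumr_ge0 => j _; rewrite mulr_ge0 ?csq_ge0 ?L2normsq_ge0.
  + by rewrite ler_weXn2l // ler1n.
  + apply: (@le_trans _ _ (\sum_(j <- b l) csq (analysis (f l) j) * G)).
      by apply: ler_sum => j _; rewrite ler_wpM2l ?csq_ge0.
    by rewrite -mulr_suml ler_wpM2r // (G0 l).
- move=> eps eps0; have [Le _ te] := localized_e.
  have [l0|noI] := pselect (inhabited I); last first.
    by exists 0 => l; exfalso; apply: noI.
  have C0' : 0 <= C by case: l0 => l; exact: (C0 l).
  pose D := K%:R * (B * C) + 1.
  have D0 : 0 < D by rewrite ltr_wpDl // mulr_ge0 // mulr_ge0 // ltW.
  have [N' hN'] := te _ (divr_gt0 eps0 D0).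
  exists (N + N') => l s us far; have [ub sz inb] := hb l.
  apply: (@le_trans _ _ (\sum_(k <- s) (K%:R * \sum_(j <- b l)
      csq (analysis (f l) j) * csq (analysis (e j) k)))).
    apply: ler_sum => k _; rewrite {1}/analysis L2dot_suml //.
    apply: le_trans (csq_sum_le _ _) _.
    under eq_bigr do rewrite csqM.
    apply: ler_pM => //; last by rewrite ler_nat.
    by apply: sumr_ge0 => j _; rewrite mulr_ge0 ?csq_ge0.
  rewrite -mulr_sumr exchange_big /=.
  apply: (@le_trans _ _ (K%:R * \sum_(j <- b l) csq (analysis (f l) j) * (eps / D))).
    rewrite ler_wpM2l // !big_seq; apply: ler_sum => j jb; rewrite -mulr_sumr.
    rewrite ler_wpM2l ?csq_ge0 //; apply: hN' => // k ks.
    rewrite inb in jb.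
    rewrite -(ltrD2l N); apply: lt_le_trans (far k ks) _.
    by apply: le_trans (d_triangle k j l) _; rewrite addrC lerD2r.
  rewrite -mulr_suml mulrA.
  apply: (@le_trans _ _ (K%:R * (B * C) * (eps / D))).
    by rewrite ler_wpM2r ?ler_wpM2l // divr_ge0 // ltW.
  rewrite mulrCA ger_pMr // ler_pdivrMr // mul1r /D.
  by rewrite lerDl.
Qed.

Lemma analysisD phi f (c : R[i]) : L2 mu phi -> L2 mu f ->
  analysis (fun x => phi x + c * f x) = fun i => analysis phi i + c * analysis f i.
Proof.
move=> Lphi Lf; apply/funext => i.
by rewrite /analysis L2dotDl ?L2dotZl //; exact: L2Z.
Qed.

(** The real form of [I - S / B], written through coefficients. It is positive and bounded by
    [1 - A / B], which makes the iteration contract. *)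
Definition frame_defect phi f : R := cRe (L2dot mu phi f) - B^-1 * Re_ell2dot (analysis phi) (analysis f).

Lemma frame_defect_diag phi : L2 mu phi ->
  0 <= frame_defect phi phi <= (1 - A / B) * L2normsq mu phi.
Proof.
have B_gt0 := upper_bound_gt0.
move=> Lphi; rewrite /frame_defect -L2normsqE // Re_ell2dotcc; last exact: ell2_analysis.
have h1 := frame_lower Lphi; have h2 := frame_upper Lphi.
apply/andP; split; first by rewrite subr_ge0 mulrC ler_pdivrMr // mulrC.
rewrite mulrBl mul1r lerB // mulrAC mulrC ler_wpM2l // ?invr_ge0 ?ltW //.
Qed.

Lemma frame_defect_le phi f : L2 mu phi -> L2 mu f ->
  frame_defect phi f <= (1 - A / B) * (L2norm mu phi * L2norm mu f).
Proof.
have B_gt0 := upper_bound_gt0.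
move=> Lphi Lf.
have rho0 := contraction_ge0.
have /andP[p0 p1] := frame_defect_diag Lphi; have /andP[f0 f1] := frame_defect_diag Lf.
have H : frame_defect phi f ^+ 2 <= frame_defect phi phi * frame_defect f f.
  apply: discriminant_le => s.
  have Ls := L2D Lphi (L2Z s%:C Lf).
  have lphi := ell2_analysis Lphi; have lf := ell2_analysis Lf.
  have ls := ell2D lphi (ell2Z s%:C lf).
  have /andP[+ _] := frame_defect_diag Ls.
  rewrite /frame_defect -(L2normsqE Ls) -(L2normsqE Lphi) -(L2normsqE Lf) (L2normsqDZ s Lphi Lf).
  rewrite (analysisD _ Lphi Lf) (Re_ell2dotcc ls) (sqsumDZ s lphi lf).
  rewrite (Re_ell2dotcc lphi) (Re_ell2dotcc lf) => H.
  by apply: le_trans H _; rewrite le_eqVlt; apply/orP; left; apply/eqP; ring.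
have : frame_defect phi f ^+ 2 <= ((1 - A / B) * (L2norm mu phi * L2norm mu f)) ^+ 2.
  apply: le_trans H _; rewrite !exprMn !L2norm_sqr.
  have -> : (1 - A / B) ^+ 2 * (L2normsq mu phi * L2normsq mu f) =
     ((1 - A / B) * L2normsq mu phi) * ((1 - A / B) * L2normsq mu f) by ring.
  exact: (ler_pM p0 f0 p1 f1).
have rhs0 : 0 <= (1 - A / B) * (L2norm mu phi * L2norm mu f).
  by rewrite mulr_ge0 // mulr_ge0 // L2norm_ge0.
by move=> h; rewrite leNgt; apply/negP => h'; move: h; rewrite leNgt ltrXn2r ?nnegrE // ltW // (le_lt_trans rhs0).
Qed.

Variable h : I -> X -> R[i].
Hypothesis L2h : forall l, L2 mu (h l).
Hypothesis h_proj : forall l phi, L2 mu phi ->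
  Re_ell2dot (fun i => delta R l i - analysis (h l) i) (analysis phi) = 0.

(** The weak form of [S h_l = e_l]. *)
Lemma Re_ell2dot_h l phi : L2 mu phi ->
  Re_ell2dot (analysis (h l)) (analysis phi) = cRe (L2dot mu (e l) phi).
Proof.
move=> Lphi; have := h_proj l Lphi.
rewrite (Re_ell2dotBl (ell2_delta R l) (ell2_analysis (L2h l)) (ell2_analysis Lphi)).
move/eqP; rewrite subr_eq0 => /eqP <-.
by rewrite Re_ell2dot_delta /analysis (L2dotC (L2e l) Lphi) conjE.
Qed.

(** A projected basis vector has norm at most 1: its squared norm [S] equals its inner product with
    the basis vector, so [S ^+ 2 <= S]. The lower frame bound transfers this to [h l]. *)
Lemma h_bounded l : L2normsq mu (h l) <= A^-1.
Proof.
have lh := ell2_analysis (L2h l).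
set S := sqsum (analysis (h l)).
have S0 : 0 <= S := sqsum_ge0 _.
have : S ^+ 2 <= S.
  have := h_proj l (L2h l).
  rewrite (Re_ell2dotBl (ell2_delta R l) lh lh) (Re_ell2dotcc lh).
  rewrite -/S => /eqP; rewrite subr_eq0 => /eqP {1}<-.
  apply: le_trans (Re_ell2dot_sqr_le (ell2_delta R l) lh) _.
  rewrite (_ : sqsum _ = 1) ?mul1r // /sqsum (esum_at (l := l)).
  - by rewrite /delta eqxx csq1.
  - by move=> i; exact: csq_ge0.
  - by move=> i /negPf il; rewrite /delta il csq0.
move=> SS; have S1 : S <= 1 by nra.
rewrite -div1r ler_pdivlMr // mulrC; apply: le_trans S1; exact: frame_lower.
Qed.

(* One step of the Richardson iteration for the dual frame, with the frame
   operator truncated to a ball around the base point. *)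
Lemma richardson_step (f : I -> X -> R[i]) (delta0 sigma : R) : 0 < sigma -> localized f ->
  (forall l, L2norm mu (fun x => f l x - h l x) <= delta0) ->
  exists f' : I -> X -> R[i], localized f' /\ forall l, L2norm mu (fun x => f' l x - h l x) <=
    (1 - A / B) * delta0 + sigma.
Proof.
have B_gt0 := upper_bound_gt0.
move=> sigma0 loc_f fh; have [Lf _ tf] := loc_f.
(* The discarded coefficients get norm at most [sigma] times the root of [B]; pairing with an
   analysis sequence costs another root of [B], and the factor [B^-1] leaves [sigma]. *)
have eta0 : 0 < sigma ^+ 2 * B by rewrite mulr_gt0 // exprn_gt0.
have [N hN] := tf _ eta0; have [K [b hb]] := ball_enum N.
pose u l x : R[i] := \sum_(j <- b l) analysis (f l) j * e j x.
have loc_u : localized u := localized_synthesis loc_f hb.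
have Lu l : L2 mu (u l) by case: loc_u.
pose tau : R[i] := (B^-1)%:C.
pose f' l x := (f l x + tau * e l x) + - tau * u l x.
exists f'; split; first by apply: localizedDZ => //; exact: localizedDZ.
move=> l; have [us _ inb] := hb l.
pose E x := f l x - h l x; pose E' x := f' l x - h l x.
have LE : L2 mu E by exact: L2B.
have Lf'l : L2 mu (f' l) by apply: L2D; [apply: L2D => //|]; exact: L2Z.
have LE' : L2 mu E' by exact: L2B.
pose a := analysis (f l).
pose aF i : R[i] := if i \in b l then a i else 0.
pose r i : R[i] := if i \in b l then 0 else a i.
have la : ell2 a by exact: ell2_analysis.
have laF : ell2 aF.
  by apply: ell2_le la => i; rewrite /aF; case: ifP => // _; rewrite csq0 csq_ge0.
have lr : ell2 r.
  by apply: ell2_le la => i; rewrite /r; case: ifP => // _; rewrite csq0 csq_ge0.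
have rsmall : sqsum r <= sigma ^+ 2 * B.
  rewrite -lee_fin sqsumK //; apply: esum_le_sum => s us' _.
  rewrite (bigID (mem (b l))) /= big1 ?add0r; last first.
    by move=> i ib; rewrite /r ib csq0.
  rewrite -big_filter; apply: le_trans (hN l [seq i <- s | i \notin b l] _ _).
  - rewrite !big_filter; apply: ler_sum => i ib; rewrite /r (negPf ib) //.
  - exact: filter_uniq.
  - by move=> j; rewrite mem_filter inb -ltNge => /andP[].
(* The error equation in weak form: the new error is [I - S / B] applied to the old one, plus [B^-1]
   times the synthesis of the discarded coefficients [r]. *)
have key phi : L2 mu phi -> cRe (L2dot mu E' phi) =
    frame_defect E phi + B^-1 * Re_ell2dot r (analysis phi).
  move=> Lphi; have lphi := ell2_analysis Lphi.
  have e1 : cRe (L2dot mu (u l) phi) = Re_ell2dot aF (analysis phi).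
    rewrite /u (L2dot_suml (b l) (analysis (f l)) L2e Lphi) raddf_sum /Re_ell2dot (rsum_seq us).
      rewrite !big_seq; apply: eq_bigr => i ib.
      by rewrite /aF ib /analysis (L2dotC Lphi (L2e i)).
    by move=> i /negPf ib; rewrite /aF ib mul0r.
  have e2 : Re_ell2dot a (analysis phi) =
      Re_ell2dot aF (analysis phi) + Re_ell2dot r (analysis phi).
    rewrite -(Re_ell2dotDl laF lr lphi); congr (Re_ell2dot _ (analysis phi)); apply/funext => i.
    by rewrite /aF /r; case: ifP => _; rewrite ?addr0 ?add0r.
  have e3 : Re_ell2dot (analysis E) (analysis phi) =
      Re_ell2dot a (analysis phi) - cRe (L2dot mu (e l) phi).
    rewrite -(Re_ell2dot_h l Lphi) -(Re_ell2dotBl la (ell2_analysis (L2h l)) lphi).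
    by congr (Re_ell2dot _ (analysis phi)); apply/funext => i; rewrite /analysis (L2dotBl (Lf l) (L2h l) (L2e i)).
  have e4 : L2dot mu E' phi = L2dot mu E phi + tau * L2dot mu (e l) phi - tau * L2dot mu (u l) phi.
    have Lte := L2Z tau (L2e l); have Ltu := L2Z (- tau) (Lu l).
    rewrite (L2dotBl Lf'l (L2h l) Lphi) (L2dotBl (Lf l) (L2h l) Lphi).
    rewrite (L2dotDl (L2D (Lf l) Lte) Ltu Lphi) (L2dotDl (Lf l) Lte Lphi).
    by rewrite (L2dotZl tau (L2e l) Lphi) (L2dotZl (- tau) (Lu l) Lphi); ring.
  rewrite e4 /frame_defect e3 e2 -e1 /tau.
  case: (L2dot mu E phi) (L2dot mu (e l) phi) (L2dot mu (u l) phi) => x1 y1 [x2 y2] [x3 y3] /=.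
  by ring.
have n' := L2norm_sqr mu E'.
(* The error equation is tested against [E'] itself, and one factor of its norm cancels at the
   end. *)
have : L2norm mu E' ^+ 2 <= ((1 - A / B) * delta0 + sigma) * L2norm mu E'.
  rewrite {1}n' (L2normsqE LE') (key _ LE').
  have nE := L2norm_ge0 mu E; have nE' := L2norm_ge0 mu E'.
  have rho0 := contraction_ge0.
  have p1 : frame_defect E E' <= (1 - A / B) * (delta0 * L2norm mu E').
    apply: le_trans (frame_defect_le LE LE') _; rewrite ler_wpM2l // ler_wpM2r //; exact: fh.
  have p2 : Re_ell2dot r (analysis E') <= sigma * B * L2norm mu E'.
    have : Re_ell2dot r (analysis E') ^+ 2 <= (sigma * B * L2norm mu E') ^+ 2.
      apply: le_trans (Re_ell2dot_sqr_le lr (ell2_analysis LE')) _.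
      have -> : (sigma * B * L2norm mu E') ^+ 2 = (sigma ^+ 2 * B) * (B * L2normsq mu E').
        by rewrite -n'; ring.
      by apply: ler_pM; rewrite ?sqsum_ge0 // frame_upper.
    have q0 : 0 <= sigma * B * L2norm mu E' by rewrite !mulr_ge0 // ltW.
    by move=> sq; rewrite leNgt; apply/negP => lt; move: sq; rewrite leNgt ltrXn2r ?nnegrE // ltW // (le_lt_trans q0).
  have p3 : B^-1 * Re_ell2dot r (analysis E') <= sigma * L2norm mu E'.
    by rewrite mulrC ler_pdivrMr // mulrAC.
  rewrite mulrDl -mulrA; exact: lerD.
have := L2norm_ge0 mu E'; rewrite -/E' le_eqVlt => /predU1P[<- _|n0].
  apply: addr_ge0; last exact: ltW.
  apply: mulr_ge0; first exact: contraction_ge0.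
  by apply: le_trans (fh l); exact: L2norm_ge0.
by rewrite expr2 ler_pM2r.
Qed.

Lemma localized_dual : localized h.
Proof.
have B_gt0 := upper_bound_gt0.
pose ok (c : R) := exists f : I -> X -> R[i], localized f /\
  forall l, L2norm mu (fun x => f l x - h l x) <= c.
pose H := Num.sqrt A^-1 + 1.
have H0 : 0 < H by rewrite ltr_wpDl // sqrtr_ge0.
have okH : ok H.
  exists (fun _ _ => 0); split; first exact: localized0.
  move=> l; under eq_fun do rewrite sub0r.
  rewrite /L2norm L2normsqN (@le_trans _ _ (Num.sqrt A^-1)) ?lerDl //.
  by apply: ler_wsqrtr; exact: h_bounded.
(* Midway between the contraction factor [1 - A / B] and 1: each step spends the remaining half of
   the gap on truncation. *)
pose q := 1 - A / B / 2.
have AB0 : 0 < A / B by rewrite divr_gt0.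
have AB1 : A / B <= 1 by rewrite ler_pdivrMr // mul1r.
have q0 : 0 < q by rewrite /q; lra.
have q1 : q < 1 by rewrite /q; lra.
have okq n : ok (q ^+ n * H).
  elim: n => [|n [f [loc_f hf]]]; first by rewrite mul1r.
  have c0 : 0 < q ^+ n * H by rewrite mulr_gt0 // exprn_gt0.
  have s0 : 0 < A / B / 2 * (q ^+ n * H) by rewrite mulr_gt0 // divr_gt0.
  have [f' [loc_f' hf']] := richardson_step s0 loc_f hf.
  exists f'; split => // l; apply: le_trans (hf' l) _.
  rewrite exprS -[q * _ * H]mulrA /q; move: (q ^+ n * H) => c; lra.
have small c : 0 < c -> ok c.
  move=> c0; have : `|q| < 1 by rewrite ger0_norm // ltW.
  move=> /cvg_expr /cvgr0_norm_lt /(_ _ (divr_gt0 c0 H0))[n _ /(_ n (leqnn n))] /=.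
  rewrite ger0_norm ?exprn_ge0 ?(ltW q0) // ltr_pdivlMr // => qn.
  have [f [loc_f hf]] := okq n; exists f; split => // l.
  by apply: le_trans (hf l) _; exact: ltW.
split => //.
  by exists A^-1 => l; exact: h_bounded.
move=> eps eps0.
have c0 : 0 < Num.sqrt (eps / (4 * B)) by rewrite sqrtr_gt0 divr_gt0 // mulr_gt0.
have [f [[Lf _ tf] hf]] := small _ c0.
have e4 : 0 < eps / 4 by rewrite divr_gt0.
have [N hN] := tf _ e4; exists N => l s us far.
apply: (@le_trans _ _ (\sum_(j <- s)
   (2 * csq (analysis (fun x => f l x - h l x) j) + 2 * csq (analysis (f l) j)))).
  apply: ler_sum => j _; rewrite /analysis L2dotBl //.
  have := csqB_le (L2dot mu (f l) (e j)) (L2dot mu (f l) (e j) - L2dot mu (h l) (e j)).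
  by rewrite subKr; lra.
rewrite big_split -!mulr_sumr /=.
have h1 := hN l s us far; have h2 := bessel_seq (L2B (Lf l) (L2h l)) us.
have h3 : L2normsq mu (fun x => f l x - h l x) <= eps / (4 * B).
  have e0 : 0 <= eps / (4 * B) by rewrite divr_ge0 // ltW // mulr_gt0.
  rewrite -L2norm_sqr -(sqr_sqrtr e0) lerXn2r ?nnegrE ?L2norm_ge0 ?sqrtr_ge0 //.
have h4 : B * L2normsq mu (fun x => f l x - h l x) <= eps / 4.
  apply: le_trans (ler_wpM2l (ltW upper_bound_gt0) h3) _.
  by rewrite le_eqVlt; apply/orP; left; apply/eqP; field; rewrite gt_eqF.
lra.
Qed.

End FrameLocalization.

(** * Gram projections of Gabor frames *)

Section Hermitian.
Variables (R : realType) (I : countType).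

(** Multiplication by [i] is skew for the real inner product; this gives the imaginary half of
    Hermitian symmetry. *)
Lemma Re_ell2dot_i_anti (c v : I -> R[i]) :
  Re_ell2dot c (fun i => 'i * v i) = - Re_ell2dot v (fun i => 'i * c i).
Proof.
rewrite -rsumN; congr rsum; apply/funext => i; rewrite !conjE.
by case: (c i) (v i) => x y [z w] /=; ring.
Qed.

End Hermitian.

Section GaborFrames.
Variables (R : realType) (m : nat) (mu : {measure set (m.-tuple R) -> \bar R}).
Local Notation X := (m.-tuple R).
Hypothesis mu_leb : is_lebesgue_Rm mu.

Lemma csq_L2dot_phase (f g : X -> R[i]) (q : R) (k : X * X) :
  L2 mu f -> L2 mu g ->
  csq (L2dot mu f (gabor_atom g q k)) = csq (L2dot mu f (gabor_atom g 0 k)).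
Proof.
move=> Lf Lg; rewrite -{1}(gabor_origin f) csq_L2dot_gabor //.
by rewrite /subP /origin /= !subT0 -surjective_pairing.
Qed.

(** With a nonzero function at hand, the lower frame bound forces [g] to be nonzero. *)
Lemma ex_L2_normsq1 : exists2 f, L2 mu f & L2normsq mu f = 1.
Proof.
pose Q := cbox (cst_tuple m (0 : R)) (cst_tuple m 1).
have mQ : measurable Q := measurable_cbox _ _.
exists (fun x => (\1_Q x)%:C).
  exact: (L2_indic_sub mu_leb mQ (@subset_refl _ _)).
rewrite /L2normsq /Rintegral (eq_integral (fun x => (\1_Q x)%:E)); last first.
  move=> x _; rewrite csq_real indicE; case: (_ \in _) => /=.
  - by rewrite expr1n.
  - by rewrite expr0n.
rewrite integral_indic // setIT mu_cbox //=; last first.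
  by move=> i; rewrite !tnth_mktuple ler01.
by rewrite big1 // => i _; rewrite !tnth_mktuple subr0.
Qed.

End GaborFrames.

Theorem theorem9p6 (R : realType) (m : nat)
    (mu : {measure set (m.-tuple R) -> \bar R})
    (I : countType) (lam : I -> m.-tuple R * m.-tuple R) (ph : I -> R)
    (g : m.-tuple R -> R[i]) (P : (I -> R[i]) -> (I -> R[i])) :
  is_lebesgue_Rm mu ->
  L2 mu g ->
  is_frame mu (fun l => gabor_atom g (ph l) (lam l)) ->
  is_gram_projection mu (fun l => gabor_atom g (ph l) (lam l)) P ->
  nonexpansive (fun l l' => dinf (lam l) (lam l')) P.
Proof.
move=> mu_leb Lg [A0 [B [A0_gt0 B_gt0 frame]]] proj.
pose e l := gabor_atom g (ph l) (lam l).
have Le l : L2 mu (e l) by exact: L2_gabor.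
pose T := analysis mu e.
have ell2T f : L2 mu f -> ell2 (T f).
  by move=> Lf; have [_ h] := frame f Lf; apply: le_lt_trans h (ltry _).
(* Enforces [A <= B], so that [1 - A / B] is nonnegative, while keeping a valid lower frame
   bound. *)
pose A := Num.min A0 B.
have A_gt0 : 0 < A by rewrite lt_min A0_gt0.
have AB : A <= B by rewrite ge_min lexx orbT.
have lower f : L2 mu f -> A * L2normsq mu f <= sqsum (T f).
  move=> Lf; have [h _] := frame f Lf; rewrite -lee_fin sqsumK; last exact: ell2T.
  apply: le_trans h; rewrite lee_fin ler_wpM2r ?L2normsq_ge0 //.
  by rewrite ge_min lexx.
have upper f : L2 mu f -> sqsum (T f) <= B * L2normsq mu f.
  by move=> Lf; have [_ h] := frame f Lf; rewrite -lee_fin sqsumK //; exact: ell2T.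
have g_neq0 : 0 < L2normsq mu g.
  rewrite lt_neqAle L2normsq_ge0 andbT; apply/eqP => g0.
  have [f Lf f1] := ex_L2_normsq1 mu_leb.
  have := lower f Lf; rewrite f1 mulr1 leNgt => /negP; apply.
  rewrite /sqsum esum1 //= => i _; congr EFin; apply/eqP; rewrite eq_le csq_ge0 andbT.
  have := L2_Cauchy_Schwarz Lf (Le i).
  by rewrite (L2normsq_gabor mu_leb (ph i) (lam i) Lg) -g0 mulr0.
have bessel f (s : seq I) : L2 mu f -> uniq s ->
    \sum_(j <- s) csq (L2dot mu f (gabor_atom g 0 (lam j))) <= B * L2normsq mu f.
  move=> Lf us; apply: le_trans (upper f Lf).
  under eq_bigr => j _ do rewrite -(csq_L2dot_phase mu_leb (ph j) (lam j) Lf Lg).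
  rewrite -lee_fin sqsumK; last exact: ell2T.
  by apply: (@sum_le_esum _ _ setT (fun j => csq (T f j))) => // i; exact: csq_ge0.
pose d l l' := dinf (lam l) (lam l').
have loc_e : localized mu e d e.
  split => //.
  - by exists (L2normsq mu g) => l; rewrite L2normsq_gabor.
  - move=> eps eps0.
    have [_ tail] := uniform_tail_L2 mu_leb B_gt0 Lg bessel g_neq0 Lg.
    have [N hN] := tail eps eps0; exists N => l s us far.
    under eq_bigr => j _ do rewrite /analysis /e csq_L2dot_gabor //.
    exact: hN.
have balls := ball_count mu_leb Lg bessel g_neq0.
(* The dual frame is read off from the range condition on the projection, so no inverse of the frame
   operator is formed. *)
have /choice[h hP] : forall l, exists f, L2 mu f /\ P (delta R l) = T f.
  by move=> l; have [[f [Lf Pf]] _] := proj _ (ell2_delta R l); exists f.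
have Lh l : L2 mu (h l) by case: (hP l).
have orth l f : L2 mu f ->
    Re_ell2dot (fun i => delta R l i - T (h l) i) (T f) = 0.
  move=> Lf; have [_ orth] := proj _ (ell2_delta R l).
  have /orth : analysis_range mu e (T f) by exists f.
  by have [_ ->] := hP l; move=> /(congr1 (@complex.Re R)).
have [_ _ tail] : localized mu e d h.
  apply: (localized_dual (A := A) (B := B) (G := L2normsq mu g)) => //.
  - by move=> i j k; exact: dinf_triangle.
  - by move=> j; rewrite L2normsq_gabor.
(* Rows of the projection act as a reproducing kernel on the range of the analysis operator; applied
   to [f = h l'] this yields the symmetry of the matrix. *)
have ReT l f : L2 mu f -> cRe (T f l) = Re_ell2dot (T (h l)) (T f).
  move=> Lf; rewrite -Re_ell2dot_delta; apply/eqP; rewrite -subr_eq0; apply/eqP.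
  by rewrite -(Re_ell2dotBl (ell2_delta R l) (ell2T _ (Lh l)) (ell2T _ Lf)) orth.
have Ti f : L2 mu f -> T (fun x => 'i * f x) = fun i => 'i * T f i.
  by move=> Lf; apply/funext => i; rewrite /T /analysis L2dotZl.
have hermitian l l' : csq (T (h l) l') = csq (T (h l') l).
  have re : cRe (T (h l) l') = cRe (T (h l') l) by rewrite (ReT l' _ (Lh l)) (ReT l _ (Lh l')) Re_ell2dotC.
  have im : cIm (T (h l) l') = - cIm (T (h l') l).
    have ImT k f : L2 mu f -> cIm (T f k) = - Re_ell2dot (T (h k)) (fun i => 'i * T f i).
      move=> Lf; rewrite -(Ti f Lf) -(ReT k _ (L2Z 'i Lf)) (Ti f Lf).
      by case: (T f k) => x y /=; ring.
    by rewrite (ImT l' _ (Lh l)) (ImT l _ (Lh l')) Re_ell2dot_i_anti.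
  by rewrite /csq re im sqrrN.
have row (M : I -> I -> R[i]) : (forall l l', csq (M l l') = csq (T (h l) l')) ->
    row_nonexpansive d M.
  move=> MT eps eps0; have e2 : 0 < eps / 2 by rewrite divr_gt0.
  have [N hN] := tail _ e2; exists N => l.
  apply: (@le_lt_trans _ _ (eps / 2)%:E); last by rewrite lte_fin; lra.
  apply: esum_le_sum => s us far; under eq_bigr do rewrite MT.
  by apply: hN => // j js; rewrite ltNge; apply/negP; exact: far.
split; apply: row => l l'.
- by rewrite /op_entries; have [_ ->] := hP l.
- by rewrite /adj_entries csq_conj /op_entries hermitian; have [_ ->] := hP l'.
Qed.
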